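(* Let $G$ be a connected Lie group and let $\Sigma_G$ be a linear control system on $G$ satisfying the Lie algebra rank condition (LARC). Let $G^0$, $G^-$ and $G^{-,0}=G^-G^0$ be the dynamical subgroups associated with the drift of $\Sigma_G$. Then the following conditions are equivalent: 1. $G=G^{-,0}$ and $G^0$ is a compact subgroup; 2. $\mathcal{O}^+(e)$ is bounded; 3. for every $u\in\mathcal{U}$, the trajectory $\{\phi(t,e,u) : t\geq 0\}$ is bounded.
   Context: Let $G$ be a connected Lie group with identity $e$ and Lie algebra $\mathfrak{g}$ (identified with the right-invariant vector fields). A subset of $G$ is bounded if its closure is compact. A vector field $\mathcal{X}$ on $G$ is linear if its flow $\{\varphi_t\}_{t\in\mathbb{R}}$ is a one-parameter group of automorphisms of $G$. Associated with it is a derivation $\mathcal{D}$ of $\mathfrak{g}$ with $(d\varphi_t)_e=\mathrm{e}^{t\mathcal{D}}$ for all $t\in\mathbb{R}$. Jordan decomposition: a linear map on a finite-dimensional real vector space is semisimple if its complexification is diagonalizable; it is elliptic (resp. hyperbolic) if it is semisimple with all eigenvalues purely imaginary, $0$ allowed (resp. real). Write $\mathcal{D}=\mathcal{D}_{\mathcal{E}}+\mathcal{D}_{\mathcal{H}}+\mathcal{D}_{\mathcal{N}}$ for the unique decomposition into commuting elliptic, hyperbolic and nilpotent parts; all three are derivations. There are unique commuting linear vector fields $\mathcal{X}_{\mathcal{E}},\mathcal{X}_{\mathcal{H}},\mathcal{X}_{\mathcal{N}}$ on $G$ with these derivations and $\mathcal{X}=\mathcal{X}_{\mathcal{E}}+\mathcal{X}_{\mathcal{H}}+\mathcal{X}_{\mathcal{N}}$;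 denote by $\varphi^{\mathcal{E}},\varphi^{\mathcal{H}},\varphi^{\mathcal{N}}$ their flows, so $\varphi_t=\varphi_t^{\mathcal{E}}\circ\varphi_t^{\mathcal{H}}\circ\varphi_t^{\mathcal{N}}$. Dynamical subgroups: let $\mathfrak{g}^-$ be the sum of the eigenspaces of $\mathcal{D}_{\mathcal{H}}$ with negative eigenvalue (a nilpotent subalgebra). Set $G^0=\{g\in G:\varphi^{\mathcal{H}}_t(g)=g\ \forall t\in\mathbb{R}\}$, $G^-=\exp(\mathfrak{g}^-)$, $G^{-,0}=G^-G^0$ (these are closed subgroups). A linear control system $\Sigma_G$ on $G$ is the family of ODEs $\dot g(t)=\mathcal{X}(g(t))+\sum_{i=1}^m u_i(t)Y^i(g(t))$, where $\mathcal{X}$ (the drift) is a linear vector field, $Y^1,\dots,Y^m$ are right-invariant vector fields, and $u=(u_1,\dots,u_m)\in\mathcal{U}$, the set of piecewise constant functions $u:\mathbb{R}\to\mathbb{R}^m$ with values in a fixed compact convex set $\Omega\subset\mathbb{R}^m$ with $0\in\operatorname{int}\Omega$. The solution with initial value $x$ and control $u$ is $t\mapsto\phi(t,x,u)$, defined for all $t\in\mathbb{R}$. The positive orbit of $x$ is $\mathcal{O}^+(x)=\{\phi(t,x,u): t>0,\ u\in\mathcal{U}\}$. LARC: $\mathfrak{g}$ is the smallest $\mathcal{D}$-invariant Lie subalgebra containing $Y^1,\dots,Y^m$. *)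

(* Defs.v *)
From HB Require Import structures.
From mathcomp Require Import all_boot all_order all_algebra.
From mathcomp Require Import complex.
From mathcomp Require Import all_classical all_reals all_analysis.

Set Implicit Arguments.
Unset Strict Implicit.
Unset Printing Implicit Defensive.
Import Order.TTheory GRing.Theory Num.Theory.
Import numFieldNormedType.Exports.
Local Open Scope classical_set_scope.
Local Open Scope ring_scope.

(** * Smooth maps between open subsets of normed spaces *)

(* [f] is only looked at on [U], which is meant to be open; in finite dimension
   this is the usual notion of a function of class C^k. *)
Fixpoint classC {R : realType} {V W : normedModType R} (k : nat) (U : set V)
    (f : V -> W) : Prop :=
  match k with
  | 0 => forall x, U x -> {for x, continuous f}
  | k'.+1 => (forall x, U x -> differentiable f x) /\
             (forall v, classC k' U ('D_v f))
  end.

Definition smooth_on {R : realType} {V W : normedModType R} (U : set V)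
    (f : V -> W) : Prop :=
  forall k, classC k U f.

(** * Smooth manifolds and Lie groups *)

Record chart (R : realType) (n : nat) (M : Type) := Chart {
  chart_dom : set M;
  chart_map : M -> 'rV[R]_n;
  chart_inv : 'rV[R]_n -> M }.

Definition chart_cod {R : realType} {n : nat} {M : Type} (a : chart R n M) :
  set 'rV[R]_n := chart_map a @` chart_dom a.

Record is_chart {R : realType} {n : nat} {M : topologicalType}
    (a : chart R n M) : Prop := {
  chart_dom_open : open (chart_dom a);
  chart_cod_open : open (chart_cod a);
  chart_mapK : forall x, chart_dom a x -> chart_inv a (chart_map a x) = x;
  chart_map_continuous : {within chart_dom a, continuous (chart_map a)};
  chart_inv_continuous : {within chart_cod a, continuous (chart_inv a)} }.

Section SmoothMaps.
Context {R : realType} {n : nat} {M : topologicalType}.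
Variable atlas : set (chart R n M).

Definition smooth_fun (f : M -> R) : Prop :=
  forall a, atlas a -> smooth_on (chart_cod a) (f \o chart_inv a).

Definition smooth_map (F : M -> M) : Prop :=
  continuous F /\
  forall a b, atlas a -> atlas b ->
    smooth_on [set x | chart_cod a x /\ chart_dom b (F (chart_inv a x))]
              (fun x => chart_map b (F (chart_inv a x))).

(* smoothness of a map from the product manifold M * M to M *)
Definition smooth_map2 (F : M -> M -> M) : Prop :=
  continuous (fun p : M * M => F p.1 p.2) /\
  forall a b c, atlas a -> atlas b -> atlas c ->
    smooth_on
      [set z : 'rV[R]_n * 'rV[R]_n |
        [/\ chart_cod a z.1, chart_cod b z.2 &
            chart_dom c (F (chart_inv a z.1) (chart_inv b z.2))]]
      (fun z => chart_map c (F (chart_inv a z.1) (chart_inv b z.2))).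

(* Smoothness of the identity says that all transition maps are smooth. *)
Record smooth_atlas : Prop := {
  atlas_chart : forall a, atlas a -> is_chart a;
  atlas_cover : forall x, exists2 a, atlas a & chart_dom a x;
  atlas_compatible : smooth_map id }.

End SmoothMaps.

HB.mixin Record isLieGroup (R : realType) (n : nat) G
    of Group G & Topological G := {
  lie_atlas : set (chart R n G);
  lie_hausdorff : hausdorff_space G;
  lie_second_countable : @second_countable G;
  lie_smooth_atlas : smooth_atlas lie_atlas;
  lie_smooth_mul : smooth_map2 lie_atlas (fun x y : G => (x * y)%g);
  lie_smooth_inv : smooth_map lie_atlas (fun x : G => (x^-1)%g) }.

#[short(type="lieGroupType")]
HB.structure Definition LieGroup (R : realType) (n : nat) :=
  {G of Group G & Topological G & isLieGroup R n G}.

Section LieGroupTheory.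
Context {R : realType} {n : nat} {G : lieGroupType R n}.

Definition smoothG (f : G -> R) : Prop := smooth_fun (@lie_atlas R n G) f.

Definition lie_automorphism (F : G -> G) : Prop :=
  {morph F : x y / (x * y)%g} /\
  exists F', [/\ cancel F F', cancel F' F,
                 smooth_map (@lie_atlas R n G) F &
                 smooth_map (@lie_atlas R n G) F'].

(** * Vector fields *)

(* Vector fields are the derivations of the algebra of smooth functions. An
   operator is given the value 0 at the functions that are not smooth, so that
   Leibniz equality of operators is equality of vector fields. *)
Definition operator : Type := (G -> R) -> (G -> R).

Record vector_field (X : operator) : Prop := {
  vf_smooth : forall f, smoothG f -> smoothG (X f);
  vf_junk : forall f, ~ smoothG f -> X f = 0;
  vf_linear : forall (a : R) f h, smoothG f -> smoothG h ->
    X (fun x => a * f x + h x) = (fun x => a * X f x + X h x);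
  vf_leibniz : forall f h, smoothG f -> smoothG h ->
    X (fun x => f x * h x) = (fun x => f x * X h x + X f x * h x) }.

Definition bracket (X Y : operator) : operator :=
  fun f x => X (Y f) x - Y (X f) x.

Definition lincomb {k : nat} (c : 'I_k -> R) (b : 'I_k -> operator) : operator :=
  fun f x => \sum_(i < k) c i * b i f x.

(* the Lie algebra of G: [Y] commutes with the right translations *)
Definition right_invariant (Y : operator) : Prop :=
  vector_field Y /\
  forall (g : G) (f : G -> R), smoothG f ->
    Y (fun x => f (x * g)%g) = (fun x => Y f (x * g)%g).

Definition velocity (gamma : R -> G) (t : R) (v : (G -> R) -> R) : Prop :=
  forall f : G -> R, smoothG f ->
    is_derive t (1 : R) (fun s => f (gamma s) : R) (v f).

Definition integral_curve (X : operator) (gamma : R -> G) : Prop :=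
  continuous gamma /\ forall t, velocity gamma t (fun f => X f (gamma t)).

Definition exp_image (h : set operator) : set G :=
  [set g | exists2 Y, h Y & exists gamma : R -> G,
    [/\ integral_curve Y gamma, gamma 0 = 1%g & gamma 1 = g]].

(** * Linear maps on the Lie algebra *)

Definition lie_linear (D : operator -> operator) : Prop :=
  (forall Y, right_invariant Y -> right_invariant (D Y)) /\
  (forall (a : R) Y Z, right_invariant Y -> right_invariant Z ->
     D (fun f x => a * Y f x + Z f x) = (fun f x => a * D Y f x + D Z f x)).

Definition lie_derivation (D : operator -> operator) : Prop :=
  lie_linear D /\
  forall Y Z, right_invariant Y -> right_invariant Z ->
    D (bracket Y Z) =
    (fun f x => bracket (D Y) Z f x + bracket Y (D Z) f x).

Definition lie_basis {k : nat} (b : 'I_k -> operator) : Prop :=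
  (forall i, right_invariant (b i)) /\
  (forall Y, right_invariant Y ->
     exists! c : 'rV[R]_k, Y = lincomb (fun i => c 0 i) b).

(* The rows of the matrix are the coordinates of the images of the basis
   vectors, in accordance with MathComp's row-vector convention. *)
Definition lie_matrix {k : nat} (b : 'I_k -> operator)
    (D : operator -> operator) (A : 'M[R]_k) : Prop :=
  forall i, D (b i) = lincomb (fun j => A i j) b.

Definition semisimple_with (P : R[i] -> Prop) (D : operator -> operator) : Prop :=
  exists (k : nat) (b : 'I_k -> operator) (A : 'M[R]_k),
    let AC : 'M[R[i]]_k := map_mx (fun x => x%:C)%C A in
    [/\ lie_basis b, lie_matrix b D A, diagonalizable AC &
        forall z, eigenvalue AC z -> P z].

Definition elliptic : (operator -> operator) -> Prop :=
  semisimple_with (fun z => complex.Re z = 0).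

Definition hyperbolic : (operator -> operator) -> Prop :=
  semisimple_with (fun z => complex.Im z = 0).

Definition lie_nilpotent (D : operator -> operator) : Prop :=
  exists k, forall Y, right_invariant Y -> iter k D Y = (fun _ _ => 0).

Definition lie_commute (D D' : operator -> operator) : Prop :=
  forall Y, right_invariant Y -> D (D' Y) = D' (D Y).

Definition lie_subalgebra (h : set operator) : Prop :=
  [/\ h `<=` right_invariant,
      h (fun _ _ => 0),
      forall (a : R) Y Z, h Y -> h Z -> h (fun f x => a * Y f x + Z f x) &
      forall Y Z, h Y -> h Z -> h (bracket Y Z)].

(* sum of the eigenspaces of [D] for the negative eigenvalues *)
Definition negative_part (D : operator -> operator) : set operator :=
  [set Y | exists (k : nat) (lambda : 'I_k -> R) (Z : 'I_k -> operator),
    (forall i, [/\ lambda i < 0, right_invariant (Z i) &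
                   D (Z i) = (fun f x => lambda i * Z i f x)]) /\
    Y = lincomb (fun=> 1) Z].

End LieGroupTheory.

Arguments operator {R n} G.

(** * Linear vector fields *)

(* [lf_differential] is the identity (d phi_t)_e = exp (t D), evaluated at a
   right-invariant vector field [Y] (identified with its value at e) and at a
   smooth function [f]. It determines [lf_der] on the Lie algebra. *)
Record linear_field (R : realType) (n : nat) (G : lieGroupType R n) :=
  LinearField {
  lf_field : operator G;
  lf_flow : R -> G -> G;
  lf_der : operator G -> operator G;
  lf_vector_field : vector_field lf_field;
  lf_flowP : forall g, integral_curve lf_field (fun t => lf_flow t g);
  lf_flow0 : forall g, lf_flow 0 g = g;
  lf_flowD : forall s t g, lf_flow (s + t) g = lf_flow s (lf_flow t g);
  lf_automorphism : forall t, lie_automorphism (lf_flow t);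
  lf_derivation : lie_derivation lf_der;
  lf_differential : forall (t : R) (Y : operator G) (f : G -> R),
    right_invariant Y -> smoothG f ->
    series (fun k : nat => (exp_coeff t k * iter k lf_der Y f 1%g : R)) @ \oo
      --> (Y (fun x => f (lf_flow t x)) 1%g : R) }.

(* Both the decomposition of the derivation on the Lie algebra and the linear
   vector fields on the group that realise it; these data exist and are unique. *)
Record jordan_decomposition (R : realType) (n : nat) (G : lieGroupType R n)
    (X : linear_field G) := JordanDecomposition {
  ell_part : linear_field G;
  hyp_part : linear_field G;
  nil_part : linear_field G;
  ell_part_elliptic : elliptic (lf_der ell_part);
  hyp_part_hyperbolic : hyperbolic (lf_der hyp_part);
  nil_part_nilpotent : lie_nilpotent (lf_der nil_part);
  parts_der_commute : [/\ lie_commute (lf_der ell_part) (lf_der hyp_part),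
                          lie_commute (lf_der ell_part) (lf_der nil_part) &
                          lie_commute (lf_der hyp_part) (lf_der nil_part)];
  parts_der_sum : forall Y, right_invariant Y ->
    lf_der X Y = (fun f x => lf_der ell_part Y f x + lf_der hyp_part Y f x
                             + lf_der nil_part Y f x);
  parts_commute :
    [/\ bracket (lf_field ell_part) (lf_field hyp_part) = (fun _ _ => 0),
        bracket (lf_field ell_part) (lf_field nil_part) = (fun _ _ => 0) &
        bracket (lf_field hyp_part) (lf_field nil_part) = (fun _ _ => 0)];
  parts_sum : lf_field X =
    (fun f x => lf_field ell_part f x + lf_field hyp_part f x
                + lf_field nil_part f x) }.

Section DynamicalSubgroups.
Context {R : realType} {n : nat} {G : lieGroupType R n} {X : linear_field G}.
Variable J : jordan_decomposition X.

Definition G0 : set G := [set g | forall t, lf_flow (hyp_part J) t g = g].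

Definition Gminus : set G := exp_image (negative_part (lf_der (hyp_part J))).

Definition Gminus0 : set G :=
  [set g | exists x y, [/\ Gminus x, G0 y & g = (x * y)%g]].

End DynamicalSubgroups.

(** * Linear control systems *)

Definition switching_times {R : realType} {T : Type} (u : R -> T) : set R :=
  [set t | ~ \forall s \near t, u s = u t].

(* finitely many switchings on each compact interval; the values taken at the
   switching times themselves play no role in [is_solution] *)
Definition piecewise_constant {R : realType} {T : Type} (u : R -> T) : Prop :=
  forall a b : R, finite_set (switching_times u `&` `[a, b]).

Definition admissible {R : realType} {m : nat} (Omega : set 'rV[R]_m) :
  set (R -> 'rV[R]_m) :=
  [set u | piecewise_constant u /\ forall t, Omega (u t)].

Definition is_solution {R : realType} {n m : nat} {G : lieGroupType R n}
    (X : operator G) (Y : 'I_m -> operator G) (u : R -> 'rV[R]_m) (x : G)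
    (gamma : R -> G) : Prop :=
  [/\ continuous gamma, gamma 0 = x &
      forall t, ~ switching_times u t ->
        velocity gamma t (fun f =>
          X f (gamma t) + \sum_(i < m) u t 0 i * Y i f (gamma t))].

Record linear_control_system (R : realType) (n m : nat)
    (G : lieGroupType R n) := LinearControlSystem {
  drift : linear_field G;
  control_field : 'I_m -> operator G;
  control_range : set 'rV[R]_m;
  trajectory : R -> G -> (R -> 'rV[R]_m) -> G;
  control_field_right_invariant : forall i, right_invariant (control_field i);
  control_range_compact : compact control_range;
  control_range_convex :
    convex_set (control_range : set (convex_lmodType 'rV[R]_m));
  control_range_interior : interior control_range 0;
  trajectoryP : forall x u, admissible control_range u ->
    is_solution (lf_field drift) control_field u x (fun t => trajectory t x u) }.

Section ControlNotions.
Context {R : realType} {n m : nat} {G : lieGroupType R n}.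
Variable S : linear_control_system m G.

Definition controls : set (R -> 'rV[R]_m) := admissible (control_range S).

Definition LARC : Prop :=
  right_invariant =
  smallest [set h : set (operator G) |
             lie_subalgebra h /\ forall Y, h Y -> h (lf_der (drift S) Y)]
           (range (control_field S)).

Definition positive_orbit (x : G) : set G :=
  [set g | exists t u, [/\ 0 < t, controls u & g = trajectory S t x u]].

End ControlNotions.

Definition bounded_subset {T : topologicalType} (A : set T) : Prop :=
  compact (closure A).

Definition is_subgroup {T : groupType} (A : set T) : Prop :=
  A 1%g /\ forall x y, A x -> A y -> A (x * y^-1)%g.

(* Main.v *)
Require Import Defs.
From HB Require Import structures.
From mathcomp Require Import all_boot all_order all_algebra.
From mathcomp Require Import complex.
From mathcomp Require Import all_classical all_reals all_analysis.
From mathcomp Require Import ring lra.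

Set Implicit Arguments.
Unset Strict Implicit.
Unset Printing Implicit Defensive.
Import Order.TTheory GRing.Theory Num.Theory.
Import numFieldNormedType.Exports.
Local Open Scope classical_set_scope.
Local Open Scope ring_scope.

(** Write [phi] for the flow of the drift, [phiH] for its hyperbolic part.

    (1) implies (2).  If [G = G^- G^0], then [phiH_t g] converges in [G^0] for every
    [g], so the hyperbolic part has no positive eigenvalue and [g |-> lim phiH_t g] is
    a continuous projection onto [G^0].  On the kernel of this projection [phi_t]
    contracts a neighbourhood of [1], uniformly up to conjugation by the compact group
    [G^0]; enlarging that neighbourhood by [phiH_(-s)], which commutes with [phi_t],
    gives a bounded set that absorbs the reachable sets of a fixed time step.

    (2) implies (1).  The cocycle [kappa g = d/dt (phi_t g * g^-1)] at [t = 0] is bounded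
    on the compact closure of the orbit, whence the control vectors grow
    subexponentially under [d phi_t].  Subexponential vectors form an invariant
    subalgebra, so by LARC there is no positive eigenvalue, and the projection onto
    [G^0] exists.  Let [K0] be the image of the closure of the orbit.  A map
    [g |-> y * phi_t g] sending [K0] into itself is recurrent, hence onto; the elements
    whose projection preserves [K0] therefore form a closed invariant subgroup that
    contains the orbit, which is all of [G] by LARC, and so [G^0 = K0].

    (3) implies (2).  Controls that leave larger and larger compact sets are
    concatenated into a single one.

    Tangent vectors at [1] are represented in a fixed chart around [1] as row vectors,
    and the exponential map is built there as the limit of iterated squaring. *)

(** * Functions of class C^k *)

(** The group is given by its atlas and vector fields are derivations of functions, so two standard
    facts take another form. That a derivation is a tangent vector is not shown in general: along a
    curve the vector is read off from derivatives of coordinate functions, and for right-invariant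
    fields it follows from LARC, because the fields [rinv v] form an invariant subalgebra containing
    the controls. This is the hypothesis [HR] of later sections. Uniqueness of solutions needs no
    theory of differential equations: the quotient of two solutions, moved back by the flow, has
    velocity zero.

    The delicate direction is (2) implies (1). The derivative of [kappa] at 1 is the derivation of
    the drift, so boundedness of [kappa] only controls the image of a control vector under that
    derivation, and integrating once costs a linear factor. Subexponential growth absorbs this
    factor and is preserved by brackets. On G^0 the flow might still grow polynomially; compactness
    kills the nilpotent part on the relevant values of [kappa], and the remaining elliptic flow
    distorts them by a bounded factor only, which is what recurrence needs. *)

Section Differentials.
Context {R : realType}.
Implicit Types V W : normedModType R.

Lemma differentiable_le V W (f : V -> W) (x : V) (e : R) :
  differentiable f x -> 0 < e ->
  \forall y \near x, `|f y - f x - 'd f x (y - x)| <= e * `|y - x|.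
Proof.
move=> /diff_locallyP [_ /eqaddoP H] e0; have {}H := H _ e0.
rewrite (near_shift (0:V)) /=; near=> h.
have : `|f (h + x) - (f x + 'd f x h)| <= e * `|h| by near: h.
by rewrite /= subr0 addrK opprD addrA.
Unshelve. all: by end_near. Qed.

Lemma differentiable_intro V W (f : V -> W) (x : V) (df : {linear V -> W}) :
  continuous df ->
  (forall e : R, 0 < e ->
    \forall y \near x, `|f y - f x - df (y - x)| <= e * `|y - x|) ->
  differentiable f x /\ 'd f x = df :> (V -> W).
Proof.
move=> cdf H.
have Ho : f \o shift x = cst (f x) + df +o_ 0 id.
  apply/eqaddoP => e e0; have {H} := H _ e0.
  rewrite (near_shift (0:V)) /=; apply: filterS => h /=.
  by rewrite subr0 addrK opprD addrA.
have E := diff_unique cdf Ho; split => //.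
by apply/diff_locallyP; rewrite E.
Qed.

Lemma near_eq_differentiable V W (f g : V -> W) (x : V) :
  (\near x, f x = g x) -> differentiable f x -> differentiable g x.
Proof.
move=> fg df; have fgx := nbhs_singleton fg.
apply: (proj1 (differentiable_intro (df := 'd f x) _ _)).
  exact: diff_continuous.
move=> e e0; have H := differentiable_le df e0; near=> y.
have <- : f y = g y by near: y.
by rewrite -fgx; near: y.
Unshelve. all: by end_near. Qed.
End Differentials.

Section ClassC.
Context {R : realType}.
Implicit Types V W : normedModType R.

Lemma classC_sub k V W (U U' : set V) (f : V -> W) :
  U' `<=` U -> classC k U f -> classC k U' f.
Proof.
move=> sU; elim: k f => [|k IH] f /=; first by move=> h x /sU/h.
by move=> [h1 h2]; split=> [x /sU/h1|v]; last exact: IH.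
Qed.

Lemma classC_eq k V W (U : set V) (f g : V -> W) : open U ->
  (forall x, U x -> f x = g x) -> classC k U f -> classC k U g.
Proof.
move=> oU; elim: k f g => [|k IH] f g fg /=.
  move=> h x Ux; rewrite /prop_for /continuous_at -(fg x Ux).
  apply: cvg_trans (h x Ux); apply: near_eq_cvg.
  by apply: filterS (open_nbhs_nbhs (conj oU Ux)) => y /fg.
have nfg x : U x -> \near x, f x = g x.
  by move=> Ux; apply: filterS (open_nbhs_nbhs (conj oU Ux)) => y /fg.
move=> [h1 h2]; split=> [x Ux|v].
  exact: near_eq_differentiable (nfg x Ux) (h1 x Ux).
by apply: (IH _ _ _ (h2 v)) => x Ux; apply: near_eq_derive; exact: nfg.
Qed.

Lemma classCW k V W (U : set V) (f : V -> W) : classC k.+1 U f -> classC k U f.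
Proof.
elim: k f => [|k IH] f [h1 h2]; first by move=> x /h1/differentiable_continuous.
by split=> // v; apply: IH.
Qed.

Lemma classC_local k V W (U : set V) (f : V -> W) :
  (forall x, U x -> exists2 U', U' x & classC k U' f) -> classC k U f.
Proof.
elim: k f => [|k IH] f h /=; first by move=> x /h [U' U'x]; apply.
split=> [x /h [U' U'x [+ _]]|v]; first exact.
by apply: IH => x /h [U' U'x [_ h2]]; exists U' => //; exact: h2.
Qed.

Lemma classC_cst k V W (U : set V) (c : W) : classC k U (fun=> c).
Proof.
elim: k c => [|k IH] c /=; first by move=> x _; exact: cst_continuous.
split=> [x _|v]; first exact: differentiable_cst.
have -> : 'D_v (fun=> c) = fun=> (0 : W); last exact: IH.
by apply/funext => x; exact: derive_cst.
Qed.

Lemma classCD k V W (U : set V) (f g : V -> W) : open U ->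
  classC k U f -> classC k U g -> classC k U (fun x => f x + g x).
Proof.
move=> oU; elim: k f g => [|k IH] f g /=.
  by move=> hf hg x Ux; apply: continuousD; [exact: hf|exact: hg].
move=> [f1 f2] [g1 g2]; split=> [x Ux|v].
  by apply: differentiableD; [exact: f1|exact: g1].
apply: (classC_eq oU _ (IH _ _ (f2 v) (g2 v))) => x Ux.
by rewrite deriveD//; apply: diff_derivable; [exact: f1|exact: g1].
Qed.

Lemma classCM k V (U : set V) (f g : V -> R) : open U ->
  classC k U f -> classC k U g -> classC k U (fun x => f x * g x).
Proof.
move=> oU; elim: k f g => [|k IH] f g.
  by move=> hf hg x Ux; apply: continuousM; [exact: hf|exact: hg].
move=> Hf Hg; have [f1 f2] := Hf; have [g1 g2] := Hg.
split=> [x Ux|v].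
  by apply: differentiableM; [exact: f1|exact: g1].
have := classCD oU (IH _ _ (classCW Hf) (g2 v)) (IH _ _ (classCW Hg) (f2 v)).
apply: (classC_eq oU) => x Ux.
by rewrite deriveM//; apply: diff_derivable; [exact: f1|exact: g1].
Qed.

Lemma classC_sum k V W (I : Type) (r : seq I) (U : set V) (f : I -> V -> W) :
  open U -> (forall i, classC k U (f i)) ->
  classC k U (fun x => \sum_(i <- r) f i x).
Proof.
move=> oU hf; elim: r => [|i r IH].
  by apply: classC_eq (classC_cst _ _ 0) => // x _; rewrite big_nil.
apply: (classC_eq oU _ (classCD oU (hf i) IH)) => x _; by rewrite big_cons.
Qed.

Lemma differentiable_rVP V n (f : V -> 'rV[R]_n) x i :
  differentiable f x -> differentiable (fun y => f y 0 i) x.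
Proof.
move=> hf; apply: (differentiable_comp (g := fun M : 'rV[R]_n => M 0 i)) => //.
exact: differentiable_coord.
Qed.

Lemma derive_rV V n (f : V -> 'rV[R]_n) x v i : derivable f x v ->
  'D_v f x 0 i = 'D_v (fun y => f y 0 i) x.
Proof. by move=> hf; rewrite derive_mx// mxE. Qed.

Lemma classC_coord k V n (U : set V) (f : V -> 'rV[R]_n) i : open U ->
  classC k U f -> classC k U (fun x => f x 0 i).
Proof.
move=> oU; elim: k f => [|k IH] f.
  move=> h x Ux; apply: (@continuous_comp _ _ _ f (fun M : 'rV[R]_n => M 0 i)).
    exact: h.
  exact: coord_continuous.
move=> [h1 h2]; split=> [x Ux|v]; first exact/differentiable_rVP/h1.
apply: (classC_eq oU _ (IH _ (h2 v))) => x Ux; rewrite derive_rV//.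
exact/diff_derivable/h1.
Qed.

Lemma derive_sum_delta n (g : 'rV[R]_n -> R) x v : differentiable g x ->
  'D_v g x = \sum_i v 0 i * 'D_(delta_mx 0 i) g x.
Proof.
move=> dg; rewrite deriveE// {1}(row_sum_delta v) linear_sum/=.
by apply: eq_bigr => i _; rewrite linearZ/= -deriveE.
Qed.

Lemma derive_comp_rV V n (f : V -> 'rV[R]_n) (g : 'rV[R]_n -> R) x v :
  differentiable f x -> differentiable g (f x) ->
  'D_v (g \o f) x = 'D_('D_v f x) g (f x).
Proof.
move=> df dg; rewrite !deriveE//; last exact: differentiable_comp.
by rewrite diff_comp.
Qed.

(** The derivative of the composite is a finite sum of coordinates of ['D_v f] times partial
    derivatives of [g], so the induction closes under sums and products. This is why the middle
    space consists of row vectors and [g] is scalar. *)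
Lemma classC_comp k V n (U : set V) (U' : set 'rV[R]_n) (f : V -> 'rV[R]_n)
    (g : 'rV[R]_n -> R) : open U -> (forall x, U x -> U' (f x)) ->
  classC k U f -> classC k U' g -> classC k U (g \o f).
Proof.
move=> oU UU'; elim: k f g UU' => [|k IH] f g UU' Hf Hg.
  by move=> x Ux; apply: continuous_comp; [exact: Hf|exact/Hg/UU'].
have [f1 f2] := Hf; have [g1 g2] := Hg.
split=> [x Ux|v]; first by apply: differentiable_comp; [exact: f1|exact/g1/UU'].
have : classC k U (fun x => \sum_i 'D_v f x 0 i * ('D_(delta_mx 0 i) g \o f) x).
  apply: classC_sum => // i; apply: classCM => //.
    by apply: classC_coord => //; exact: f2.
  by apply: IH => //; [exact: classCW|exact: g2].
apply: (classC_eq oU) => x Ux.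
by rewrite derive_comp_rV; [rewrite derive_sum_delta//; exact/g1/UU'|exact: f1|exact/g1/UU'].
Qed.

(** For an affine inner map the derivative along [v] is that of [g] along [L v], composed with [f].
    No coordinates are needed, so this version serves for product spaces and vector-valued
    functions. *)
Lemma classC_compA k V V' W (U : set V) (U' : set V') (f : V -> V')
    (L : {linear V -> V'}) (c : V') (g : V' -> W) : open U -> continuous L ->
  (forall x, f x = c + L x) -> (forall x, U x -> U' (f x)) ->
  classC k U' g -> classC k U (g \o f).
Proof.
move=> oU cL fE UU'.
have isdf x : differentiable f x /\ 'd f x = L :> (V -> V').
  apply: differentiable_intro => // e e0; near=> y.
  rewrite !fE opprD addrACA subrr add0r linearB/= subrr normr0.
  by rewrite mulr_ge0// ltW.
elim: k g => [|k IH] g.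
  move=> Hg x Ux; apply: continuous_comp; last exact/Hg/UU'.
  by apply: differentiable_continuous; have [] := isdf x.
move=> [g1 g2]; split=> [x Ux|v].
  by apply: differentiable_comp; [have [] := isdf x|exact/g1/UU'].
apply: (classC_eq oU _ (IH _ (g2 (L v)))) => x Ux /=.
have [d1 d2] := isdf x.
have dg : differentiable g (f x) by exact/g1/UU'.
rewrite !deriveE//; last exact: differentiable_comp.
by rewrite (diff_comp d1 dg) /= d2.
Unshelve. all: by end_near. Qed.
End ClassC.

(** * Sup-norm estimates and derivatives as error bounds *)

Section Norms.
Context {R : realType}.

Lemma norm_coord n (x : 'rV[R]_n) i : `|x 0 i| <= `|x|.
Proof.
rewrite [leRHS]/Num.Def.normr/= mx_normrE.
exact: (le_bigmax _ (fun ij : 'I_1 * 'I_n => `|x ij.1 ij.2|) (0, i)).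
Qed.

Lemma norm_rV_le n (x : 'rV[R]_n) e : 0 <= e ->
  (forall i, `|x 0 i| <= e) -> `|x| <= e.
Proof.
move=> e0 h; rewrite [leLHS]/Num.Def.normr/= mx_normrE bigmax_le// => -[j i] _.
by rewrite ord1; exact: h.
Qed.

Lemma norm_rV_lt n (x : 'rV[R]_n) e : 0 < e ->
  (forall i, `|x 0 i| < e) -> `|x| < e.
Proof.
move=> e0 h; rewrite [ltLHS]/Num.Def.normr/= mx_normrE bigmax_lt// => -[j i] _.
by rewrite ord1; exact: h.
Qed.

Lemma is_derive_leP (V : normedModType R) (f : R -> V) (x : R) (l : V) :
  is_derive x (1 : R) f l <->
  (forall e : R, 0 < e ->
     \forall h \near (0:R), `|f (x + h) - f x - h *: l| <= e * `|h|).
Proof.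
split=> [[df <-] e e0|H].
  move: df => /cvgrPdist_le /(_ _ e0) H.
  have {}H : \forall h \near 0^', `|f (x + h) - f x - h *: 'D_1 f x| <= e * `|h|.
    near=> h.
    have h0 : h != 0 by near: h; exact: nbhs_dnbhs_neq.
    have : `|'D_1 f x - h^-1 *: (f (h *: (1:R) + x) - f x)| <= e by near: h.
    rewrite distrC -(ler_pM2l (_ : 0 < `|h|)) ?normr_gt0// -normrZ scalerBr.
    rewrite scalerA divff// scale1r [h%:A]mulr1 (addrC h) => /le_trans; apply.
    by rewrite mulrC.
  move: H; rewrite /dnbhs /within/= => H; near=> h.
  have [->|h0] := eqVneq h 0.
    by rewrite addr0 scale0r subr0 subrr !normr0 mulr0.
  by move: h0; near: h.
have cl : (fun h => h^-1 *: (f (h *: (1:R) + x) - f x)) @ 0^' --> l.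
  apply/cvgrPdist_le => e e0; have {}H := H _ e0; near=> h.
  have h0 : h != 0 by near: h; exact: nbhs_dnbhs_neq.
  rewrite distrC -(ler_pM2l (_ : 0 < `|h|)) ?normr_gt0// -normrZ scalerBr.
  rewrite scalerA divff// scale1r [h%:A]mulr1 (addrC h) (mulrC _ e).
  by near: h; exact: cvg_within H.
by split; [apply/cvg_ex; exists l|exact: cvg_lim cl].
Unshelve. all: by end_near. Qed.
End Norms.

(** * Smooth bump functions *)

Section Bump.
Context {R : realType}.

Lemma nbhs0_ler (V : normedModType R) (e : R) : 0 < e ->
  \forall x \near (0 : V), `|x| <= e.
Proof. by move=> e0; apply: (cvgr0_norm_le (fun x : V => x)) => //; exact: cvg_id. Qed.

(** The polynomial factor makes the family stable under differentiation: the derivative of the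
    function for [p] is the one for X^2 (p - p'). *)
Definition flat (p : {poly R}) (x : R) : R :=
  if 0 < x then p.[x^-1] * expR (- x^-1) else 0.

(** In each monomial, exp (1/x) beats (1/x)^(i+2) / (i+2)!. A bound quadratic in x is what makes the
    derivative at 0 vanish. *)
Lemma flat_bound p : exists M : R, forall x, x <= 1 -> `|flat p x| <= M * x ^+ 2.
Proof.
exists (\sum_(i < size p) `|p`_i| * (i.+2)`!%:R) => x x1; rewrite /flat.
have S0 : 0 <= \sum_(i < size p) `|p`_i| * (i.+2)`!%:R.
  by apply: sumr_ge0 => i _; rewrite mulr_ge0.
case: ifPn => [x0|_]; last by rewrite normr0 mulr_ge0// sqr_ge0.
rewrite normrM (ger0_norm (expR_ge0 _)) horner_coef.
apply: (le_trans (ler_wpM2r (expR_ge0 _) (ler_norm_sum _ _ _))).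
rewrite !mulr_suml ler_sum// => i _.
rewrite normrM -!mulrA ler_wpM2l//.
have xi0 : 0 < x^-1 by rewrite invr_gt0.
rewrite normrX gtr0_norm// expRN ler_pdivrMr ?expR_gt0//.
rewrite -ler_pdivrMl; last by rewrite mulr_gt0 ?exprn_gt0// ltr0n fact_gt0.
apply: le_trans (expR_ge1Dxn i.+1 (ltW xi0)).
rewrite -[leLHS]add0r lerD// invfM mulrC mulrA (exprS _ i.+1) (exprS _ i).
have f0 : (i.+2)`!%:R != 0 :> R by rewrite pnatr_eq0 -lt0n fact_gt0.
move: f0; move: (_`!%:R) (_ ^+ i) => f s f0; rewrite le_eqVlt; apply/orP; left.
by apply/eqP; field; rewrite f0 gt_eqF.
Qed.

Lemma is_derive_flat p (x : R) :
  is_derive x (1 : R) (flat p) (flat ('X^2 * (p - p^`())) x).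
Proof.
have [x0|x0|->] := ltgtP x 0.
- rewrite {2}/flat (lt_gtF x0).
  have : is_derive x (1:R) (cst (0:R)) (0:R) by exact: is_derive_cst.
  apply: near_eq_is_derive.
  near=> y; rewrite /flat ifF//; apply: lt_gtF; near: y.
  exact: lt_nbhsl.
- rewrite {2}/flat x0.
  suff : is_derive x (1:R) (fun y => p.[y^-1] * expR (- y^-1))
    (('X^2 * (p - p^`())).[x^-1] * expR (- x^-1)).
    apply: near_eq_is_derive; near=> y; rewrite /flat ifT//; near: y.
    exact: lt_nbhsr.
  have xn0 : x != 0 by rewrite gt_eqF.
  have dV : is_derive x (1:R) (fun y : R => y^-1) (- x ^- 2).
    have := @is_deriveV R id x 1 1 xn0 (is_derive_id _ _).
    by rewrite /= -[_ *: 1]/(_ * 1) mulr1.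
  have dN : is_derive x (1:R) (fun y : R => - y^-1) (x ^- 2).
    by have := is_deriveN dV; rewrite opprK.
  have := is_deriveM (is_derive1_comp (is_derive_poly p _) dV)
                     (is_derive1_comp (is_derive_expR _) dN).
  move=> H; refine (is_derive_eq H _); rewrite /= !hornerE -![_ *: _]/(_ * _) /=.
  by field.
- rewrite {2}/flat ltxx; apply/is_derive_leP => e e0.
  have [M MP] := flat_bound p.
  have M0 : 0 <= M by have := MP 1 (lexx _); rewrite expr1n mulr1; exact: le_trans.
  have N1 : \forall h \near (0 : R), `|h| <= e / (M + 1).
    by apply: nbhs0_ler; rewrite divr_gt0// ltr_wpDl.
  have N2 : \forall h \near (0 : R), `|h| <= 1 by exact: nbhs0_ler.
  near=> h.
  rewrite add0r {2}/flat ltxx subr0 scaler0 subr0.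
  apply: (le_trans (MP h _)); last first.
    rewrite -(real_normK (num_real h)) expr2 mulrA ler_wpM2r//.
    have hM : `|h| <= e / (M + 1).
      by near: h; exact: N1.
    rewrite ler_pdivlMr ?ltr_wpDl// in hM; apply: le_trans hM.
    by rewrite mulrDr mulr1 mulrC lerDl.
  have : `|h| <= 1 by near: h; exact: N2.
  exact/le_trans/ler_norm.
Unshelve. all: by end_near. Qed.

Lemma derive_scale (V W : normedModType R) (f : V -> W) x v (a : R) :
  differentiable f x -> 'D_(a *: v) f x = a *: 'D_v f x.
Proof. by move=> df; rewrite !deriveE// linearZ. Qed.

Lemma classC_flat k p : classC k setT (flat p : R -> R).
Proof.
have hd q x : differentiable (flat q) x.
  by apply/derivable1_diffP; have [] := is_derive_flat q x.
elim: k p => [|k IH] p; first by move=> x _; exact/differentiable_continuous.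
split=> [x _|v]; first exact: hd.
have : classC k setT (fun x : R => v * flat ('X^2 * (p - p^`())) x).
  by apply: classCM; [exact: openT|exact: classC_cst|exact: IH].
apply: classC_eq; [exact: openT|move=> x _].
have := derive_scale (1 : R) v (hd p x); rewrite [v *: (1:R)]mulr1 => ->.
by have [_ ->] := is_derive_flat p x.
Qed.

(** A product over coordinates has a cube as support, which is a ball for the norm of row vectors:
    for [r > 0] it is positive exactly at distance less than [r] from [p]. *)
Definition bump n (p : 'rV[R]_n) (r : R) (x : 'rV[R]_n) : R :=
  \prod_i (flat 1 (r - (x 0 i - p 0 i)) * flat 1 (r + (x 0 i - p 0 i))).

Lemma classC_prod k (V : normedModType R) (I : Type) (s : seq I) (U : set V)
    (f : I -> V -> R) : open U -> (forall i, classC k U (f i)) ->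
  classC k U (fun x => \prod_(i <- s) f i x).
Proof.
move=> oU hf; elim: s => [|i s IH].
  apply: (classC_eq oU _ (classC_cst k U (1:R))) => x _; by rewrite big_nil.
by apply: (classC_eq oU _ (classCM oU (hf i) IH)) => x _; rewrite big_cons.
Qed.

Lemma classC_affine_coord k n (g : R -> R) (a b : R) (i : 'I_n) :
  classC k setT g -> classC k setT (fun x : 'rV[R]_n => g (a + b * x 0 i)).
Proof.
move=> hg.
have lin : linear (fun x : 'rV[R]_n => b * x 0 i).
  by move=> c x y; rewrite !mxE mulrDr mulrCA.
pose L : {linear 'rV[R]_n -> R} := HB.pack (fun x : 'rV[R]_n => b * x 0 i)
  (GRing.isLinear.Build _ _ _ _ _ lin).
have cL : continuous L.
  by move=> x; apply: continuousM; [exact: cst_continuous|exact: coord_continuous].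
exact: (classC_compA (f := fun x : 'rV[R]_n => a + b * x 0 i) openT cL _ _ hg).
Qed.

Lemma classC_bump k n (p : 'rV[R]_n) r : classC k setT (bump p r).
Proof.
apply: classC_prod => [|i]; first exact: openT.
apply: classCM; first exact: openT.
  apply: (classC_eq openT _
    (classC_affine_coord (r + p 0 i) (-1) i (classC_flat k 1))).
  by move=> x _ /=; congr flat; ring.
apply: (classC_eq openT _
  (classC_affine_coord (r - p 0 i) 1 i (classC_flat k 1))).
by move=> x _ /=; congr flat; ring.
Qed.

Lemma flat_gt0 x : 0 < x -> 0 < flat 1 x.
Proof. by move=> x0; rewrite /flat x0 hornerC mul1r expR_gt0. Qed.

Lemma flat_ge0 x : 0 <= flat 1 x.
Proof. by rewrite /flat; case: ifP => // _; rewrite hornerC mul1r expR_ge0. Qed.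

Lemma bump_ge0 n (p : 'rV[R]_n) r x : 0 <= bump p r x.
Proof. by apply: prodr_ge0 => i _; rewrite mulr_ge0// flat_ge0. Qed.

Lemma bump_gt0 n (p : 'rV[R]_n) r x : `|x - p| < r -> 0 < bump p r x.
Proof.
move=> xr; apply: prodr_gt0 => i _.
have := le_lt_trans (norm_coord (x - p) i) xr.
rewrite !mxE ltr_norml => /andP[h1 h2].
by rewrite mulr_gt0// flat_gt0// ?subr_gt0// addrC -ltrBlDr sub0r.
Qed.

Lemma bump_neq0 n (p : 'rV[R]_n) r x : 0 < r -> bump p r x != 0 -> `|x - p| < r.
Proof.
move=> r0 /prodf_neq0 h; apply: norm_rV_lt => // i; rewrite !mxE.
have := h i isT; rewrite mulf_eq0 negb_or /flat ltr_norml => /andP[].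
case: ifPn => [|_]; last by rewrite eqxx.
case: ifPn => [|_]; last by rewrite eqxx.
by rewrite subr_gt0 -ltrBlDl sub0r => -> ->.
Qed.
End Bump.

(** * Symmetry of second derivatives and strict differentiability *)

Section SecondOrder.
Context {R : realType}.
Implicit Types V W : normedModType R.

Lemma addKBr (V : zmodType) (p u w : V) : p + u + w - p = u + w.
Proof. by rewrite addrC !addrA addNr add0r. Qed.

Lemma segmentE V (p x y : V) (t : R) :
  y + t *: (x - y) - p = (1 - t) *: (y - p) + t *: (x - p).
Proof.
have -> : x - y = (x - p) - (y - p) by rewrite opprB addrA subrK.
by rewrite addrAC scalerBl scale1r (scalerBr t) addrA [RHS]addrAC.
Qed.

Lemma is_derive_line V W (f : V -> W) (x a : V) (s : R) (l : W) :
  is_derive (x + s *: a) a f l ->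
  is_derive s (1 : R) (fun t : R => f (x + t *: a)) l.
Proof.
have E : (fun h : R => h^-1 *: (f (h *: a + (x + s *: a)) - f (x + s *: a))) =
   (fun h : R => h^-1 *: (f (x + (h *: (1:R) + s) *: a) - f (x + s *: a))).
  by apply/funext => h; rewrite [h *: (1:R)]mulr1 scalerDl addrCA.
case=> df <-; rewrite /derivable E in df.
split; first exact: df.
by rewrite /derive E.
Qed.

Lemma derive_line V W (f : V -> W) (x a : V) (s : R) :
  differentiable f (x + s *: a) ->
  is_derive s (1 : R) (fun t : R => f (x + t *: a)) ('D_a f (x + s *: a)).
Proof. by move=> df; apply: is_derive_line; apply: derivableP; exact: diff_derivable. Qed.

Lemma nbhs_normP V (x : V) (P : set V) :
  (\forall y \near x, P y) <-> exists2 r : R, 0 < r & forall y, `|y - x| < r -> P y.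
Proof.
split=> [/nbhs_ballP [r /= r0 H]|[r r0 H]].
  by exists r => // y yr; apply: H; rewrite -ball_normE /= distrC.
by apply/nbhs_ballP; exists r => // y; rewrite -ball_normE /= distrC; exact: H.
Qed.

(** The mean value theorem for [phi s], the increment of [F] along [h *: b] at [p + s *: a], turns
    the second difference into an increment of ['D_a F]. That increment is replaced by the
    differential at [p], so differentiability of ['D_a F] at the single point [p] is enough. *)
Lemma mixed_difference V (U : set V) (F : V -> R) (p a b : V) (e : R) :
  open U -> U p -> (forall x, U x -> differentiable F x) ->
  differentiable ('D_a F) p -> 0 < e ->
  exists2 d : R, 0 < d & forall h, 0 < h -> h < d ->
  `|F (p + h *: a + h *: b) - F (p + h *: a) - F (p + h *: b) + F p
     - h ^+ 2 * 'D_b ('D_a F) p| <= e * h ^+ 2.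
Proof.
(* [K * h] bounds every displacement from [p] inside the parallelogram spanned by [h *: a] and
   [h *: b]; the tolerance is halved because it is used at two points. *)
move=> oU Up dF dG e0; pose K := `|a| + `|b| + 1.
have K0 : 0 < K by rewrite ltr_wpDl// addr_ge0.
have e'0 : 0 < e / (K *+ 2) by rewrite divr_gt0// pmulrn_lgt0.
have : \forall y \near p, U y /\
    `|'D_a F y - 'D_a F p - 'd ('D_a F) p (y - p)| <= e / (K *+ 2) * `|y - p|.
  near=> y; split; first by near: y; exact: open_nbhs_nbhs.
  by near: y; exact: differentiable_le.
move=> /nbhs_normP[r r0 H].
exists (r / K); first by rewrite divr_gt0.
move=> h h0; rewrite ltr_pdivlMr// => hr.
have small s t : 0 <= s -> s <= h -> 0 <= t -> t <= h ->
    `|p + t *: b + s *: a - p| <= K * h.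
  move=> s0 sh t0 th.
  rewrite addKBr (le_trans (ler_normD _ _))// !normrZ.
  rewrite !ger0_norm// /K !mulrDl mul1r addrC.
  rewrite -[leLHS]addr0 !lerD// ?(ltW h0)// mulrC ler_wpM2l//.
have smallr s t : 0 <= s -> s <= h -> 0 <= t -> t <= h ->
    `|p + t *: b + s *: a - p| < r.
  by move=> *; apply: (le_lt_trans (small _ _ _ _ _ _)) => //; rewrite mulrC.
pose phi s := F (p + h *: b + s *: a) - F (p + (0:R) *: b + s *: a).
pose dphi s := 'D_a F (p + h *: b + s *: a) - 'D_a F (p + (0:R) *: b + s *: a).
have hd s : 0 <= s -> s <= h -> is_derive s (1:R) phi (dphi s).
  move=> s0 sh; apply: is_deriveB; apply: derive_line; apply: dF.
    by apply: (H _ _).1; apply: smallr => //; exact: ltW.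
  by apply: (H _ _).1; apply: smallr => //; exact: ltW.
have [c] : exists2 c, c \in `[0, h]%R & phi h - phi 0 = dphi c * (h - 0).
  apply: MVT_segment; first exact: ltW.
    by move=> s; rewrite in_itv/= => /andP[s0 sh]; apply: hd; exact: ltW.
  apply: derivable_within_continuous => s; rewrite in_itv/= => /andP[s0 sh].
  by have [] := hd s s0 sh.
rewrite in_itv/= => /andP[c0 ch]; rewrite subr0 /phi !scale0r !addr0 => E.
have -> : F (p + h *: a + h *: b) - F (p + h *: a) - F (p + h *: b) + F p =
    dphi c * h.
  by rewrite -E addrAC (addrAC p) opprB addrA -!addrA; congr (_ + _); rewrite addrCA.
rewrite (_ : _ - _ = h * (dphi c - h * 'D_b ('D_a F) p)); last by ring.
rewrite normrM gtr0_norm// expr2 mulrCA ler_wpM2l//; first exact: ltW.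
have -> : dphi c - h * 'D_b ('D_a F) p =
   ('D_a F (p + h *: b + c *: a) - 'D_a F p -
     'd ('D_a F) p (p + h *: b + c *: a - p)) -
   ('D_a F (p + (0:R) *: b + c *: a) - 'D_a F p -
     'd ('D_a F) p (p + (0:R) *: b + c *: a - p)).
  have -> : 'D_b ('D_a F) p = 'd ('D_a F) p b by exact: deriveE.
  have E1 : 'd ('D_a F) p (h *: b + c *: a) =
      h * 'd ('D_a F) p b + 'd ('D_a F) p (c *: a).
    by rewrite linearD linearZ.
  rewrite !addKBr E1 {1}/dphi scale0r add0r addr0; ring.
apply: (le_trans (ler_normB _ _)).
have h1 : forall t, 0 <= t -> t <= h ->
    `|'D_a F (p + t *: b + c *: a) - 'D_a F p -
      'd ('D_a F) p (p + t *: b + c *: a - p)| <= e / 2 * h.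
  move=> t t0 th; apply: (le_trans (H _ (smallr _ _ c0 ch t0 th)).2).
  apply: (le_trans (ler_wpM2l (ltW e'0) (small _ _ c0 ch t0 th))).
  rewrite mulrA ler_wpM2r//; first exact: ltW.
  by rewrite le_eqVlt; apply/orP; left; apply/eqP; field; rewrite gt_eqF.
apply: (le_trans (lerD (h1 h (ltW h0) (lexx _)) (h1 0 (lexx _) (ltW h0)))).
by rewrite le_eqVlt; apply/orP; left; apply/eqP; field.
Unshelve. all: by end_near. Qed.

Lemma derive_comm V (U : set V) (F : V -> R) (p a b : V) :
  open U -> U p -> classC 2 U F -> 'D_a ('D_b F) p = 'D_b ('D_a F) p.
Proof.
move=> oU Up [F1 F2].
apply/eqP; rewrite -subr_eq0 -normr_le0; apply/ler_addgt0Pl => e e0.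
rewrite addr0.
have e20 : 0 < e / 2 by rewrite divr_gt0.
have [d1 d10 H1] := mixed_difference b oU Up F1 ((F2 a).1 p Up) e20.
have [d2 d20 H2] := mixed_difference a oU Up F1 ((F2 b).1 p Up) e20.
pose h := Num.min d1 d2 / 2.
have m0 : 0 < Num.min d1 d2 by rewrite lt_min d10.
have h0 : 0 < h by rewrite divr_gt0.
have hm : h < Num.min d1 d2 by rewrite ltr_pdivrMr// ltr_pMr// ltr1n.
move: (hm); rewrite lt_min => /andP[hd1 hd2].
have {}H1 := H1 h h0 hd1; have {}H2 := H2 h h0 hd2.
rewrite -(ler_pM2r (_ : 0 < h ^+ 2)) ?exprn_gt0//.
rewrite -(gtr0_norm (_ : 0 < h ^+ 2)) ?exprn_gt0// -normrM.
rewrite [in leRHS]gtr0_norm ?exprn_gt0//.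
apply: le_trans (_ : e / 2 * h ^+ 2 + e / 2 * h ^+ 2 <= _); last first.
  by rewrite -mulrDl -splitr.
apply: le_trans (lerD H1 H2); apply: le_trans (ler_normB _ _).
rewrite (addrAC p (h *: b)); rewrite le_eqVlt; apply/orP; left; apply/eqP; congr (`|_|).
move: ('D_a ('D_b F) p) ('D_b ('D_a F) p) (F (p + h *: a + h *: b)) (F (p + h *: a)).
by move: (F (p + h *: b)) (F p) (h ^+ 2) => u1 u2 u3 u4 u5 u6 u7; ring.
Qed.

Lemma derive_lincomb V W (I : finType) (a : I -> R) (b : I -> V) (F : V -> W) z :
  differentiable F z ->
  'D_(\sum_i a i *: b i) F z = \sum_i a i *: 'D_(b i) F z.
Proof.
move=> dF; rewrite deriveE// linear_sum/=.
by apply: eq_bigr => i _; rewrite linearZ/= deriveE.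
Qed.

(** The mean value theorem on the segment from [y] to [x] leaves increments of the partial
    derivatives between an intermediate point and [p], and differentiability at [p] makes these at
    most linear in the distance [rho]. A spanning family with bounded coordinates replaces a basis,
    so that the lemma applies to a product of two copies of the coordinate space. *)
Lemma C2_strict V (I : finType) (b : I -> V) (c : V -> I -> R) (U : set V)
    (F : V -> R) (p : V) :
  (forall v, v = \sum_i c v i *: b i) -> (forall v i, `|c v i| <= `|v|) ->
  open U -> U p -> classC 2 U F ->
  exists C r : R, [/\ 0 <= C, 0 < r & forall x y rho, rho <= r ->
    `|x - p| <= rho -> `|y - p| <= rho ->
    `|F x - F y - 'D_(x - y) F p| <= C * rho * `|x - y|].
Proof.
move=> vE cv oU Up [F1 F2].
have hi i : exists Cr : R * R, [/\ 0 <= Cr.1, 0 < Cr.2 & forall z, `|z - p| < Cr.2 ->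
    `|'D_(b i) F z - 'D_(b i) F p| <= Cr.1 * `|z - p|].
  have dG := (F2 (b i)).1 p Up.
  have /nbhs_normP[r r0 H] := differentiable_le dG ltr01.
  have [k k0 Hk] := linear_lipschitz (diff_continuous dG).
  exists (1 + k, r); split=> //=; first by rewrite addr_ge0// ltW.
  move=> z zr; rewrite -[X in `|X|](subrK ('d ('D_(b i) F) p (z - p))).
  by rewrite (le_trans (ler_normD _ _))// mulrDl lerD// H.
have /choice[g gP] := hi.
have [r0 [r00 r0U]] : exists r0 : R, 0 < r0 /\ forall y, `|y - p| < r0 -> U y.
  have /nbhs_normP[r0 ? ?] : \forall y \near p, U y by exact: open_nbhs_nbhs.
  by exists r0.
pose r := \big[Num.min/r0]_i (g i).2 / 2.
have m0 : 0 < \big[Num.min/r0]_i (g i).2.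
  by elim/big_ind : _ => // [x y x0 y0|i _]; [rewrite lt_min x0|have [] := gP i].
have rm : r < \big[Num.min/r0]_i (g i).2.
  by rewrite /r ltr_pdivrMr// ltr_pMr// ltr1n.
exists (\sum_i (g i).1), r; split.
- by apply: sumr_ge0 => i _; have [] := gP i.
- by rewrite divr_gt0.
move=> x y rho rhor xp yp.
have seg t : 0 <= t -> t <= 1 -> `|y + t *: (x - y) - p| <= rho.
  move=> t0 t1.
  rewrite segmentE.
  rewrite (le_trans (ler_normD _ _))// !normrZ !ger0_norm ?subr_ge0//.
  have -> : rho = (1 - t) * rho + t * rho by rewrite -mulrDl subrK mul1r.
  by rewrite lerD// ler_wpM2l// subr_ge0.
have lt1 t : 0 <= t -> t <= 1 -> `|y + t *: (x - y) - p| < \big[Num.min/r0]_i (g i).2.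
  by move=> t0 t1; apply: le_lt_trans rm; apply: le_trans rhor; exact: seg.
have inU t : 0 <= t -> t <= 1 -> U (y + t *: (x - y)).
  move=> t0 t1; apply: r0U; apply: lt_le_trans (lt1 _ t0 t1) _.
  exact: bigmin_le_id.
have [t] : exists2 t, t \in `[0, 1]%R & F (y + (1:R) *: (x - y)) - F (y + (0:R) *: (x - y)) =
    'D_(x - y) F (y + t *: (x - y)) * (1 - 0).
  apply: (MVT_segment (f := fun t => F (y + t *: (x - y)))
    (df := fun t => 'D_(x - y) F (y + t *: (x - y)))) => //.
    move=> s; rewrite in_itv/= => /andP[s0 s1]; apply: derive_line; apply: F1.
    by apply: inU; exact: ltW.
  apply: derivable_within_continuous => s; rewrite in_itv/= => /andP[s0 s1].
  by have [] := derive_line (F1 _ (inU _ s0 s1)).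
rewrite in_itv/= => /andP[t0 t1]; rewrite scale1r scale0r addr0 (addrC y (x - y)) subrK subr0 mulr1 => ->.
have DE z : U z -> 'D_(x - y) F z = \sum_i c (x - y) i * 'D_(b i) F z.
  by move=> Uz; rewrite {1}(vE (x - y)) derive_lincomb//; exact: F1.
rewrite !DE//; last exact: inU.
rewrite -sumrB mulr_suml mulr_suml (le_trans (ler_norm_sum _ _ _))// ler_sum// => i _.
rewrite -mulrBr normrM mulrC ler_pM//.
have [g0 _ gi] := gP i.
apply: (le_trans (gi _ _)); last by rewrite ler_wpM2l// seg.
by apply: lt_le_trans (lt1 _ t0 t1) _; exact: bigmin_le_cond.
Qed.
End SecondOrder.

(** * Smooth functions on the group *)

Lemma open_within_preimage {T U : topologicalType} (A : set T) (B : set U) (g : T -> U) :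
  open A -> (forall x, A x -> {for x, continuous g}) -> open B ->
  open [set x | A x /\ B (g x)].
Proof.
move=> oA gc oB; rewrite openE => x [Ax Bx]; apply: filterI.
  exact: open_nbhs_nbhs.
by apply: (gc x Ax); exact: open_nbhs_nbhs.
Qed.

Section SmoothFunctions.
Context {R : realType} {n : nat} {G : lieGroupType R n}.
Local Notation V := 'rV[R]_n.
Local Notation atlas := (@lie_atlas R n G).

Lemma atlasP (a : chart R n G) : atlas a -> is_chart a.
Proof. exact: (atlas_chart (@lie_smooth_atlas R n G)). Qed.

Lemma chart_inv_cont (a : chart R n G) x : atlas a -> chart_cod a x ->
  {for x, continuous (chart_inv a)}.
Proof.
move=> /atlasP ha cx; have := chart_inv_continuous ha.
by rewrite continuous_open_subspace; [apply; exact: mem_set|exact: chart_cod_open].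
Qed.

Lemma chart_map_cont (a : chart R n G) x : atlas a -> chart_dom a x ->
  {for x, continuous (chart_map a)}.
Proof.
move=> /atlasP ha cx; have := chart_map_continuous ha.
by rewrite continuous_open_subspace; [apply; exact: mem_set|exact: chart_dom_open].
Qed.

Lemma chart_invK (a : chart R n G) x : atlas a -> chart_cod a x ->
  chart_dom a (chart_inv a x) /\ chart_map a (chart_inv a x) = x.
Proof. by move=> /atlasP ha [y dy <-]; rewrite (chart_mapK ha). Qed.

Lemma mulg_cont : continuous (fun p : G * G => (p.1 * p.2)%g).
Proof. by have [] := @lie_smooth_mul R n G. Qed.

Lemma invg_cont : continuous (fun x : G => (x^-1)%g).
Proof. by have [] := @lie_smooth_inv R n G. Qed.

Lemma mulg_cvg (T : Type) (F : set_system T) (f g : T -> G) (a b : G) :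
  Filter F -> f @ F --> a -> g @ F --> b -> (fun t => (f t * g t)%g) @ F --> (a * b)%g.
Proof.
move=> FF fa gb.
apply: (cvg_comp (fun t => (f t, g t)) (fun p : G * G => (p.1 * p.2)%g) (cvg_pair fa gb)).
exact: (@mulg_cont (a, b)).
Qed.

Lemma invg_cvg (T : Type) (F : set_system T) (f : T -> G) (a : G) :
  Filter F -> f @ F --> a -> (fun t => ((f t)^-1)%g) @ F --> (a^-1)%g.
Proof. by move=> FF fa; apply: (cvg_comp _ _ fa); exact: invg_cont. Qed.

Lemma smoothG_comp (F : G -> G) (f : G -> R) :
  smooth_map atlas F -> smoothG f -> smoothG (f \o F).
Proof.
move=> [Fc Fs] fs a ha k; apply: classC_local => x cx.
have [b hb dx] := atlas_cover (@lie_smooth_atlas R n G) (F (chart_inv a x)).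
exists [set x | chart_cod a x /\ chart_dom b (F (chart_inv a x))] => //.
have oU : open [set x | chart_cod a x /\ chart_dom b (F (chart_inv a x))].
  apply: (open_within_preimage (g := F \o chart_inv a)).
  - exact/chart_cod_open/atlasP.
  - by move=> y cy; apply: continuous_comp; [exact: chart_inv_cont|exact: Fc].
  - exact/chart_dom_open/atlasP.
have := classC_comp oU (U' := chart_cod b) _ (Fs a b ha hb k) (fs b hb k).
move=> /(_ (fun y hy => ex_intro2 _ _ _ hy.2 erefl)).
by apply: (classC_eq oU) => y [_ dy] /=; rewrite (chart_mapK (atlasP hb)).
Qed.

Lemma smoothG_mul2 (a b : chart R n G) (f : G -> R) k : atlas a -> atlas b ->
  smoothG f ->
  classC k [set z : V * V | chart_cod a z.1 /\ chart_cod b z.2]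
    (fun z => f (chart_inv a z.1 * chart_inv b z.2)%g).
Proof.
move=> ha hb fs; apply: classC_local => -[x y] /= [cx cy].
have [c hc dc] := atlas_cover (@lie_smooth_atlas R n G)
  (chart_inv a x * chart_inv b y)%g.
pose U := [set z : V * V | (chart_cod a z.1 /\ chart_cod b z.2) /\
  chart_dom c (chart_inv a z.1 * chart_inv b z.2)%g].
exists U => //.
have oA : open [set z : V * V | chart_cod a z.1 /\ chart_cod b z.2].
  rewrite openE => -[u v] /= [cu cv].
  exists (chart_cod a, chart_cod b) => //=.
  by split; apply: open_nbhs_nbhs; split=> //; exact/chart_cod_open/atlasP.
have oU : open U.
  apply: (open_within_preimage (g := fun z : V * V => (chart_inv a z.1 * chart_inv b z.2)%g)) => //.
    move=> -[u v] /= [cu cv]; apply: mulg_cvg.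
      by apply: (cvg_comp fst (chart_inv a) cvg_fst); exact: chart_inv_cont.
    by apply: (cvg_comp snd (chart_inv b) cvg_snd); exact: chart_inv_cont.
  exact/chart_dom_open/atlasP.
have hm : classC k U (fun z => chart_map c (chart_inv a z.1 * chart_inv b z.2)%g).
  apply: classC_sub ((@lie_smooth_mul R n G).2 a b c ha hb hc k).
  by move=> z [[]].
have := classC_comp oU (U' := chart_cod c) _ hm (fs c hc k).
move=> /(_ (fun y hy => ex_intro2 _ _ _ hy.2 erefl)).
by apply: (classC_eq oU) => z [_ dz] /=; rewrite (chart_mapK (atlasP hc)).
Qed.

Lemma continuous_inl2 : continuous (fun x : V => (x, 0) : V * V).
Proof. move=> x; exact: (cvg_pair (@cvg_id _ (nbhs x)) (cvg_cst (0 : V))). Qed.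

Lemma continuous_inr2 : continuous (fun x : V => (0, x) : V * V).
Proof. move=> x; exact: (cvg_pair (cvg_cst (0 : V)) (@cvg_id _ (nbhs x))). Qed.

Lemma linear_inl2 : linear (fun x : V => (x, 0) : V * V).
Proof. by move=> c x y; congr (_, _); rewrite /= scaler0 addr0. Qed.

Lemma linear_inr2 : linear (fun x : V => (0, x) : V * V).
Proof. by move=> c x y; congr (_, _); rewrite /= scaler0 addr0. Qed.

Definition inl2 : {linear V -> (V * V)%type} := HB.pack (fun x : V => (x, 0) : V * V)
  (GRing.isLinear.Build _ _ _ _ _ linear_inl2).
Definition inr2 : {linear V -> (V * V)%type} := HB.pack (fun x : V => (0, x) : V * V)
  (GRing.isLinear.Build _ _ _ _ _ linear_inr2).

Lemma classC_slicel k (W : normedModType R) (A B : set V) (F : V * V -> W) (y : V) :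
  open A -> B y -> classC k [set z : V * V | A z.1 /\ B z.2] F ->
  classC k A (fun x => F (x, y)).
Proof.
move=> oA By hF.
apply: (classC_compA (L := inl2) (c := (0, y)) oA continuous_inl2 _ _ hF) => //=.
by move=> x; congr (_, _) => /=; rewrite ?add0r ?addr0.
Qed.

Lemma classC_slicer k (W : normedModType R) (A B : set V) (F : V * V -> W) (x : V) :
  open B -> A x -> classC k [set z : V * V | A z.1 /\ B z.2] F ->
  classC k B (fun y => F (x, y)).
Proof.
move=> oB Ax hF.
apply: (classC_compA (L := inr2) (c := (x, 0)) oB continuous_inr2 _ _ hF) => //=.
by move=> y; congr (_, _) => /=; rewrite ?add0r ?addr0.
Qed.

Lemma smoothG_mulr (g : G) (f : G -> R) : smoothG f -> smoothG (fun x => f (x * g)%g).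
Proof.
move=> fs a ha k.
have [b hb dg] := atlas_cover (@lie_smooth_atlas R n G) g.
have cb : chart_cod b (chart_map b g) by exists g.
have := classC_slicel (chart_cod_open (atlasP ha)) cb (smoothG_mul2 k ha hb fs).
by rewrite /= (chart_mapK (atlasP hb)).
Qed.

Lemma smoothG_mull (g : G) (f : G -> R) : smoothG f -> smoothG (fun x => f (g * x)%g).
Proof.
move=> fs b hb k.
have [a ha dg] := atlas_cover (@lie_smooth_atlas R n G) g.
have ca : chart_cod a (chart_map a g) by exists g.
have := classC_slicer (chart_cod_open (atlasP hb)) ca (smoothG_mul2 k ha hb fs).
by rewrite /= (chart_mapK (atlasP ha)).
Qed.

Lemma smoothG_inv (f : G -> R) : smoothG f -> smoothG (fun x => f (x^-1)%g).
Proof. exact: (smoothG_comp (@lie_smooth_inv R n G)). Qed.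

Lemma smoothG_cst (c : R) : smoothG (fun _ : G => c).
Proof. by move=> a ha k; exact: classC_cst. Qed.

Lemma smoothGD (f h : G -> R) : smoothG f -> smoothG h -> smoothG (fun x => f x + h x).
Proof.
move=> fs hs a ha k.
by apply: (classCD (chart_cod_open (atlasP ha)) (fs a ha k) (hs a ha k)).
Qed.

Lemma smoothGM (f h : G -> R) : smoothG f -> smoothG h -> smoothG (fun x => f x * h x).
Proof.
move=> fs hs a ha k.
by apply: (classCM (chart_cod_open (atlasP ha)) (fs a ha k) (hs a ha k)).
Qed.

Lemma smoothG_continuous (f : G -> R) : smoothG f -> continuous f.
Proof.
move=> fs x; have [a ha dx] := atlas_cover (@lie_smooth_atlas R n G) x.
have cx : chart_cod a (chart_map a x) by exists x.
have H := fs a ha 0 _ cx.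
have K : {for x, continuous ((f \o chart_inv a) \o chart_map a)}.
  by apply: continuous_comp => //; exact: chart_map_cont.
rewrite /prop_for /continuous_at /= (chart_mapK (atlasP ha) dx) in K.
apply: cvg_trans K; apply: near_eq_cvg.
apply: filterS (open_nbhs_nbhs (conj (chart_dom_open (atlasP ha)) dx)) => y dy /=.
by rewrite (chart_mapK (atlasP ha)).
Qed.
End SmoothFunctions.

(** * The chart at the identity, cutoff functions and separation of points *)

Section IdentityChart.
Context {R : realType} {n : nat} (G : lieGroupType R n).
Local Notation V := 'rV[R]_n.
Local Notation atlas := (@lie_atlas R n G).

Definition id_chart : chart R n G :=
  projT1 (cid2 (atlas_cover (@lie_smooth_atlas R n G) 1%g)).

Lemma id_chart_atlas : atlas id_chart.
Proof. by rewrite /id_chart; case: cid2. Qed.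

Lemma id_chart_dom1 : chart_dom id_chart 1%g.
Proof. by rewrite /id_chart; case: cid2. Qed.

(* the chart at the identity, translated so that the identity has coordinates 0 *)
Definition lcoord (x : G) : V := chart_map id_chart x - chart_map id_chart 1%g.
Definition lpt (v : V) : G := chart_inv id_chart (v + chart_map id_chart 1%g).
Definition ldom : set G := chart_dom id_chart.
Definition lcod : set V := [set v | chart_cod id_chart (v + chart_map id_chart 1%g)].

Lemma ldom1 : ldom 1%g. Proof. exact: id_chart_dom1. Qed.

Lemma open_ldom : open ldom.
Proof. exact/chart_dom_open/atlasP/id_chart_atlas. Qed.

Lemma lcoordK x : ldom x -> lpt (lcoord x) = x.
Proof. by move=> dx; rewrite /lpt subrK (chart_mapK (atlasP id_chart_atlas)). Qed.

Lemma lcod_lcoord x : ldom x -> lcod (lcoord x).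
Proof. by move=> dx; rewrite /lcod/= subrK; exists x. Qed.

Lemma lptK v : lcod v -> lcoord (lpt v) = v.
Proof. by move=> /(chart_invK id_chart_atlas)[_ E]; rewrite /lcoord E addrK. Qed.

Lemma ldom_lpt v : lcod v -> ldom (lpt v).
Proof. by move=> /(chart_invK id_chart_atlas)[]. Qed.

Lemma lcoord1 : lcoord 1%g = 0. Proof. by rewrite /lcoord subrr. Qed.

Lemma lpt0 : lpt 0 = 1%g.
Proof. by rewrite -lcoord1 lcoordK//; exact: ldom1. Qed.

Lemma lcod0 : lcod 0. Proof. by rewrite -lcoord1; apply: lcod_lcoord ldom1. Qed.

Lemma open_lcod : open lcod.
Proof.
have -> : lcod = [set v : V | setT v /\ chart_cod id_chart (v + chart_map id_chart 1%g)].
  by apply/seteqP; split=> v //= [].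
apply: open_within_preimage; first exact: openT.
  by move=> v _; apply: continuousD; [exact: cvg_id|exact: cst_continuous].
exact/chart_cod_open/atlasP/id_chart_atlas.
Qed.

Lemma lpt_cont v : lcod v -> {for v, continuous lpt}.
Proof.
move=> cv.
suff : {for v, continuous (chart_inv id_chart \o (fun v : V => v + chart_map id_chart 1%g))} by [].
apply: continuous_comp.
  by apply: continuousD; [exact: cvg_id|exact: cst_continuous].
exact: (chart_inv_cont id_chart_atlas cv).
Qed.

Lemma lcoord_cont x : ldom x -> {for x, continuous lcoord}.
Proof.
move=> dx; apply: continuousD; last exact: cst_continuous.
exact: (chart_map_cont id_chart_atlas dx).
Qed.

Lemma lrad_ex : exists r : R, 0 < r /\ forall v, `|v| <= r -> lcod v.
Proof.
have /nbhs_normP[r r0 H] : \forall v \near (0 : V), lcod v.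
  by apply: open_nbhs_nbhs; split; [exact: open_lcod|exact: lcod0].
exists (r / 2); split; first by rewrite divr_gt0.
move=> v vr; apply: H; rewrite subr0; apply: le_lt_trans vr _.
by rewrite ltr_pdivrMr// ltr_pMr// ltr1n.
Qed.

Definition lrad : R := projT1 (cid lrad_ex).
Lemma lrad_gt0 : 0 < lrad. Proof. by rewrite /lrad; case: cid => /= r []. Qed.
Lemma lcod_lrad v : `|v| <= lrad -> lcod v.
Proof. by rewrite /lrad; case: cid => /= r [_]; apply. Qed.

Lemma nbhs1_coord (P : set G) :
  nbhs 1%g P <-> exists2 r : R, 0 < r & forall v, `|v| <= r -> lcod v /\ P (lpt v).
Proof.
split=> [N|[r r0 H]].
  have H : \forall v \near (0 : V), lcod v /\ P (lpt v).
    apply: filterI.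
      by apply: open_nbhs_nbhs; split; [exact: open_lcod|exact: lcod0].
    by have := lpt_cont lcod0; rewrite /prop_for/continuous_at lpt0; apply.
  move/nbhs_normP : H => [r r0 H].
  exists (r / 2); first by rewrite divr_gt0.
  move=> v vr; apply: H; rewrite subr0; apply: le_lt_trans vr _.
  by rewrite ltr_pdivrMr// ltr_pMr// ltr1n.
have : \forall x \near (1%g : G), ldom x /\ `|lcoord x| < r.
  apply: filterI.
    by apply: open_nbhs_nbhs; split; [exact: open_ldom|exact: ldom1].
  have := lcoord_cont ldom1; rewrite /prop_for/continuous_at lcoord1.
  move=> /cvgr0_norm_lt; exact.
apply: filterS => x [dx xr].
by have [_] := H _ (ltW xr); rewrite lcoordK.
Qed.

Definition cutoff (h : V -> R) (x : G) : R :=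
  if `[< ldom x >] then bump 0 lrad (lcoord x) * h (lcoord x) else 0.

Lemma cutoffE h v : lcod v -> cutoff h (lpt v) = bump 0 lrad v * h v.
Proof.
by move=> cv; rewrite /cutoff; case: asboolP => [_|/(_ (ldom_lpt cv))//]; rewrite lptK.
Qed.

Lemma closed_ball_compact r : r <= lrad -> compact (lpt @` [set v | `|v| <= r]).
Proof.
move=> rr; apply: continuous_compact.
  apply: continuous_in_subspaceT => v /set_mem vr.
  by apply: lpt_cont; apply: lcod_lrad; exact: le_trans rr.
apply: bounded_closed_compact.
  by exists r; split; [exact: num_real|move=> y yr v /= vr; exact: le_trans (ltW yr)].
have -> : [set v : V | `|v| <= r] = (fun v : V => `|v|) @^-1` [set x | x <= r] by [].
by apply: closed_comp => [x _|]; [exact: norm_continuous|exact: closed_le].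
Qed.

(** The support of the bump lies in the image of the closed ball of radius [lrad]. This image is
    compact, hence closed because the group is Hausdorff; near any point outside the chart domain
    the extension by 0 is therefore identically 0. *)
Lemma smooth_cutoff h : (forall k, classC k setT h) -> smoothG (cutoff h).
Proof.
move=> hs a ha k; apply: classC_local => x cx.
have oa : open (chart_cod a) by exact/chart_cod_open/atlasP.
have ca y : chart_cod a y -> {for y, continuous (chart_inv a)} by exact: chart_inv_cont.
case: (pselect (ldom (chart_inv a x))) => [dx|ndx].
  exists [set y | chart_cod a y /\ ldom (chart_inv a y)] => //.
  have oU := open_within_preimage oa ca open_ldom.
  have tr : classC k [set y | chart_cod a y /\ ldom (chart_inv a y)]
      (fun y => chart_map id_chart (chart_inv a y)).
    exact: ((atlas_compatible (@lie_smooth_atlas R n G)).2 a id_chart ha id_chart_atlas k).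
  have tr2 : classC k [set y | chart_cod a y /\ ldom (chart_inv a y)]
      (fun y => lcoord (chart_inv a y)).
    by apply: (classCD oU tr); exact: classC_cst.
  have := classC_comp oU (U' := setT) _ tr2
     (classCM openT (classC_bump k 0 lrad) (hs k)).
  move=> /(_ (fun _ _ => I)); apply: (classC_eq oU) => y [_ dy] /=.
  by rewrite /cutoff; case: asboolP.
exists [set y | chart_cod a y /\ (~` (lpt @` [set v | `|v| <= lrad])) (chart_inv a y)].
  by split=> // -[v vr E]; apply: ndx; rewrite -E; exact/ldom_lpt/lcod_lrad.
have oU : open [set y | chart_cod a y /\
    (~` (lpt @` [set v | `|v| <= lrad])) (chart_inv a y)].
  apply: open_within_preimage => //; apply: closed_openC.
  by apply: compact_closed; [exact: lie_hausdorff|exact: closed_ball_compact].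
apply: (classC_eq oU _ (classC_cst k _ (0 : R))) => y [_ ny] /=.
rewrite /cutoff; case: asboolP => // dy.
have [->|b0] := eqVneq (bump 0 lrad (lcoord (chart_inv a y))) 0; first by rewrite mul0r.
exfalso; apply: ny; exists (lcoord (chart_inv a y)); last by rewrite lcoordK.
by have := bump_neq0 lrad_gt0 b0; rewrite subr0 => /ltW.
Qed.

(** These functions do the work of a distance on the group: a curve starting at 1 remains in [P] as
    long as [f] has not dropped from 1 to 0, and the rate of change of [f] can be estimated. *)
Lemma smoothG_bump (P : set G) : nbhs 1%g P -> exists f : G -> R,
  [/\ smoothG f, f 1%g = 1, forall x, 0 <= f x & forall x, f x != 0 -> P x].
Proof.
move=> /nbhs1_coord[r r0 H].
pose f := cutoff (bump 0 r); have fs : smoothG f.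
  by apply: smooth_cutoff => k; exact: classC_bump.
have f1 : 0 < f 1%g.
  rewrite -lpt0 /f cutoffE; last exact: lcod0.
  by rewrite mulr_gt0// bump_gt0// subr0 normr0//; exact: lrad_gt0.
exists (fun x => (f 1%g)^-1 * f x); split.
- by apply: smoothGM => //; exact: smoothG_cst.
- by rewrite mulVf// gt_eqF.
- move=> x; rewrite mulr_ge0// ?invr_ge0 ?(ltW f1)// /f /cutoff.
  by case: asboolP => // _; rewrite mulr_ge0// bump_ge0.
- move=> x; rewrite mulf_eq0 negb_or => /andP[_].
  rewrite /f /cutoff; case: asboolP => [dx|]; last by rewrite eqxx.
  rewrite mulf_eq0 negb_or => /andP[_] /bump_neq0 - /(_ r0); rewrite subr0 => /ltW xr.
  by rewrite -(lcoordK dx); exact: (H _ xr).2.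
Qed.

Lemma smoothG_separate (x y : G) : x <> y -> exists2 f : G -> R, smoothG f & f x <> f y.
Proof.
move=> xy; have N : nbhs (1%g : G) [set z | z <> (y * x^-1)%g].
  apply: open_nbhs_nbhs; split.
    have -> : [set z : G | z <> (y * x^-1)%g] = ~` [set (y * x^-1)%g] by [].
    apply: closed_openC; apply: accessible_closed_set1.
    by apply: hausdorff_accessible; exact: lie_hausdorff.
  by move=> /(congr1 (fun z => z * x)%g); rewrite mul1g mulgVK.
have [f [fs f1 _ fP]] := smoothG_bump N.
exists (fun z => f (z * x^-1)%g); first exact: smoothG_mulr.
rewrite mulgV f1 => E; apply: (fP (y * x^-1)%g) => //; rewrite -E.
exact: oner_neq0.
Qed.
End IdentityChart.

(** * Tangent vectors at the identity *)

Section Velocity.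
Context {R : realType} {n : nat} {G : lieGroupType R n}.
Local Notation V := 'rV[R]_n.
Local Notation lpt := (@lpt R n G).
Local Notation lcoord := (@lcoord R n G).
Local Notation lcod := (@lcod R n G).
Local Notation ldom := (@ldom R n G).

Lemma continuous_idfun (W : normedModType R) : continuous (idfun : W -> W).
Proof. by move=> x; exact: cvg_id. Qed.

Lemma smoothG_lpt (f : G -> R) k : smoothG f -> classC k lcod (f \o lpt).
Proof.
move=> fs.
exact: (classC_compA (L := idfun) (c := chart_map (id_chart G) 1%g)
   (f := fun v => v + chart_map (id_chart G) 1%g)
   (@open_lcod R n G) (@continuous_idfun V) (fun v => addrC _ _) (fun _ h => h)
   (fs (id_chart G) (id_chart_atlas G) k)).
Qed.

Lemma smoothG_mul_lpt (a : chart R n G) (f : G -> R) k : lie_atlas a -> smoothG f ->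
  classC k [set z : V * V | lcod z.1 /\ chart_cod a z.2]
    (fun z => f (lpt z.1 * chart_inv a z.2)%g).
Proof.
move=> ha fs; pose c := chart_map (id_chart G) 1%g.
have oU : open [set z : V * V | lcod z.1 /\ chart_cod a z.2].
  rewrite openE => -[u v] /= [cu cv]; exists (lcod, chart_cod a) => //=.
  split; apply: open_nbhs_nbhs; split=> //; first exact: open_lcod.
  exact/chart_cod_open/atlasP.
apply: (classC_compA (L := idfun) (c := (c, 0)) (f := fun z : V * V => (z.1 + c, z.2))
   oU (@continuous_idfun (V * V)%type) _ _ (smoothG_mul2 k (id_chart_atlas G) ha fs)) => //.
by move=> [x y]; congr (_, _); rewrite /= ?add0r// addrC.
Qed.

Lemma smoothG_lpt2 (f : G -> R) k : smoothG f ->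
  classC k [set z : V * V | lcod z.1 /\ lcod z.2] (fun z => f (lpt z.1 * lpt z.2)%g).
Proof.
move=> fs; pose c := chart_map (id_chart G) 1%g.
have oU : open [set z : V * V | lcod z.1 /\ lcod z.2].
  rewrite openE => -[u v] /= [cu cv]; exists (lcod, lcod) => //=.
  by split; apply: open_nbhs_nbhs; split=> //; exact: open_lcod.
apply: (classC_compA (L := idfun) (c := (0, c)) (f := fun z : V * V => (z.1, z.2 + c))
   oU (@continuous_idfun (V * V)%type) _ _ (smoothG_mul_lpt k (id_chart_atlas G) fs)) => //.
by move=> [x y]; congr (_, _); rewrite /= ?add0r// addrC.
Qed.

Lemma smoothG_diff (f : G -> R) v : smoothG f -> lcod v -> differentiable (f \o lpt) v.
Proof. by move=> fs cv; apply: (smoothG_lpt 1 fs).1. Qed.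

Lemma smoothG_diff2 (f : G -> R) z : smoothG f -> lcod z.1 -> lcod z.2 ->
  differentiable (fun z : V * V => f (lpt z.1 * lpt z.2)%g) z.
Proof. by move=> fs c1 c2; apply: (smoothG_lpt2 1 fs).1. Qed.

Lemma derive_slicel (W : normedModType R) (F : V * V -> W) v x y :
  'D_(v, 0) F (x, y) = 'D_v (fun u => F (u, y)) x.
Proof.
rewrite /derive.
set P := (fun h : R => _); set Q := (fun h : R => _).
suff -> : P = Q by [].
apply/funext => h; rewrite /P /Q; congr (_ *: (F _ - _)).
by congr (_, _); rewrite /= scaler0 add0r.
Qed.

Lemma derive_slicer (W : normedModType R) (F : V * V -> W) v x y :
  'D_(0, v) F (x, y) = 'D_v (fun u => F (x, u)) y.
Proof.
rewrite /derive.
set P := (fun h : R => _); set Q := (fun h : R => _).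
suff -> : P = Q by [].
apply/funext => h; rewrite /P /Q; congr (_ *: (F _ - _)).
by congr (_, _); rewrite /= scaler0 add0r.
Qed.

Definition dfe (f : G -> R) (v : V) : R := 'D_v (f \o lpt) 0.

Lemma dfeE f v : smoothG f -> dfe f v = 'd (f \o lpt) 0 v.
Proof. by move=> fs; rewrite /dfe deriveE//; apply: smoothG_diff => //; exact: lcod0. Qed.

Lemma dfe_lin f a v w : smoothG f -> dfe f (a *: v + w) = a * dfe f v + dfe f w.
Proof. by move=> fs; rewrite !dfeE// linearP. Qed.

Lemma dfeD f v w : smoothG f -> dfe f (v + w) = dfe f v + dfe f w.
Proof. by move=> fs; rewrite -[v]scale1r dfe_lin// mul1r scale1r. Qed.

Lemma dfe0 f : smoothG f -> dfe f 0 = 0.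
Proof. by move=> fs; rewrite dfeE// linear0. Qed.

Lemma dfeZ f a v : smoothG f -> dfe f (a *: v) = a * dfe f v.
Proof. by move=> fs; rewrite !dfeE// linearZ. Qed.

Lemma dfeB f v w : smoothG f -> dfe f (v - w) = dfe f v - dfe f w.
Proof. by move=> fs; rewrite dfeD// -scaleN1r dfeZ// mulN1r. Qed.

Lemma dfe_sum f (I : finType) (v : I -> V) : smoothG f ->
  dfe f (\sum_i v i) = \sum_i dfe f (v i).
Proof.
by move=> fs; apply: (big_morph (dfe f)) => [x y|]; [exact: dfeD|exact: dfe0].
Qed.

Lemma dfe_coord f v : smoothG f -> dfe f v = \sum_i v 0 i * dfe f (delta_mx 0 i).
Proof.
move=> fs; rewrite {1}(row_sum_delta v) dfe_sum//.
by apply: eq_bigr => i _; rewrite dfeZ.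
Qed.

Lemma dfe_linf (f h : G -> R) a v : smoothG f -> smoothG h ->
  dfe (fun x => a * f x + h x) v = a * dfe f v + dfe h v.
Proof.
move=> fs hs; have d0 := @lcod0 R n G.
have df : derivable (f \o lpt) 0 v by apply/diff_derivable/smoothG_diff.
have dh : derivable (h \o lpt) 0 v by apply/diff_derivable/smoothG_diff.
have [_ <-] // := is_deriveD (is_deriveZ a (derivableP df)) (derivableP dh).
Qed.

Lemma dfeM (f h : G -> R) v : smoothG f -> smoothG h ->
  dfe (fun x => f x * h x) v = f 1%g * dfe h v + dfe f v * h 1%g.
Proof.
move=> fs hs; have d0 := @lcod0 R n G.
have df : derivable (f \o lpt) 0 v by apply/diff_derivable/smoothG_diff.
have dh : derivable (h \o lpt) 0 v by apply/diff_derivable/smoothG_diff.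
rewrite /dfe; have := deriveM df dh; rewrite /= lpt0 => E.
by rewrite -[_ \o lpt]/((f \o lpt) * (h \o lpt)) E -![_ *: _]/(_ * _) (mulrC (h _)).
Qed.

Lemma classC_linear k (V1 W : normedModType R) (L : {linear V1 -> W}) (U : set V1) :
  continuous L -> classC k U L.
Proof.
move=> cL; case: k => [|k]; first by move=> x _; exact: cL.
split=> [x _|v]; first exact: linear_differentiable.
have -> : 'D_v L = fun=> L v.
  apply/funext => x; have dL : differentiable L x by exact: linear_differentiable.
  by rewrite (deriveE v dL) (diff_lin _ cL).
exact: classC_cst.
Qed.

Lemma classC_coordfun k i (a : R) : classC k setT (fun x : V => x 0 i * a).
Proof.
have lin : linear (fun x : V => x 0 i * a) by move=> c y z; rewrite !mxE mulrDl -mulrA.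
pose L : {linear V -> R} :=
  HB.pack (fun x : V => x 0 i * a) (GRing.isLinear.Build _ _ _ _ _ lin).
apply: (@classC_linear k _ _ L) => y.
by apply: continuousM; [exact: coord_continuous|exact: cst_continuous].
Qed.

(** A globally smooth substitute for the i-th coordinate. It is divided by the bump value at 0 so
    that its differential at 1 is exactly the i-th coordinate form; the derivative of the bump does
    not contribute, since the coordinate itself vanishes there. *)
Definition xc (i : 'I_n) : G -> R := 
  cutoff (fun v => v 0 i * (bump 0 (lrad G) (0 : V))^-1).

Lemma bump00 : 0 < bump 0 (lrad G) (0 : V).
Proof. by apply: bump_gt0; rewrite subr0 normr0; exact: lrad_gt0. Qed.

Lemma xc_smooth i : smoothG (xc i).
Proof. by apply: smooth_cutoff => k; exact: classC_coordfun. Qed.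

Lemma is_derive_coord0 (i : 'I_n) (x v : V) : is_derive x v (fun v : V => v 0 i) (v 0 i).
Proof.
have lin : linear (fun x : V => x 0 i) by move=> c y z; rewrite !mxE.
pose L : {linear V -> R} := HB.pack (fun x : V => x 0 i) (GRing.isLinear.Build _ _ _ _ _ lin).
have cL : continuous L by move=> y; exact: coord_continuous.
have dL : differentiable L x by exact: linear_differentiable.
suff : is_derive x v L (L v) by [].
split; first exact: diff_derivable.
by rewrite (deriveE v dL) (diff_lin _ cL).
Qed.

Lemma dfe_xc i v : dfe (xc i) v = v 0 i.
Proof.
rewrite /dfe.
rewrite (@near_eq_derive _ _ _ _ (fun v : V => (bump 0 (lrad G) v * (bump 0 (lrad G) (0 : V))^-1) * v 0 i)); last first.
  apply: filterS (open_nbhs_nbhs (conj (@open_lcod R n G) (@lcod0 R n G))) => x cx /=.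
  by rewrite /xc cutoffE// -mulrA (mulrC (x 0 i)).
have db : derivable (fun v : V => bump 0 (lrad G) v * (bump 0 (lrad G) (0 : V))^-1) 0 v.
  apply: diff_derivable; have := classCM openT (classC_bump 1 (0 : V) (lrad G)) (classC_cst 1 _ (bump 0 (lrad G) (0 : V))^-1).
  by case=> + _; apply.
have [dc Ec] := is_derive_coord0 i 0 v.
have := deriveM db dc; rewrite Ec mxE scale0r addr0 divff ?gt_eqF ?bump00// => ->.
by rewrite -[_ *: _]/(_ * _) mul1r.
Qed.

Lemma dfe_inj v w : (forall f, smoothG f -> dfe f v = dfe f w) -> v = w.
Proof. by move=> h; apply/rowP => i; rewrite -!dfe_xc h//; exact: xc_smooth. Qed.

Lemma is_derive_comp1 (W : normedModType R) (h : R -> W) (g : W -> R) (t : R) (v : W) :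
  is_derive t (1 : R) h v -> differentiable g (h t) ->
  is_derive t (1 : R) (g \o h) ('d g (h t) v).
Proof.
move=> [dh <-] dg; have dh' : differentiable h t by apply/derivable1_diffP.
have dc : differentiable (g \o h) t by exact: differentiable_comp.
split; first exact: diff_derivable.
by rewrite !deriveE// (diff_comp dh' dg).
Qed.

Lemma is_derive_rV (h : R -> V) (t : R) (v : V) :
  (forall i, is_derive t (1 : R) (fun s => h s 0 i) (v 0 i)) -> is_derive t (1 : R) h v.
Proof.
move=> H; have dh : derivable h t 1.
  by apply/derivable_mxP => j i; rewrite ord1; have [] := H i.
split=> //; rewrite derive_mx//; apply/rowP => i; rewrite mxE.
by have [_ ->] := H i.
Qed.

(** Continuity at 0 is part of the notion because [lcoord] says nothing about points outside the
    chart domain. *)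
Definition vel (c : R -> G) (v : V) : Prop :=
  [/\ c 0 = 1%g, c @ (0 : R) --> (1%g : G) &
      is_derive (0 : R) (1 : R) (lcoord \o c) v].

Lemma vel_derive c v f : vel c v -> smoothG f ->
  is_derive (0 : R) (1 : R) (f \o c) (dfe f v).
Proof.
move=> [c0 cc dc] fs; rewrite dfeE//.
apply: (@near_eq_is_derive _ _ _ ((f \o lpt) \o (lcoord \o c))).
  have : \forall t \near (0 : R), ldom (c t).
    by apply: cc; apply: open_nbhs_nbhs; split; [exact: open_ldom|exact: ldom1].
  by apply: filterS => t dt /=; rewrite lcoordK.
have -> : 'd (f \o lpt) 0 v = 'd (f \o lpt) ((lcoord \o c) 0) v by rewrite /= c0 lcoord1.
apply: is_derive_comp1 => //; apply: smoothG_diff => //.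
by rewrite /= c0 lcoord1; exact: lcod0.
Qed.

Lemma vel_uniq c v w : vel c v -> vel c w -> v = w.
Proof. by move=> [_ _ [_ <-]] [_ _ [_ <-]]. Qed.

Lemma derivable_cvg1 (c : R -> G) : c 0 = 1%g ->
  (forall f, smoothG f -> derivable (f \o c) 0 1) -> c @ (0 : R) --> (1%g : G).
Proof.
move=> c0 H P /smoothG_bump [f [fs f1 f0 fP]].
have /differentiable_continuous : differentiable (f \o c) 0.
  by apply/derivable1_diffP; exact: H.
rewrite /prop_for/continuous_at /= c0 f1 => /cvgr_gt - /(_ 0 ltr01).
by apply: filterS => t ft; apply: fP; rewrite gt_eqF.
Qed.

(** Continuity at 0 follows because bump functions detect neighbourhoods of 1. Near 1 the true
    coordinate is recovered from smooth functions as the quotient of [xc i] by the cutoff of the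
    constant 1, up to the factor [b0]. *)
Lemma vel_ex (c : R -> G) : c 0 = 1%g ->
  (forall f, smoothG f -> derivable (f \o c) 0 1) -> exists v, vel c v.
Proof.
move=> c0 H; have cc := derivable_cvg1 c0 H.
have bs : smoothG (cutoff (fun _ : V => 1 : R) : G -> R).
  by apply: smooth_cutoff => k; exact: classC_cst.
set B := cutoff _ in bs; set b0 := bump 0 (lrad G) (0 : V).
exists (\row_i 'D_1 (xc i \o c) 0); split=> //.
apply: is_derive_rV => i; rewrite mxE.
have B1 : B 1%g = b0 by rewrite /B -lpt0 cutoffE ?mulr1//; exact: lcod0.
have X1 : xc i 1%g = 0.
  by rewrite /xc -lpt0 cutoffE ?mxE ?mul0r ?mulr0//; exact: lcod0.
have bn : b0 != 0 by rewrite gt_eqF// bump00.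
apply: (@near_eq_is_derive _ _ _ (fun t => (xc i \o c) t * (b0 * ((B \o c) t)^-1))).
  have N1 : \forall t \near (0 : R), ldom (c t).
    by apply: cc; apply: open_nbhs_nbhs; split; [exact: open_ldom|exact: ldom1].
  have N2 : \forall t \near (0 : R), `|lcoord (c t)| < lrad G.
    have lc := @lcoord_cont R n G 1%g (@ldom1 R n G).
    have := cvg_comp c lcoord cc lc; rewrite lcoord1 => /cvgr0_norm_lt; apply.
    exact: lrad_gt0.
  near=> t.
  have dt : ldom (c t) by near: t.
  have lt : `|lcoord (c t)| < lrad G by near: t.
  have cl := lcod_lcoord dt.
  rewrite /= -{1 2}(lcoordK dt) /xc /B !cutoffE// mulr1.
  have : bump 0 (lrad G) (lcoord (c t)) != 0 by rewrite gt_eqF// bump_gt0// subr0.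
  rewrite -/b0; move: (bump _ _ _) (lcoord (c t) 0 i) => u w un.
  by field; rewrite un bn.
have dX := derivableP (H _ (xc_smooth i)).
have dB := derivableP (H _ bs).
have n0 : (B \o c) 0 != 0 by rewrite /= c0 B1.
have := is_deriveM dX (is_deriveM (is_derive_cst b0 _ _) (is_deriveV n0 dB)).
move=> HH; refine (is_derive_eq HH _).
have -> : (xc i \o c) 0 = 0 by rewrite /= c0.
rewrite scale0r add0r [X in X *: _](_ : _ = 1) ?scale1r//.
by rewrite -[LHS]/(b0 * (B (c 0))^-1) c0 B1 divff.
Unshelve. all: by end_near. Qed.

Lemma velI (c : R -> G) v : c 0 = 1%g ->
  (forall f, smoothG f -> is_derive (0 : R) (1 : R) (f \o c) (dfe f v)) -> vel c v.
Proof.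
move=> c0 H; have [w vw] : exists w, vel c w.
  by apply: vel_ex => // f fs; have [] := H f fs.
suff -> : v = w by [].
apply: dfe_inj => f fs; have [_ <-] := H f fs.
by have [_ <-] := vel_derive vw fs.
Qed.

Lemma vel_near (c d : R -> G) v : (\forall t \near (0 : R), c t = d t) -> vel c v -> vel d v.
Proof.
move=> cd vc; have [c0 _ _] := vc; apply: velI => [|f fs].
  by rewrite -(nbhs_singleton cd).
apply: near_eq_is_derive (vel_derive vc fs).
by apply: filterS cd => t /= ->.
Qed.

Lemma vel_cst : vel (fun=> 1%g) 0.
Proof. by apply: velI => // f fs; rewrite dfe0//; exact: is_derive_cst. Qed.

Lemma vel_line v : vel (fun t => lpt (t *: v)) v.
Proof.
apply: velI => [|f fs]; first by rewrite scale0r lpt0.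
have H : is_derive (0 : R) (1 : R) (fun t : R => (f \o lpt) (0 + t *: v)) ('D_v (f \o lpt) (0 + (0:R) *: v)).
  by apply: derive_line; apply: smoothG_diff; rewrite // scale0r addr0; exact: lcod0.
rewrite scale0r addr0 in H.
by rewrite (_ : f \o _ = fun t : R => (f \o lpt) (0 + t *: v))//; apply/funext => t /=; rewrite add0r.
Qed.

Lemma vel_scale c v (a : R) : vel c v -> vel (fun t => c (a * t)) (a *: v).
Proof.
move=> vc; have [c0 _ _] := vc; apply: velI => [|f fs]; first by rewrite mulr0.
rewrite dfeZ// mulrC.
have dl : is_derive (0 : R) (1 : R) (fun t : R => a * t) a.
  have := @is_deriveZ _ _ _ id a (0:R) (1:R) 1 (is_derive_id _ _).
  by rewrite [a *: (1:R)]mulr1.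
apply: (is_derive1_comp (f := f \o c) (g := fun t => a * t)) => //.
by rewrite mulr0; exact: vel_derive.
Qed.

(** The differential of the multiplication at the pair of identities is addition, since both partial
    maps are the identity there. *)
Lemma vel_mul c d v w : vel c v -> vel d w -> vel (fun t => c t * d t)%g (v + w).
Proof.
move=> vc vd; have [c0 cc dc] := vc; have [d0 cd dd] := vd.
apply: velI => [|f fs]; first by rewrite c0 d0 mulg1.
have d2 : differentiable (fun z : V * V => f (lpt z.1 * lpt z.2)%g) (0, 0).
  by apply: smoothG_diff2 => //; exact: lcod0.
set F := fun z : V * V => _ in d2.
have -> : dfe f (v + w) = 'd F ((fun t => (lcoord (c t), lcoord (d t))) 0) (v, w).
  rewrite /= c0 d0 lcoord1 dfeD//.
  have -> : (v, w) = inl2 v + inr2 w :> V * V by congr (_, _); rewrite /= ?addr0 ?add0r.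
  rewrite linearD/= -!deriveE// /dfe; congr (_ + _).
    rewrite derive_slicel; congr ('D_v _ _); apply/funext => u.
    by rewrite /F /= lpt0 mulg1.
  rewrite derive_slicer; congr ('D_w _ _); apply/funext => u.
  by rewrite /F /= lpt0 mul1g.
have dcd : is_derive (0 : R) (1 : R) (fun t => (lcoord (c t), lcoord (d t))) (v, w).
  apply/is_derive_leP => e e0.
  have /is_derive_leP/(_ _ e0) := dc; have /is_derive_leP/(_ _ e0) := dd.
  apply: filterS2 => h h1 h2.
  by rewrite prod_normE ge_max h1 h2.
have HH := is_derive_comp1 dcd; rewrite /= c0 d0 lcoord1 in HH *.
have {}HH := HH _ d2.
apply: near_eq_is_derive HH.
have N1 : \forall t \near (0 : R), ldom (c t).
  by apply: cc; apply: open_nbhs_nbhs; split; [exact: open_ldom|exact: ldom1].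
have N2 : \forall t \near (0 : R), ldom (d t).
  by apply: cd; apply: open_nbhs_nbhs; split; [exact: open_ldom|exact: ldom1].
by apply: filterS2 N1 N2 => t dt1 dt2; rewrite /F /= !lcoordK.
Qed.

(** Smoothness is expressed by pullback of functions, which needs no charts. Compatibility with the
    product is left out so that inversion is covered too. *)
Definition smooth_endo (F : G -> G) : Prop :=
  F 1%g = 1%g /\ forall f : G -> R, smoothG f -> smoothG (f \o F).

(** The differential of [F] at the identity, read off through the globally defined [xc i] rather
    than through chart coordinates. *)
Definition tmap (F : G -> G) (v : V) : V := \row_i dfe (xc i \o F) v.

Lemma vel_tmap F c v : smooth_endo F -> vel c v -> vel (F \o c) (tmap F v).
Proof.
move=> [F1 Fs] vc; have [c0 _ _] := vc.
have [w vw] : exists w, vel (F \o c) w.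
  apply: vel_ex => [|f fs]; first by rewrite /= c0.
  by have [] := vel_derive vc (Fs f fs).
suff -> : tmap F v = w by [].
apply/rowP => i; rewrite mxE -dfe_xc.
have [_ <-] := vel_derive vc (Fs _ (xc_smooth i)).
by have [_ <-] := vel_derive vw (xc_smooth i).
Qed.

Lemma tmapE F f v : smooth_endo F -> smoothG f -> dfe (f \o F) v = dfe f (tmap F v).
Proof.
move=> Fe fs; have [_ Fs] := Fe.
have [_ <-] := vel_derive (vel_line v) (Fs _ fs).
by have [_ <-] := vel_derive (vel_tmap Fe (vel_line v)) fs.
Qed.

Lemma tmap_lin F a v w : smooth_endo F -> tmap F (a *: v + w) = a *: tmap F v + tmap F w.
Proof.
move=> [_ Fs]; apply/rowP => i.
by rewrite 4!mxE dfe_lin ?mxE//; apply: Fs; exact: xc_smooth.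
Qed.

Lemma tmap_comp F F' v : smooth_endo F -> smooth_endo F' ->
  tmap (F \o F') v = tmap F (tmap F' v).
Proof.
move=> Fe Fe'.
have Fc : smooth_endo (F \o F').
  split=> [|f fs]; first by rewrite /= Fe'.1 Fe.1.
  exact: (Fe'.2 _ (Fe.2 _ fs)).
exact: vel_uniq (vel_tmap Fc (vel_line v)) (vel_tmap Fe (vel_tmap Fe' (vel_line v))).
Qed.

Lemma tmap_id v : tmap id v = v.
Proof. by apply/rowP => i; rewrite mxE dfe_xc. Qed.

Lemma smooth_endo_inv : smooth_endo (fun x : G => (x^-1)%g).
Proof. by split=> [|f fs]; [exact: invg1|exact: smoothG_inv]. Qed.

Lemma vel_inv c v : vel c v -> vel (fun t => (c t)^-1)%g (- v).
Proof.
move=> vc; have H := vel_tmap smooth_endo_inv vc.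
have /vel_uniq E := vel_mul vc H.
have /E : vel (fun t => c t * (fun x => (x^-1)) (c t))%g 0.
  by rewrite (_ : (fun t => _) = fun=> 1%g); [exact: vel_cst|apply/funext => t; rewrite mulgV].
by move=> /eqP; rewrite addr_eq0 => /eqP Ev; rewrite Ev opprK.
Qed.

Lemma smooth_endo_conj (g : G) : smooth_endo (fun x : G => g * x * g^-1)%g.
Proof.
split=> [|f fs]; first by rewrite mulg1 mulgV.
exact: (smoothG_mull g (smoothG_mulr g^-1%g fs)).
Qed.

Definition Ad (g : G) : V -> V := tmap (fun x => g * x * g^-1)%g.

Lemma AdM g h v : Ad (g * h)%g v = Ad g (Ad h v).
Proof.
rewrite /Ad -tmap_comp; [|exact: smooth_endo_conj|exact: smooth_endo_conj].
congr (tmap _ v); apply/funext => x /=.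
by rewrite invgM !mulgA.
Qed.

Lemma Ad1 v : Ad 1%g v = v.
Proof.
rewrite /Ad -[RHS]tmap_id; congr (tmap _ v); apply/funext => x /=.
by rewrite invg1 mulg1 mul1g.
Qed.

Lemma AdK g v : Ad g^-1%g (Ad g v) = v.
Proof. by rewrite -AdM mulVg Ad1. Qed.

Lemma Ad_lin g a v w : Ad g (a *: v + w) = a *: Ad g v + Ad g w.
Proof. exact: tmap_lin (smooth_endo_conj g). Qed.

Lemma vel_conj g c v : vel c v -> vel (fun t => g * c t * g^-1)%g (Ad g v).
Proof. exact: vel_tmap (smooth_endo_conj g). Qed.
End Velocity.

(** * Right-invariant fields and integral curves *)

Section RightInvariant.
Context {R : realType} {n : nat} {G : lieGroupType R n}.
Local Notation V := 'rV[R]_n.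

Definition rinv (v : V) : operator G := fun f =>
  if `[< smoothG f >] then fun g => dfe (fun x => f (x * g)%g) v else fun=> 0.

Lemma rinvE v (f : G -> R) g : smoothG f -> rinv v f g = dfe (fun x => f (x * g)%g) v.
Proof. by move=> fs; rewrite /rinv; case: asboolP. Qed.

Lemma rinv1 v (f : G -> R) : smoothG f -> rinv v f 1%g = dfe f v.
Proof.
by move=> fs; rewrite rinvE//; congr (dfe _ v); apply/funext => x; rewrite mulg1.
Qed.

Lemma smooth_rinv v (f : G -> R) : smoothG f -> smoothG (rinv v f).
Proof.
move=> fs a ha k.
have oa : open (chart_cod a) by exact/chart_cod_open/atlasP.
(* The field is a partial derivative: one differentiates the function of two variables along
   [(v, 0)], losing one order of smoothness, and then restricts to first coordinate 0. *)
have H := (smoothG_mul_lpt k.+1 ha fs).2 (v, 0).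
have := classC_slicer oa (@lcod0 R n G) H; apply: (classC_eq oa) => x cx.
by rewrite derive_slicel /= rinvE.
Qed.

Lemma right_invariant_rinv v : right_invariant (rinv v).
Proof.
split; first split.
- by move=> f; exact: smooth_rinv.
- by move=> f nf; rewrite /rinv; case: asboolP.
- move=> a f h fs hs; apply/funext => g.
  have fhs : smoothG (fun x : G => a * f x + h x).
    by apply: smoothGD => //; apply: smoothGM => //; exact: smoothG_cst.
  rewrite !rinvE// -dfe_linf//; exact: smoothG_mulr.
- move=> f h fs hs; apply/funext => g.
  rewrite !rinvE//; last exact: smoothGM.
  rewrite (dfeM v (smoothG_mulr g fs) (smoothG_mulr g hs)) !mul1g//.
- move=> g f fs; apply/funext => x.
  rewrite !rinvE//; last exact: smoothG_mulr.
  by congr (dfe _ v); apply/funext => y; rewrite mulgA.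
Qed.

Lemma right_invariantE (Y : operator G) f g : right_invariant Y -> smoothG f ->
  Y f g = Y (fun x => f (x * g)%g) 1%g.
Proof. by move=> [_ H] fs; rewrite H// mul1g. Qed.

Lemma right_invariant_eq (Y Z : operator G) : right_invariant Y -> right_invariant Z ->
  (forall f, smoothG f -> Y f 1%g = Z f 1%g) -> Y = Z.
Proof.
move=> rY rZ YZ; apply/funext => f; case: (pselect (smoothG f)) => fs.
  apply/funext => g; rewrite (right_invariantE g rY fs) (right_invariantE g rZ fs).
  by apply: YZ; exact: smoothG_mulr.
by rewrite (vf_junk rY.1 fs) (vf_junk rZ.1 fs).
Qed.

Lemma is_derive_shift0 (W : normedModType R) (f : R -> W) (t : R) l :
  is_derive t (1 : R) f l <-> is_derive (0 : R) (1 : R) (fun s => f (t + s)) l.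
Proof.
by split=> /is_derive_leP H; apply/is_derive_leP => e e0; have {H} := H e e0;
  apply: filterS => h; rewrite addr0 add0r.
Qed.

(** This turns velocities, which are functionals on smooth functions, into row vectors: translate
    the curve to the identity and apply [vel_ex]. *)
Lemma velocity_vel (gamma : R -> G) t (w : (G -> R) -> R) :
  velocity gamma t w -> exists v,
    vel (fun s => gamma (t + s) * (gamma t)^-1)%g v /\
    forall f, smoothG f -> w f = dfe (fun x => f (x * gamma t)%g) v.
Proof.
move=> H.
have D (f : G -> R) : smoothG f ->
    is_derive (0 : R) (1 : R) (f \o (fun s => gamma (t + s) * (gamma t)^-1)%g)
      (w (fun x => f (x * (gamma t)^-1)%g)).
  move=> fs; have /is_derive_shift0 := H _ (smoothG_mulr (gamma t)^-1%g fs).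
  by [].
have [v vv] : exists v, vel (fun s => gamma (t + s) * (gamma t)^-1)%g v.
  apply: vel_ex => [|f fs]; first by rewrite addr0 mulgV.
  by have [] := D f fs.
exists v; split=> // f fs.
have fs' := smoothG_mulr (gamma t) fs.
have [_ E1] := vel_derive vv fs'; have [_ E2] := D _ fs'.
rewrite -E1 E2; congr (w _); apply/funext => x.
by rewrite mulgVK.
Qed.

Lemma vel_velocity (gamma : R -> G) t v :
  vel (fun s => gamma (t + s) * (gamma t)^-1)%g v ->
  velocity gamma t (fun f => dfe (fun x => f (x * gamma t)%g) v).
Proof.
move=> vv f fs; apply/is_derive_shift0.
have := vel_derive vv (smoothG_mulr (gamma t) fs).
by rewrite (_ : (fun s => f (gamma (t + s))) =
  (fun x => f (x * gamma t)%g) \o (fun s => gamma (t + s) * (gamma t)^-1)%g)//;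
  apply/funext => s /=; rewrite mulgVK.
Qed.
End RightInvariant.

(** * Curves with finitely many exceptional times *)

Section MeanValue.
Context {R : realType}.

(** The list [s] stands for the switching times of a control. Induction on it splits the interval at
    an exceptional point; without exceptions the claim is the mean value theorem. *)
Lemma lipschitz_except (h dh : R -> R) (s : seq R) (M a b : R) : a <= b ->
  continuous h ->
  (forall t, a < t -> t < b -> t \notin s -> is_derive t (1 : R) h (dh t) /\ `|dh t| <= M) ->
  0 <= M -> `|h b - h a| <= M * (b - a).
Proof.
move=> ab ch H M0; elim: s a b ab H => [|x s IH] a b ab H.
  have [t tab ->] : exists2 t, t \in `]a, b[%R \/ a = b &
      h b - h a = dh t * (b - a).
    have [/eqP E|nab] := eqVneq a b.
      by exists a; [right; exact/eqP|rewrite (eqP E) !subrr mulr0].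
    have {}ab : a < b by rewrite lt_neqAle nab.
    have [||t tab E] := @MVT R h dh a b ab.
    - by move=> t; rewrite in_itv/= => /andP[at_ tb]; have [] := H t at_ tb isT.
    - by apply: continuous_subspaceT.
    - by exists t => //; left.
  rewrite normrM (ger0_norm (_ : 0 <= b - a)) ?subr_ge0//.
  case: tab => [|->]; last by rewrite subrr !mulr0.
  rewrite in_itv/= => /andP[at_ tb]; rewrite ler_wpM2r ?subr_ge0//.
  by have [] := H t at_ tb isT.
have [xab|] := boolP ((a < x) && (x < b)).
  have /andP[ax xb] := xab.
  have h1 : `|h x - h a| <= M * (x - a).
    apply: IH; [exact: ltW|] => t at_ tx ts; apply: H => //; first exact: lt_trans xb.
    by rewrite inE negb_or ts lt_eqF.
  have h2 : `|h b - h x| <= M * (b - x).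
    apply: IH; [exact: ltW|] => t xt tb ts; apply: H => //; first exact: lt_trans xt.
    by rewrite inE negb_or ts gt_eqF.
  have -> : h b - h a = (h b - h x) + (h x - h a) by rewrite addrA subrK.
  have -> : M * (b - a) = M * (b - x) + M * (x - a) by ring.
  by apply: le_trans (ler_normD _ _) _; exact: lerD.
move=> nx; apply: IH => // t at_ tb ts; apply: H => //.
rewrite inE negb_or ts andbT; apply: contraNneq nx => <-.
by rewrite at_ tb.
Qed.
End MeanValue.

Section Curves.
Context {R : realType} {n : nat} {G : lieGroupType R n}.
Local Notation V := 'rV[R]_n.

Lemma curve_const_except (c : R -> G) (s : seq R) (a b : R) : a <= b ->
  continuous c ->
  (forall t, a < t -> t < b -> t \notin s ->
     vel (fun h => c (t + h) * (c t)^-1)%g 0) -> c b = c a.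
Proof.
move=> ab cc H; apply: contrapT => /(@smoothG_separate R n G)[f fs]; apply.
apply/eqP; rewrite -subr_eq0 -normr_le0 -[leRHS](mul0r (b - a)).
apply: (@lipschitz_except R (f \o c) (fun=> 0) s) => //.
  by move=> x; apply: continuous_comp; [exact: cc|exact: smoothG_continuous].
move=> t at_ tb ts; split; last by rewrite normr0.
have := vel_velocity (H t at_ tb ts) fs; rewrite dfe0//; exact: smoothG_mulr.
Qed.

Lemma curve_const (c : R -> G) : continuous c ->
  (forall t, vel (fun h => c (t + h) * (c t)^-1)%g 0) -> forall t, c t = c 0.
Proof.
move=> cc H t; have [t0|t0] := leP 0 t.
  by apply: (@curve_const_except c [::] 0 t).
by apply/esym; apply: (@curve_const_except c [::] t 0) => //; exact: ltW.
Qed.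

(** Off the closed set [K] the function is locally zero and contributes no derivative. A bound on
    [K] therefore suffices, and the curve is not assumed to stay in [K]. *)
Lemma speed_bound (K : set G) (f : G -> R) (gamma : R -> G) (d : R -> R) (s : seq R)
    (M a b : R) : closed K -> (forall x, f x != 0 -> K x) -> continuous f ->
  continuous gamma -> a <= b -> 0 <= M ->
  (forall t, a < t -> t < b -> t \notin s ->
    is_derive t (1 : R) (f \o gamma) (d t) /\ (K (gamma t) -> `|d t| <= M)) ->
  `|f (gamma b) - f (gamma a)| <= M * (b - a).
Proof.
move=> cK fK fc gc ab M0 H.
apply: (@lipschitz_except R (f \o gamma) d s) => //.
  by move=> x; apply: continuous_comp; [exact: gc|exact: fc].
move=> t at_ tb ts; have [H1 H2] := H t at_ tb ts; split=> //.
case: (pselect (K (gamma t))) => [/H2//|nK].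
suff -> : d t = 0 by rewrite normr0.
have [_ <-] := H1.
have : is_derive t (1 : R) (cst (0 : R)) (0 : R) by exact: is_derive_cst.
move=> [_ E]; rewrite -[RHS]E; apply: near_eq_derive.
have : \forall x \near t, (~` K) (gamma x).
  by apply: gc; apply: open_nbhs_nbhs; split=> //; exact: closed_openC.
apply: filterS => x nKx /=; apply/eqP; apply: contra_notT nKx; exact: fK.
Qed.
End Curves.

(** * Linear fields and their flows *)

Section LinearFields.
Context {R : realType} {n : nat} {G : lieGroupType R n}.
Local Notation V := 'rV[R]_n.

Lemma vel_ext (c d : R -> G) v : (forall t, c t = d t) -> vel c v -> vel d v.
Proof. by move=> /funext ->. Qed.

Lemma morph1 (F : G -> G) : {morph F : x y / (x * y)%g} -> F 1%g = 1%g.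
Proof. by move=> hF; apply: (mulIg (F 1%g)); rewrite -hF !mul1g. Qed.

Lemma morphV (F : G -> G) x : {morph F : x y / (x * y)%g} -> F x^-1%g = (F x)^-1%g.
Proof. by move=> hF; apply: (mulIg (F x)); rewrite -hF !mulVg morph1. Qed.

Variable X : linear_field G.
Local Notation phi := (lf_flow X).

Lemma flowM t : {morph phi t : x y / (x * y)%g}.
Proof. by have [] := lf_automorphism X t. Qed.

Lemma flow1 t : phi t 1%g = 1%g. Proof. exact/morph1/flowM. Qed.

Lemma flowV t x : phi t x^-1%g = (phi t x)^-1%g. Proof. exact/morphV/flowM. Qed.

Lemma flowK t x : phi (- t) (phi t x) = x.
Proof. by rewrite -lf_flowD addNr lf_flow0. Qed.

Lemma flowVK t x : phi t (phi (- t) x) = x.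
Proof. by rewrite -lf_flowD subrr lf_flow0. Qed.

Lemma smooth_endo_flow t : smooth_endo (phi t).
Proof.
split; first exact: flow1.
by move=> f fs; have [_ [F' [_ _ s1 _]]] := lf_automorphism X t; exact: smoothG_comp.
Qed.

Lemma flow_cont_time g : continuous (fun t => phi t g).
Proof. by have [] := lf_flowP X g. Qed.

Lemma flow_cont t : continuous (phi t).
Proof. by have [_ [F' [_ _ [] ]]] := lf_automorphism X t. Qed.

Lemma flow_derive g t f : smoothG f ->
  is_derive t (1 : R) (fun s => f (phi s g) : R) (lf_field X f (phi t g)).
Proof. by move=> fs; have [_] := lf_flowP X g; apply. Qed.

Lemma field1 f : smoothG f -> lf_field X f 1%g = 0.
Proof.
move=> fs; have := flow_derive 1%g 0 fs; rewrite lf_flow0.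
rewrite (_ : (fun s => _) = cst (f 1%g)); last by apply/funext => s; rewrite flow1.
by move=> [_ <-]; exact: derive_cst.
Qed.

Definition dflow (t : R) : V -> V := tmap (phi t).

Lemma dflow_lin t a v w : dflow t (a *: v + w) = a *: dflow t v + dflow t w.
Proof. exact/tmap_lin/smooth_endo_flow. Qed.

Lemma dflow_0 t : dflow t 0 = 0.
Proof. by have := dflow_lin t (-1) 0 0; rewrite scaleN1r oppr0 addr0 scaleN1r addNr. Qed.

Lemma dflow0 v : dflow 0 v = v.
Proof.
by rewrite /dflow -[RHS](@tmap_id R n G); congr (tmap _ v); apply/funext => x; rewrite lf_flow0.
Qed.

Lemma dflowD s t v : dflow (s + t) v = dflow s (dflow t v).
Proof.
rewrite /dflow -tmap_comp; [|exact: smooth_endo_flow|exact: smooth_endo_flow].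
by congr (tmap _ v); apply/funext => x; rewrite lf_flowD.
Qed.

Lemma kappa_ex g : exists v, vel (fun s => phi s g * g^-1)%g v.
Proof.
have [_ /(_ 0)/velocity_vel[v [vv _]]] := lf_flowP X g.
by exists v; apply: vel_ext vv => s; rewrite lf_flow0 add0r.
Qed.

(* the field X, trivialised by right translations *)
Definition kappa (g : G) : V := projT1 (cid (kappa_ex g)).

Lemma kappaP g : vel (fun s => phi s g * g^-1)%g (kappa g).
Proof. by rewrite /kappa; case: cid. Qed.

Lemma kappaM g h : kappa (g * h)%g = kappa g + Ad g (kappa h).
Proof.
apply: (vel_uniq (kappaP (g * h)%g)).
apply: vel_ext (vel_mul (kappaP g) (vel_conj g (kappaP h))) => t.
by rewrite flowM invgM !mulgA mulgVK.
Qed.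

Lemma kappa_flow s g : kappa (phi s g) = dflow s (kappa g).
Proof.
apply: (vel_uniq (kappaP (phi s g))).
apply: vel_ext (vel_tmap (smooth_endo_flow s) (kappaP g)) => t /=.
by rewrite flowM flowV -!lf_flowD (addrC s).
Qed.

Lemma kappa1 : kappa 1%g = 0.
Proof.
apply: (vel_uniq (kappaP 1%g)); apply: vel_ext (@vel_cst R n G) => s.
by rewrite flow1 mulgV.
Qed.

Lemma vel_flow t g : vel (fun s => phi (t + s) g * (phi t g)^-1)%g (kappa (phi t g)).
Proof.
by apply: vel_ext (kappaP (phi t g)) => s; rewrite -lf_flowD addrC.
Qed.

Lemma kappa_fixed g : kappa g = 0 -> forall t, phi t g = g.
Proof.
move=> k0 t; rewrite -[RHS](lf_flow0 X).
apply: (curve_const (c := fun t => phi t g)); first exact: flow_cont_time.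
move=> s; have := vel_flow s g; rewrite kappa_flow k0.
by rewrite dflow_0.
Qed.

Lemma field_smooth f : smoothG f -> smoothG (lf_field X f).
Proof. exact: (vf_smooth (lf_vector_field X)). Qed.

Lemma closed_bound (f : G -> R) (K : set G) : compact K -> smoothG f ->
  exists2 M : R, 0 <= M & forall x, K x -> `|f x| <= M.
Proof.
move=> cK fs.
have cf : compact ((fun x => `|f x|) @` K).
  apply: continuous_compact => //; apply: continuous_subspaceT => x.
  by apply: continuous_comp; [exact: smoothG_continuous|exact: norm_continuous].
have [M [_ MP]] := compact_bounded cf.
exists (`|M| + 1); first by rewrite addr_ge0.
move=> x Kx; have := MP (`|M| + 1) _ (`|f x|) (ex_intro2 _ _ x Kx erefl).
by rewrite /= normr_id; apply; rewrite (le_lt_trans (ler_norm _))// ltrDl.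
Qed.

Lemma nbhs1_compact (P : set G) : nbhs 1%g P ->
  exists K : set G, [/\ compact K, nbhs 1%g K & K `<=` P].
Proof.
move=> /nbhs1_coord[r r0 H].
pose r' := Num.min r (lrad G).
have r'0 : 0 < r' by rewrite lt_min r0 lrad_gt0.
exists (@lpt R n G @` [set v | `|v| <= r']); split.
- by apply: closed_ball_compact; rewrite ge_min lexx orbT.
- apply/nbhs1_coord; exists r' => // v vr; split; last by exists v.
  by apply: lcod_lrad; apply: le_trans vr _; rewrite ge_min lexx orbT.
- by move=> _ [v /= vr <-]; apply: (H v _).2; apply: le_trans vr _; rewrite ge_min lexx.
Qed.

(** The bump function supported in a compact [K] inside [P] changes along the flow at a rate bounded
    on [K], uniformly in the starting point. *)
Lemma flow_near1 (P : set G) : nbhs 1%g P -> exists2 d : R, 0 < d &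
  nbhs 1%g [set x | forall t, `|t| <= d -> P (phi t x)].
Proof.
move=> /nbhs1_compact[K [cK nK KP]].
have [f [fs f1 f0 fK]] := smoothG_bump nK.
have [M M0 MP] := closed_bound cK (field_smooth fs).
have clK : closed K by apply: compact_closed cK; exact: lie_hausdorff.
(* During time [d] the function [f] changes by less than 1/2, and it starts above 1/2, so it cannot
   reach 0. *)
pose d := (2 * (M + 1))^-1.
have d0 : 0 < d by rewrite invr_gt0 mulr_gt0// ltr_wpDl.
exists d => //.
have : \forall x \near (1%g : G), 1 / 2 < f x.
  have := @smoothG_continuous R n G f fs 1%g; rewrite /continuous_at f1.
  by move/cvgr_gt; apply; rewrite ltr_pdivrMr// mul1r ltr1n.
apply: filterS => x fx t td; have key := fun h => KP _ (fK (phi t x) h); apply: key; rewrite gt_eqF//.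
have bd a b : a <= b -> `|f (phi b x) - f (phi a x)| <= M * (b - a).
  move=> ab; apply: (@speed_bound _ _ _ K f (fun t => phi t x)
    (fun t => lf_field X f (phi t x)) [::] M) => //.
  - exact: smoothG_continuous.
  - exact: flow_cont_time.
  - by move=> s _ _ _; split; [exact: flow_derive|exact: MP].
have : `|f (phi t x) - f x| <= M * `|t|.
  rewrite -{2}(lf_flow0 X x); have [t0|t0] := leP 0 t.
    by rewrite (ger0_norm t0); have := bd 0 t t0; rewrite subr0.
  by rewrite distrC (ltr0_norm t0); have := bd t 0 (ltW t0); rewrite sub0r.
have : M * `|t| < 1 / 2.
  apply: (le_lt_trans (ler_wpM2l M0 td)); rewrite /d invfM mulrA ltr_pdivrMr ?ltr_wpDl//.
  by rewrite mulrC mul1r ltr_pM2l// ltrDl.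
rewrite ler_norml => h1 /andP[h2 _]; lra.
Qed.

(** Joint continuity in time and space. As the flow acts by automorphisms, the claim reduces to
    small times and points near 1, which [flow_near1] handles, together with continuity in each
    variable alone. *)
Lemma flow_cvg (T : Type) (F : set_system T) (a : T -> R) (g : T -> G) (t : R) (x : G) :
  Filter F -> a @ F --> t -> g @ F --> x -> (fun i => phi (a i) (g i)) @ F --> phi t x.
Proof.
move=> FF at_ gx.
have E : (fun i => phi (a i) (g i)) =
    (fun i => phi t (phi (a i - t) (g i * x^-1) * phi (a i - t) x))%g.
  by apply/funext => i; rewrite -flowM mulgVK -lf_flowD addrC subrK.
rewrite E; apply: (cvg_comp (fun i => (phi (a i - t) (g i * x^-1) * phi (a i - t) x)%g) (phi t)); last exact: flow_cont.
have a0 : (fun i => a i - t) @ F --> (0 : R).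
  by rewrite -(subrr t); apply: cvgB => //; exact: cvg_cst.
suff : (fun i => phi (a i - t) (g i * x^-1) * phi (a i - t) x)%g @ F --> (1 * x)%g.
  by rewrite mul1g.
apply: mulg_cvg; last first.
  have := @flow_cont_time x 0; rewrite /continuous_at lf_flow0 => H.
  exact: (cvg_comp _ _ a0 H).
have g1 : (fun i => g i * x^-1)%g @ F --> (1%g : G).
  suff : (fun i => g i * x^-1)%g @ F --> (x * x^-1)%g by rewrite mulgV.
  by apply: mulg_cvg => //; exact: cvg_cst.
move=> P /flow_near1[d d0 H].
have N1 : \forall i \near F, `|a i - t| <= d by move/cvgr0_norm_le : a0; apply.
have N2 := g1 _ H.
by apply: filterS2 N1 N2 => i ad; apply.
Qed.

(** The field vanishes at 1, so flowing the point [c h] for a time proportional to [h] moves it only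
    by o(h). *)
Lemma vel_flow_apply c v (k : R) : vel c v -> vel (fun h => phi (k * h) (c h)) v.
Proof.
move=> vc; have [c0 cc _] := vc.
apply: velI => [|f fs]; first by rewrite c0 flow1.
have /is_derive_leP D := vel_derive vc fs.
apply/is_derive_leP => e e0.
have e20 : 0 < e / 2 by rewrite divr_gt0.
have ek : 0 < e / 2 / (`|k| + 1) by rewrite !divr_gt0// ltr_wpDl.
have kc : (fun h => k * h) @ (0 : R) --> (0 : R).
  suff : (fun h => k * h) @ (0 : R) --> k * 0 by rewrite mulr0.
  by apply: cvgM; [exact: cvg_cst|exact: cvg_id].
have {}D := D _ e20.
pose P := [set x : G | `|lf_field X f x| <= e / 2 / (`|k| + 1)].
have /flow_near1[d d0 H] : nbhs (1%g : G) P.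
  have := @smoothG_continuous R n G _ (field_smooth fs) 1%g.
  by rewrite /continuous_at field1// => /cvgr0_norm_le; apply.
have N1 : \forall h \near (0 : R), `|k * h| <= d by move/cvgr0_norm_le : kc; apply.
have N2 := cc _ H.
near=> h.
have hd : `|k * h| <= d by near: h.
have hH : forall t, `|t| <= d -> P (phi t (c h)) by near: h.
have hD : `|(f \o c) (0 + h) - (f \o c) 0 - h *: dfe f v| <= e / 2 * `|h| by near: h.
have bd a b : a <= b -> `|a| <= d -> `|b| <= d ->
    `|f (phi b (c h)) - f (phi a (c h))| <= e / 2 / (`|k| + 1) * (b - a).
  move=> ab ad bd.
  apply: (@lipschitz_except _ (fun t => f (phi t (c h)))
    (fun t => lf_field X f (phi t (c h))) [::]) => //; last exact: ltW.
  - move=> s; apply: (@continuous_comp _ _ _ (fun t => phi t (c h)) f); first exact: flow_cont_time.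
    exact: smoothG_continuous.
  - move=> s as_ sb _; split; first exact: flow_derive.
    apply: hH; move: ad bd; rewrite !ler_norml => /andP[? ?] /andP[? ?].
    by apply/andP; split; lra.
have : `|f (phi (k * h) (c h)) - f (c h)| <= e / 2 / (`|k| + 1) * `|k * h|.
  rewrite -{2}(lf_flow0 X (c h)); have [t0|t0] := leP 0 (k * h).
    rewrite (ger0_norm t0); have := bd 0 (k * h) t0; rewrite subr0; apply=> //.
    by rewrite normr0 ltW.
  rewrite distrC (ltr0_norm t0); have := bd (k * h) 0 (ltW t0); rewrite sub0r; apply=> //.
  by rewrite normr0 ltW.
have : e / 2 / (`|k| + 1) * `|k * h| <= e / 2 * `|h|.
  rewrite normrM mulrA ler_wpM2r// -[leRHS]mulr1 -mulrA ler_wpM2l//; first exact: ltW.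
  by rewrite mulrC ler_pdivrMr ?mul1r ?lerDl// ltr_wpDl.
move: hD; rewrite /= !add0r c0 flow1 => h1 h2 h3.
have -> : f (phi (k * h) (c h)) - f 1%g - h *: dfe f v =
  (f (phi (k * h) (c h)) - f (c h)) + (f (c h) - f 1%g - h *: dfe f v).
  by rewrite !addrA subrK.
apply: le_trans (ler_normD _ _) _.
by rewrite [in leRHS](splitr e) mulrDl lerD//; exact: le_trans h2.
Unshelve. all: by end_near. Qed.
End LinearFields.

(** * The exponential map *)

Section Doubling.
Context {R : realType} {n : nat}.
Local Notation V := 'rV[R]_n.

Lemma geometric_cvg (u : nat -> V) (A : R) : 0 <= A ->
  (forall k, `|u k.+1 - u k| <= A / 2 ^+ k) ->
  exists2 l : V, u @ \oo --> l & `|l - u 0%N| <= 2 * A.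
Proof.
move=> A0 H.
have B m k : `|u (k + m)%N - u k| <= 2 * A / 2 ^+ k - 2 * A / 2 ^+ (k + m).
  elim: m => [|m IH]; first by rewrite addn0 !subrr normr0.
  have -> : u (k + m.+1)%N - u k = (u (k + m).+1 - u (k + m)%N) + (u (k + m)%N - u k).
    by rewrite addrA subrK addnS.
  apply: (le_trans (ler_normD _ _)); apply: (le_trans (lerD (H _) IH)).
  rewrite addnS exprS; set w := 2 ^+ (k + m); set z := _ ^+ k.
  have w0 : w != 0 by rewrite expf_neq0// pnatr_eq0.
  have z0 : z != 0 by rewrite expf_neq0// pnatr_eq0.
  by rewrite le_eqVlt; apply/orP; left; apply/eqP; field; rewrite w0 z0.
have B' m k : (k <= m)%N -> `|u m - u k| <= 2 * A / 2 ^+ k.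
  move=> km; have := B (m - k)%N k; rewrite subnKC// => /le_trans; apply.
  by rewrite gerBl mulr_ge0// ?mulr_ge0// invr_ge0 exprn_ge0.
have g0 : (fun k : nat => 2 * A / 2 ^+ k) @ \oo --> 0.
  have := @cvg_geometric R (2 * A) (2^-1) _.
  rewrite gtr0_norm// invf_lt1// ltr1n => /(_ isT).
  by apply: cvg_trans; apply: near_eq_cvg; apply: nearW => k; rewrite /geometric/= exprVn.
have cu : cvg (u @ \oo).
  apply/cauchy_cvgP/cauchy_ballP => e e0.
  have e20 : 0 < e / 2 by rewrite divr_gt0.
  have [N _ HN] : \forall k \near \oo, 2 * A / 2 ^+ k < e / 2.
    by move/cvgr_lt : g0; apply.
  exists ([set x | exists2 k, (N <= k)%N & x = u k],
          [set x | exists2 k, (N <= k)%N & x = u k]).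
    by split; exists N => // k Nk; exists k.
  move=> [x y] /= [[i Ni ->] [j Nj ->]]; rewrite -ball_normE /=.
  have -> : u i - u j = (u i - u N) - (u j - u N) by rewrite opprB addrA subrK.
  apply: (le_lt_trans (ler_normB _ _)); rewrite (splitr e).
  by apply: ltrD; apply: le_lt_trans (B' _ _ _) (HN N _) => /=.
have [l ul] := (cvg_ex _).1 cu; exists l => //.
have nl : (fun k => `|u k - u 0%N|) @ \oo --> `|l - u 0%N|.
  by apply: cvg_norm; apply: cvgB ul _; exact: cvg_cst.
apply: (cvgr_to_le nl); apply: nearW => k.
by have := B' k 0%N isT; rewrite expr0 divr1.
Qed.

Variables (s : V -> V) (C r q : R).
Hypothesis C0 : 0 <= C.
Hypothesis q0 : 0 < q.
Hypothesis qr : 2 * q <= r.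
Hypothesis Cq : 2 * C * q <= 1.
Hypothesis s0 : s 0 = 0.
Hypothesis sE : forall x y rho, rho <= r -> `|x| <= rho -> `|y| <= rho ->
  `|s x - s y - 2 *: (x - y)| <= C * rho * `|x - y|.

Lemma iter_s0 j : iter j s 0 = 0.
Proof. by elim: j => //= j ->. Qed.

(** The map [s], later squaring in a chart, differs from doubling by a factor of order [C * rho] at
    scale [rho]. The scales form a geometric progression ending below [q], so the accumulated
    relative error is of the order of its last term. *)
Lemma iter_est j x y d : `|x| <= d -> `|y| <= d -> 2 ^+ j * d <= q ->
  `|iter j s x - iter j s y - 2 ^+ j *: (x - y)| <=
    2 * C * (2 ^+ j * d) * (2 ^+ j * `|x - y|).
Proof.
elim: j x y => [|j IH] x y xd yd.
  move=> _; rewrite !expr0 /= scale1r subrr normr0 !mul1r !mulr_ge0//.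
  exact: le_trans xd.
rewrite exprS => dq; set p := 2 ^+ j in IH dq *.
have d0 : 0 <= d by exact: le_trans xd.
have p0 : 0 <= p by rewrite exprn_ge0.
have pd0 : 0 <= p * d by rewrite mulr_ge0.
have pq : p * d <= q by rewrite -mulrA in dq; lra.
have c1 : 2 * C * (p * d) <= 1 by apply: le_trans Cq; rewrite ler_wpM2l// mulr_ge0.
have b1 z : `|z| <= d -> `|iter j s z| <= 2 * (p * d).
  move=> zd; have := IH z 0 zd; rewrite normr0 iter_s0 !subr0 => /(_ d0 pq) H.
  rewrite -[iter j s z](subrK (p *: z)); apply: (le_trans (ler_normD _ _)).
  rewrite normrZ (ger0_norm p0).
  have h1 : p * `|z| <= p * d by rewrite ler_wpM2l.
  have h2 : 2 * C * (p * d) * (p * `|z|) <= 1 * (p * `|z|) by rewrite ler_wpM2r// mulr_ge0.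
  lra.
have b2 : `|iter j s x - iter j s y| <= 2 * (p * `|x - y|).
  have H := IH x y xd yd pq.
  rewrite -[X in `|X|](subrK (p *: (x - y))); apply: (le_trans (ler_normD _ _)).
  rewrite normrZ (ger0_norm p0).
  have h2 : 2 * C * (p * d) * (p * `|x - y|) <= 1 * (p * `|x - y|).
    by rewrite ler_wpM2r// mulr_ge0.
  lra.
have rr : 2 * (p * d) <= r by apply: le_trans qr; rewrite ler_pM2l.
have H1 := sE rr (b1 x xd) (b1 y yd).
have H2 := IH x y xd yd pq.
have -> : iter j.+1 s x - iter j.+1 s y - (2 * p) *: (x - y) =
  (s (iter j s x) - s (iter j s y) - 2 *: (iter j s x - iter j s y)) +
  2 *: (iter j s x - iter j s y - p *: (x - y)).
  by rewrite (scalerBr 2 (_ - _)) addrA subrK scalerA.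
apply: (le_trans (ler_normD _ _)); rewrite normrZ (ger0_norm (_ : 0 <= 2))//.
have H3 : C * (2 * (p * d)) * `|iter j s x - iter j s y| <=
    C * (2 * (p * d)) * (2 * (p * `|x - y|)).
  by rewrite ler_wpM2l// mulr_ge0// mulr_ge0.
have -> : 2 * C * (2 * p * d) * (2 * p * `|x - y|) =
   C * (2 * (p * d)) * (2 * (p * `|x - y|)) + 2 * (2 * C * (p * d) * (p * `|x - y|)).
  ring.
lra.
Qed.

Lemma iter_lip k x y : `|x| <= q / 2 ^+ k -> `|y| <= q / 2 ^+ k ->
  `|iter k s x - iter k s y| <= 2 * (2 ^+ k * `|x - y|).
Proof.
move=> xd yd.
have p0 : 0 < (2 : R) ^+ k by rewrite exprn_gt0.
have E : 2 ^+ k * (q / 2 ^+ k) = q by rewrite mulrC divfK// gt_eqF.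
have := iter_est (j := k) xd yd; rewrite E lexx => /(_ isT) H.
rewrite -[X in `|X|](subrK (2 ^+ k *: (x - y))); apply: (le_trans (ler_normD _ _)).
rewrite normrZ (gtr0_norm p0).
have h2 : 2 * C * q * (2 ^+ k * `|x - y|) <= 1 * (2 ^+ k * `|x - y|).
  by rewrite ler_wpM2r// mulr_ge0// ltW.
lra.
Qed.

(** The exponential in coordinates: the 2^k-th power of the point with coordinates v / 2^k, in the
    limit. *)
Definition dexp (v : V) : V := lim ((fun k => iter k s ((2 ^+ k)^-1 *: v)) @ \oo).

Lemma norm_scale2 k (v : V) : `|(2 ^+ k)^-1 *: v| = `|v| / 2 ^+ k.
Proof. by rewrite normrZ ger0_norm ?invr_ge0 ?exprn_ge0// mulrC. Qed.

(** With y = v / 2^(k+1), consecutive terms come from applying k doublings to [s y] and to [2 *: y].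
    Their distance is quadratic in y and is magnified by about 2^k, which leaves a geometric
    series. *)
Lemma dexp_cvg v : `|v| <= q / 2 ->
  (fun k => iter k s ((2 ^+ k)^-1 *: v)) @ \oo --> dexp v.
Proof.
move=> vq; apply/cvg_ex.
have [] := @geometric_cvg (fun k => iter k s ((2 ^+ k)^-1 *: v)) (C * `|v| * `|v|).
- by rewrite !mulr_ge0.
- move=> k; rewrite iterSr; set y := (2 ^+ k.+1)^-1 *: v.
  have p0 : 0 < (2 : R) ^+ k by rewrite exprn_gt0.
  have -> : (2 ^+ k)^-1 *: v = 2 *: y.
    by rewrite /y scalerA exprS invfM mulrA divff// mul1r.
  have ny : `|y| = `|v| / 2 / 2 ^+ k by rewrite norm_scale2 exprS invfM mulrA.
  have yq : `|y| <= q / 4 / 2 ^+ k.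
    rewrite ny ler_pM2r ?invr_gt0//; lra.
  have yr : `|y| <= r.
    apply: (le_trans yq); rewrite ler_pdivrMr//.
    have : 1 <= (2 : R) ^+ k by rewrite exprn_ege1// ler1n.
    have r0 : 0 < r by apply: lt_le_trans qr; rewrite mulr_gt0.
    move=> h; have : r * 1 <= r * 2 ^+ k by rewrite ler_pM2l.
    have := q0; have := qr; lra.
  have H := sE yr (lexx _) (_ : `|0| <= `|y|).
  have {}H : `|s y - 2 *: y| <= C * `|y| * `|y|.
    by have := H; rewrite s0 !subr0 normr0; apply.
  have y2 : `|2 *: y| = 2 * `|y| by rewrite normrZ ger0_norm.
  have Cy : C * `|y| * `|y| <= 1 * `|y|.
    rewrite ler_wpM2r//; apply: le_trans (_ : 2 * C * q <= 1) => //.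
    have : `|y| <= q.
      apply: (le_trans yq); rewrite ler_pdivrMr//.
      have : q * 1 <= q * 2 ^+ k by rewrite ler_pM2l// exprn_ege1// ler1n.
      have := q0; lra.
    move=> yq'; have : C * `|y| <= C * q by rewrite ler_wpM2l.
    have : 0 <= C * q by rewrite mulr_ge0// ltW.
    lra.
  have E4 : q / 2 ^+ k = 4 * (q / 4 / 2 ^+ k).
    by rewrite mulrA; congr (_ * _); field.
  apply: (le_trans (iter_lip (k := k) _ _)).
  + rewrite -[s y](subrK (2 *: y)) E4; apply: (le_trans (ler_normD _ _)).
    rewrite y2; move: yq; set z := q / 4 / 2 ^+ k; have := normr_ge0 y; lra.
  + by rewrite y2 E4; move: yq; set z := q / 4 / 2 ^+ k; have := normr_ge0 y; lra.
  + have HH : 2 * (2 ^+ k * `|s y - 2 *: y|) <= 2 * (2 ^+ k * (C * `|y| * `|y|)).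
      by rewrite ler_pM2l// ler_pM2l.
    apply: (le_trans HH).
    rewrite ny; set z := 2 ^+ k in p0 *; set w := `|v|.
    have -> : 2 * (z * (C * (w / 2 / z) * (w / 2 / z))) = C * w * w / z / 2.
      by field; rewrite gt_eqF.
    have w0 : 0 <= w by exact: normr_ge0.
    have : 0 <= C * w * w / z.
      by apply: divr_ge0; [do 2?apply: mulr_ge0|exact: ltW].
    move: (C * w * w / z) => u; lra.
- by move=> l ul _; exists l.
Qed.

Lemma dexp_strict v w rho : rho <= q / 2 -> `|v| <= rho -> `|w| <= rho ->
  `|dexp v - dexp w - (v - w)| <= 2 * C * rho * `|v - w|.
Proof.
move=> rq vr wr.
have cv := dexp_cvg (le_trans vr rq); have cw := dexp_cvg (le_trans wr rq).
have H : (fun k => `|iter k s ((2 ^+ k)^-1 *: v) - iter k s ((2 ^+ k)^-1 *: w) - (v - w)|) @ \oo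
    --> `|dexp v - dexp w - (v - w)|.
  by apply: cvg_norm; apply: cvgB; [exact: cvgB|exact: cvg_cst].
apply: (cvgr_to_le H); apply: nearW => k.
have p0 : 0 < (2 : R) ^+ k by rewrite exprn_gt0.
have h1 : `|(2 ^+ k)^-1 *: v| <= rho / 2 ^+ k.
  by rewrite norm_scale2 ler_pM2r ?invr_gt0.
have h2 : `|(2 ^+ k)^-1 *: w| <= rho / 2 ^+ k.
  by rewrite norm_scale2 ler_pM2r ?invr_gt0.
have E (u : R) : 2 ^+ k * (u / 2 ^+ k) = u by rewrite mulrC divfK// gt_eqF.
have := iter_est (j := k) h1 h2; rewrite E -scalerBr norm_scale2 E scalerA divff ?gt_eqF//.
by rewrite scale1r; apply; have := q0; lra.
Qed.

Lemma dexp0 : dexp 0 = 0.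
Proof.
rewrite /dexp (_ : (fun k => _) = fun=> 0); first exact: lim_cst.
by apply/funext => k; rewrite scaler0 iter_s0.
Qed.

(** Only the first-order behaviour of the roots matters. This lets any curve with velocity [v]
    replace the straight line in the definition of the exponential. *)
Lemma dexp_limit (x : nat -> V) v : `|v| < q / 2 ->
  (fun k => 2 ^+ k *: x k) @ \oo --> v -> (fun k => iter k s (x k)) @ \oo --> dexp v.
Proof.
move=> vq xv; have cv := dexp_cvg (ltW vq).
have d0 : (fun k => 2 ^+ k *: x k - v) @ \oo --> (0 : V).
  by rewrite -(subrr v); apply: cvgB => //; exact: cvg_cst.
suff : (fun k => iter k s (x k) - iter k s ((2 ^+ k)^-1 *: v)) @ \oo --> (0 : V).
  move=> H; have : (fun k => iter k s (x k) - iter k s ((2 ^+ k)^-1 *: v)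
      + iter k s ((2 ^+ k)^-1 *: v)) @ \oo --> 0 + dexp v by exact: cvgD.
  by rewrite add0r; under eq_fun do rewrite subrK.
apply/cvgr0Pnorm_le => e e0.
have e20 : 0 < e / 2 by rewrite divr_gt0.
have N1 : \forall k \near \oo, `|2 ^+ k *: x k - v| <= e / 2 by move/cvgr0_norm_le : d0; apply.
have N2 : \forall k \near \oo, `|2 ^+ k *: x k| < q / 2 by move/cvgr_norm_lt : xv; apply.
near=> k.
have p0 : 0 < (2 : R) ^+ k by rewrite exprn_gt0.
have h1 : `|2 ^+ k *: x k - v| <= e / 2 by near: k.
have h2 : `|2 ^+ k *: x k| < q / 2 by near: k.
apply: (le_trans (iter_lip _ _)).
- rewrite ler_pdivlMr// mulrC; apply: le_trans (_ : q / 2 <= _); last by have := q0; lra.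
  by rewrite normrZ gtr0_norm// in h2; exact: ltW.
- rewrite norm_scale2 ler_pM2r ?invr_gt0//; have := q0; lra.
- have -> : x k - (2 ^+ k)^-1 *: v = (2 ^+ k)^-1 *: (2 ^+ k *: x k - v).
    by rewrite scalerBr scalerA mulVf ?gt_eqF// scale1r.
  rewrite norm_scale2 (mulrC (2 ^+ k)) divfK ?gt_eqF//; lra.
Unshelve. all: by end_near. Qed.

(** Successive approximation: [dexp] minus the identity is Lipschitz with constant 1/2, so the
    corrections [y - dexp u] at least halve at each step. *)
Lemma dexp_surj y : `|y| <= q / 4 / 2 -> 2 * C * (q / 2) <= 1 / 2 ->
  exists2 v, `|v| <= 2 * `|y| & dexp v = y.
Proof.
move=> yq Cq2.
have half v w : `|v| <= q / 2 -> `|w| <= q / 2 ->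
    `|dexp v - dexp w - (v - w)| <= 1 / 2 * `|v - w|.
  move=> vq wq; apply: (le_trans (dexp_strict (lexx _) vq wq)).
  by rewrite ler_wpM2r.
pose u := fix u (k : nat) : V := if k is k'.+1 then u k' + (y - dexp (u k')) else 0.
have uS k : u k.+1 = u k + (y - dexp (u k)) by [].
have H k : `|u k.+1 - u k| <= `|y| / 2 ^+ k /\ `|u k| <= 2 * `|y| - 2 * `|y| / 2 ^+ k.
  elim: k => [|k [IH1 IH2]].
    rewrite uS /= dexp0 subr0 add0r subr0 normr0 expr0 !divr1; split=> //; lra.
  have p0 : 0 < (2 : R) ^+ k by rewrite exprn_gt0.
  have z0 : 0 <= `|y| / 2 ^+ k by rewrite divr_ge0// ltW.
  have e1 : `|y| / 2 ^+ k.+1 = 1 / 2 * (`|y| / 2 ^+ k).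
    by rewrite exprS; field; rewrite gt_eqF.
  have e2 : 2 * `|y| / 2 ^+ k.+1 = `|y| / 2 ^+ k.
    by rewrite exprS; field; rewrite gt_eqF.
  have e3 : 2 * `|y| / 2 ^+ k = 2 * (`|y| / 2 ^+ k) by rewrite mulrA.
  have b2 : `|u k.+1| <= 2 * `|y| - 2 * `|y| / 2 ^+ k.+1.
    rewrite -[u k.+1](subrK (u k)); apply: (le_trans (ler_normD _ _)).
    rewrite e2; rewrite e3 in IH2; lra.
  split=> //.
  have -> : u k.+2 - u k.+1 = - (dexp (u k.+1) - dexp (u k) - (u k.+1 - u k)).
    rewrite (uS k.+1) (_ : u k.+1 - u k = y - dexp (u k)); last first.
      by rewrite uS addrAC subrr add0r.
    move: (dexp (u k.+1)) (dexp (u k)) => a b.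
    by apply/rowP => i; rewrite !mxE; ring.
  rewrite normrN; apply: (le_trans (half _ _ _ _)).
  - rewrite e2 in b2; have := q0; lra.
  - rewrite e3 in IH2; have := q0; lra.
  - by rewrite e1 ler_pM2l//; lra.
have [l ul lb] := geometric_cvg (normr_ge0 y) (fun k => (H k).1).
rewrite /= subr0 in lb; exists l => //.
have ub k : `|u k| <= q / 2.
  have [_ h] := H k; have : 0 <= 2 * `|y| / 2 ^+ k by rewrite divr_ge0 ?mulr_ge0 ?exprn_ge0.
  have := q0; lra.
have lq : `|l| <= q / 2 by have := q0; lra.
apply/eqP; rewrite -subr_eq0 -normr_le0.
have d0 : (fun k => `|u k.+1 - u k| + 2 * `|u k - l|) @ \oo --> (0 : R).
  have h1 : (fun k => u k.+1) @ \oo --> l by move: ul; rewrite -cvg_shiftS.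
  have h2 : (fun k => `|u k.+1 - u k|) @ \oo --> (0 : R).
    rewrite -(normr0 V) -(subrr l); apply: cvg_norm; exact: cvgB.
  have h3 : (fun k => `|u k - l|) @ \oo --> (0 : R).
    rewrite -(normr0 V) -(subrr l); apply: cvg_norm; apply: cvgB => //; exact: cvg_cst.
  rewrite -(addr0 (0 : R)); apply: cvgD => //.
  by rewrite -(mulr0 (2 : R)); apply: cvgM => //; exact: cvg_cst.
apply: (cvgr_to_ge d0); apply: nearW => k.
have -> : dexp l - y = - (dexp (u k) - dexp l - (u k - l)) - (u k.+1 - u k) - (u k - l).
  rewrite (uS k); move: (dexp l) (dexp (u k)) => a b.
  by apply/rowP => i; rewrite !mxE; ring.
apply: (le_trans (ler_normB _ _)); apply: (le_trans (lerD (ler_normB _ _) (lexx _))).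
rewrite normrN; have := half (u k) l (ub k) lq; have := normr_ge0 (u k - l); lra.
Qed.
End Doubling.

Lemma continuous_for_norm {R : realType} (V W : normedModType R) (f : V -> W) (v : V) :
  (forall e : R, 0 < e -> exists2 d : R, 0 < d &
    forall u, `|u - v| < d -> `|f v - f u| <= e) -> {for v, continuous f}.
Proof.
move=> H; apply/cvgrPdist_le => e e0; apply/nbhs_normP.
by have [d d0 Hd] := H e e0; exists d.
Qed.

Lemma near_eq_continuous {T U : topologicalType} (f g : T -> U) (v : T) :
  (\forall u \near v, f u = g u) -> {for v, continuous f} -> {for v, continuous g}.
Proof.
move=> fg fc; rewrite /prop_for/continuous_at -(nbhs_singleton fg).
by apply: cvg_trans fc; exact: near_eq_cvg.
Qed.

(** * The exponential map near the identity *)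

Section Exponential.
Context {R : realType} {n : nat} {G : lieGroupType R n}.
Local Notation V := 'rV[R]_n.
Local Notation lpt := (@lpt R n G).
Local Notation lcoord := (@lcoord R n G).
Local Notation lcod := (@lcod R n G).
Local Notation ldom := (@ldom R n G).

Definition lmul (z : V * V) : V := lcoord (lpt z.1 * lpt z.2)%g.

Definition lmul_dom : set (V * V) :=
  [set z | (lcod z.1 /\ lcod z.2) /\ ldom (lpt z.1 * lpt z.2)%g].

Lemma open_lmul_dom : open lmul_dom.
Proof.
apply: (open_within_preimage (A := [set z : V * V | lcod z.1 /\ lcod z.2])
  (g := fun z : V * V => (lpt z.1 * lpt z.2)%g)).
- rewrite openE => -[u v] /= [cu cv]; exists (lcod, lcod) => //=.
  by split; apply: open_nbhs_nbhs; split=> //; exact: open_lcod.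
- move=> -[u v] /= [cu cv]; apply: mulg_cvg.
    by apply: (cvg_comp fst lpt cvg_fst); exact: lpt_cont.
  by apply: (cvg_comp snd lpt cvg_snd); exact: lpt_cont.
- exact: open_ldom.
Qed.

Lemma smooth_lmul k i : classC k lmul_dom (fun z => lmul z 0 i).
Proof.
pose ch := id_chart G; pose c := chart_map ch 1%g.
have H := (@lie_smooth_mul R n G).2 ch ch ch (id_chart_atlas G) (id_chart_atlas G)
  (id_chart_atlas G) k.
have H2 : classC k lmul_dom (fun z : V * V => chart_map ch (lpt z.1 * lpt z.2)%g).
  apply: (classC_compA (L := idfun) (c := (c, c)) (f := fun z : V * V => (z.1 + c, z.2 + c))
    open_lmul_dom (@continuous_idfun _ (V * V)%type) _ _ H) => //.
    by move=> [x y]; congr (_, _); rewrite /= addrC.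
  by move=> z [[? ?] ?].
have H3 : classC k lmul_dom lmul.
  by apply: (classCD open_lmul_dom H2); exact: classC_cst.
exact: (classC_coord i open_lmul_dom H3).
Qed.

Lemma lmul_dom0 : lmul_dom (0, 0).
Proof.
by split; [split; exact: lcod0|rewrite /= lpt0 mulg1; exact: ldom1].
Qed.

Lemma inl2_inr2 (v : V * V) : v = inl2 v.1 + inr2 v.2.
Proof. by case: v => a b; congr (_, _); rewrite /= ?addr0 ?add0r. Qed.

Lemma derive_lmul0 i (v : V * V) : 'D_v (fun z => lmul z 0 i) (0, 0) = v.1 0 i + v.2 0 i.
Proof.
have d : differentiable (fun z => lmul z 0 i) (0, 0).
  exact: (smooth_lmul 1 i).1 lmul_dom0.
have N : \forall u \near (0 : V), lcod u.
  by apply: open_nbhs_nbhs; split; [exact: open_lcod|exact: lcod0].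
rewrite [v in LHS]inl2_inr2.
rewrite deriveE// linearD/= -!deriveE// derive_slicel derive_slicer.
congr (_ + _).
  rewrite (@near_eq_derive _ _ _ _ (fun u : V => u 0 i)).
    by have [_ ->] := is_derive_coord0 i (0 : V) v.1.
  by apply: filterS N => u cu; rewrite /lmul /= lpt0 mulg1 lptK.
rewrite (@near_eq_derive _ _ _ _ (fun u : V => u 0 i)).
  by have [_ ->] := is_derive_coord0 i (0 : V) v.2.
by apply: filterS N => u cu; rewrite /lmul /= lpt0 mul1g lptK.
Qed.

(** The derivative at the origin of the group law in coordinates is addition; strict
    differentiability, applied to each coordinate, makes the error small relative to the
    displacement. The family [b] is the standard basis of a product of two copies of the coordinate
    space. *)
Lemma lmul_est_ex : exists C r : R, [/\ 0 < C, 0 < r, r <= lrad G &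
  forall x y x' y' rho, rho <= r -> `|x| <= rho -> `|y| <= rho ->
    `|x'| <= rho -> `|y'| <= rho ->
    ldom (lpt x * lpt y)%g /\
    `|lmul (x, y) - lmul (x', y') - ((x - x') + (y - y'))| <=
      C * rho * (`|x - x'| + `|y - y'|)].
Proof.
pose b (j : 'I_n + 'I_n) : V * V :=
  match j with inl i => inl2 (delta_mx 0 i) | inr i => inr2 (delta_mx 0 i) end.
pose c (v : V * V) (j : 'I_n + 'I_n) : R :=
  match j with inl i => v.1 0 i | inr i => v.2 0 i end.
have vE v : v = \sum_j c v j *: b j.
  have E1 : \sum_(i < n) c v (inl i) *: b (inl i) = inl2 v.1.
    rewrite [in RHS](row_sum_delta v.1) linear_sum; apply: eq_bigr => i _.
    by rewrite linearZ.
  have E2 : \sum_(i < n) c v (inr i) *: b (inr i) = inr2 v.2.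
    rewrite [in RHS](row_sum_delta v.2) linear_sum; apply: eq_bigr => i _.
    by rewrite linearZ.
  rewrite big_sumType E1 E2; exact: inl2_inr2.
have cv v j : `|c v j| <= `|v|.
  rewrite prod_normE; case: j => i /=.
    by apply: (le_trans (norm_coord _ _)); rewrite le_max lexx.
  by apply: (le_trans (norm_coord _ _)); rewrite le_max lexx orbT.
have H i := C2_strict vE cv open_lmul_dom lmul_dom0 (smooth_lmul 2 i).
have {}H i : exists Cr : R * R, [/\ 0 <= Cr.1, 0 < Cr.2 & forall x y rho, rho <= Cr.2 ->
    `|x - (0, 0)| <= rho -> `|y - (0, 0)| <= rho ->
    `|lmul x 0 i - lmul y 0 i - 'D_(x - y) (fun z => lmul z 0 i) (0, 0)| <= Cr.1 * rho * `|x - y|].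
  by have [C [r ?]] := H i; exists (C, r).
have {H}/choice[g gP] := H.
have [r0 r00 r0P] : exists2 r0 : R, 0 < r0 & forall z, `|z - (0, 0)| < r0 -> lmul_dom z.
  apply/nbhs_normP; apply: open_nbhs_nbhs; split; [exact: open_lmul_dom|exact: lmul_dom0].
pose r := Num.min (r0 / 2) (Num.min (lrad G) (\big[Num.min/1]_i (g i).2)).
exists (1 + \sum_i (g i).1), r; split.
- by rewrite ltr_pwDl// sumr_ge0// => i _; have [] := gP i.
- rewrite lt_min divr_gt0//= lt_min lrad_gt0/=.
  by elim/big_ind : _ => // [x y x0 y0|i _]; [rewrite lt_min x0|have [] := gP i].
- by rewrite /r !ge_min lexx !orbT.
move=> x y x' y' rho rr xr yr x'r y'r.
have rho0 : 0 <= rho by exact: le_trans xr.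
have nz (u w : V) : `|u| <= rho -> `|w| <= rho -> `|(u, w) - (0, 0) : V * V| <= rho.
  by move=> ur wr; rewrite prod_normE ge_max /= !subr0 ur wr.
split.
  suff [] : lmul_dom (x, y) by [].
  apply: r0P; apply: (le_lt_trans (nz _ _ xr yr)); apply: (le_lt_trans rr).
  by rewrite gt_min ltr_pdivrMr// ltr_pMr// ltr1n.
apply: norm_rV_le => [|i].
  by rewrite !mulr_ge0 ?addr_ge0// ?sumr_ge0// => i _; have [] := gP i.
have [g0 _ gi] := gP i.
have rg : rho <= (g i).2.
  apply: (le_trans rr); rewrite /r !ge_min; apply/orP; right; apply/orP; right.
  exact: bigmin_le_cond.
have := gi _ _ _ rg (nz _ _ xr yr) (nz _ _ x'r y'r).
rewrite derive_lmul0 => h.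
rewrite [X in `|X|](_ : _ = lmul (x, y) 0 i - lmul (x', y') 0 i -
  (((x, y) - (x', y')).1 0 i + ((x, y) - (x', y')).2 0 i)); last by rewrite !mxE.
apply: (le_trans h); apply: ler_pM => //; first exact: mulr_ge0.
  rewrite ler_wpM2r// -[leLHS]add0r lerD// (bigD1 i)//= lerDl.
  by apply: sumr_ge0 => j _; have [] := gP j.
by rewrite prod_normE ge_max /= lerDl lerDr !normr_ge0.
Qed.

Definition mC : R := projT1 (cid lmul_est_ex).
Definition mr : R := projT1 (cid (projT2 (cid lmul_est_ex))).

Lemma mCr : [/\ 0 < mC, 0 < mr, mr <= lrad G &
  forall x y x' y' rho, rho <= mr -> `|x| <= rho -> `|y| <= rho ->
    `|x'| <= rho -> `|y'| <= rho ->
    ldom (lpt x * lpt y)%g /\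
    `|lmul (x, y) - lmul (x', y') - ((x - x') + (y - y'))| <=
      mC * rho * (`|x - x'| + `|y - y'|)].
Proof. exact: (projT2 (cid (projT2 (cid lmul_est_ex)))). Qed.

Definition lsq (x : V) : V := lmul (x, x).
(** The radius [q] for the doubling estimates. Squaring has the error constant [2 * mC], and the two
    terms of the minimum give [2 * q <= mr] and [4 * mC * q <= 1]. *)
Definition eq_ : R := Num.min (mr / 2) (4 * mC)^-1.

Lemma mC_gt0 : 0 < mC. Proof. by have [] := mCr. Qed.
Lemma mr_gt0 : 0 < mr. Proof. by have [] := mCr. Qed.
Lemma eq_gt0 : 0 < eq_.
Proof. by rewrite lt_min divr_gt0 ?mr_gt0//= invr_gt0 mulr_gt0 ?mC_gt0. Qed.
Lemma eq_mr : 2 * eq_ <= mr.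
Proof. by rewrite mulrC -ler_pdivlMr// ge_min lexx. Qed.
Lemma eq_C : 2 * (2 * mC) * eq_ <= 1.
Proof.
have := mC_gt0; move=> c0; rewrite mulrA -natrM mulrC -ler_pdivlMr ?mulr_gt0// mul1r.
by rewrite ge_min lexx orbT.
Qed.
Lemma lsq0 : lsq 0 = 0.
Proof. by rewrite /lsq /lmul /= lpt0 mulg1 lcoord1. Qed.

Lemma lsq_est (x y : V) rho : rho <= mr -> `|x| <= rho -> `|y| <= rho ->
  `|lsq x - lsq y - 2 *: (x - y)| <= 2 * mC * rho * `|x - y|.
Proof.
move=> rr xr yr; have [_ _ _ H] := mCr; have [_] := H x x y y rho rr xr xr yr yr.
have -> : (x - y) + (x - y) = 2 *: (x - y) by rewrite scaler_nat mulr2n.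
by move=> h; apply: (le_trans h); rewrite le_eqVlt; apply/orP; left; apply/eqP; ring.
Qed.

Definition erad : R := eq_ / 2.
Lemma erad_gt0 : 0 < erad. Proof. by rewrite divr_gt0 ?eq_gt0. Qed.

Definition ex (v : V) : G := lpt (dexp lsq v).

Let mC2 : 0 <= 2 * mC. Proof. by rewrite mulr_ge0// ltW ?mC_gt0. Qed.

Let strict := dexp_strict mC2 eq_gt0 eq_mr eq_C lsq0 lsq_est.

Lemma dexp_norm (v : V) : `|v| <= erad -> `|dexp lsq v| <= 2 * `|v|.
Proof.
move=> vr; have := strict vr (lexx _) (_ : `|0| <= `|v|).
rewrite normr0 dexp0 ?lsq0// !subr0 => /(_ (normr_ge0 _)) h.
rewrite -[dexp lsq v](subrK v); apply: (le_trans (ler_normD _ _)).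
have : 2 * (2 * mC) * `|v| * `|v| <= 1 * `|v|.
  rewrite ler_wpM2r//; apply: le_trans eq_C; rewrite ler_wpM2l//; first exact: mulr_ge0.
  by apply: (le_trans vr); rewrite /erad; have := eq_gt0; lra.
lra.
Qed.

Lemma lcod_small (v : V) : `|v| <= 2 * eq_ -> lcod v.
Proof.
move=> vq; apply: lcod_lrad; apply: (le_trans vq); apply: (le_trans eq_mr).
by have [] := mCr.
Qed.

Lemma lcod_dexp (v : V) : `|v| <= erad -> lcod (dexp lsq v).
Proof.
move=> vr; apply: lcod_small; apply: (le_trans (dexp_norm vr)).
by move: vr; rewrite /erad; have := eq_gt0; lra.
Qed.

Lemma lcoord_ex (v : V) : `|v| <= erad -> lcoord (ex v) = dexp lsq v.
Proof. by move=> vr; rewrite /ex lptK//; exact: lcod_dexp. Qed.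

Lemma ex0 : ex 0 = 1%g.
Proof. by rewrite /ex dexp0 ?lsq0// lpt0. Qed.

Lemma ex_strict (v w : V) rho : rho <= erad -> `|v| <= rho -> `|w| <= rho ->
  `|lcoord (ex v) - lcoord (ex w) - (v - w)| <= 4 * mC * rho * `|v - w|.
Proof.
move=> rr vr wr; rewrite !lcoord_ex; [|exact: le_trans rr|exact: le_trans rr].
by have := strict rr vr wr; rewrite mulrA -natrM.
Qed.

Lemma ex_half (v w : V) : `|v| <= erad -> `|w| <= erad ->
  `|lcoord (ex v) - lcoord (ex w) - (v - w)| <= 1 / 2 * `|v - w|.
Proof.
move=> vr wr; apply: (le_trans (ex_strict (lexx _) vr wr)).
rewrite ler_wpM2r// /erad; have := eq_C; lra.
Qed.

Lemma ex_inj (v w : V) : `|v| <= erad -> `|w| <= erad -> ex v = ex w -> v = w.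
Proof.
move=> vr wr E; have := ex_half vr wr; rewrite E subrr sub0r normrN => h.
apply/eqP; rewrite -subr_eq0 -normr_le0; lra.
Qed.

Lemma ex_nbhs e : 0 < e -> nbhs (1%g : G) (ex @` [set v | `|v| <= e]).
Proof.
move=> e0; apply/nbhs1_coord; exists (Num.min (eq_ / 4 / 2) (e / 2)).
  by rewrite lt_min !divr_gt0// eq_gt0.
move=> y; rewrite le_min => /andP[y1 y2].
have [v vy E] := dexp_surj mC2 eq_gt0 eq_mr eq_C lsq0 lsq_est y1
  (ltac:(have := eq_C; lra)).
split; last by exists v; [rewrite /=; lra|rewrite /ex E].
by apply: lcod_small; have := eq_gt0; have := normr_ge0 y; lra.
Qed.

Lemma ex_cont (v : V) : `|v| < erad -> {for v, continuous ex}.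
Proof.
move=> vr; have H : {for v, continuous (fun u => lcoord (ex u))}.
  apply: continuous_for_norm => e e0.
  exists (Num.min (erad - `|v|) (e / 2)).
    by rewrite lt_min subr_gt0 vr divr_gt0.
  move=> u; rewrite lt_min => /andP[u1 u2].
  have ur : `|u| <= erad by have := ler_normD (u - v) v; rewrite subrK; lra.
  have h := ex_half (ltW vr) ur; rewrite (distrC v u) in h.
  rewrite -[X in `|X|](subrK (v - u)); apply: (le_trans (ler_normD _ _)).
  rewrite (distrC v u); lra.
have E : {for v, continuous (lpt \o (fun u => lcoord (ex u)))}.
  apply: continuous_comp => //; apply: lpt_cont; rewrite lcoord_ex ?ltW//.
  by apply: lcod_dexp; exact: ltW.
have N : \forall u \near v, `|u| <= erad.
  apply/nbhs_normP; exists (erad - `|v|); first by rewrite subr_gt0.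
  by move=> u u1; have := ler_normD (u - v) v; rewrite subrK; lra.
have K u : `|u| <= erad -> lpt (lcoord (ex u)) = ex u.
  by move=> ur; rewrite lcoord_ex.
apply: near_eq_continuous E; apply: filterS N => u ur /=; exact: K.
Qed.

Lemma lpt_iter k (x : V) : `|x| <= eq_ / 2 ^+ k -> forall j, (j <= k)%N ->
  lpt (iter j lsq x) = (lpt x ^+ (2 ^ j))%g.
Proof.
move=> xk; elim=> [|j IH] jk; first by rewrite expn0 expg1.
have jk' : (j <= k)%N by exact: ltnW.
have p0 m : 0 < (2 : R) ^+ m by rewrite exprn_gt0.
have xj : `|x| <= eq_ / 2 ^+ j.
  apply: (le_trans xk); rewrite ler_pM2l ?eq_gt0// lef_pV2 ?posrE//.
  by rewrite ler_eXn2l// ltr1n.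
have zj : `|0 : V| <= eq_ / 2 ^+ j by rewrite normr0 divr_ge0// ltW// eq_gt0.
have := iter_lip mC2 eq_mr eq_C lsq0 lsq_est xj zj.
rewrite iter_s0 ?lsq0// !subr0 => h.
have b : `|iter j lsq x| <= mr.
  apply: (le_trans h); apply: le_trans eq_mr; rewrite ler_pM2l//.
  by rewrite mulrC -ler_pdivlMr.
have [_ _ _ /(_ (iter j lsq x) (iter j lsq x) 0 0 mr (lexx _) b b)] := mCr.
rewrite normr0 => /(_ (ltW mr_gt0) (ltW mr_gt0))[d _].
rewrite iterS {1}/lsq /lmul /= lcoordK// IH//.
by rewrite -expgnDr addnn -mul2n expnS.
Qed.

(** The bridge between velocities and exponentials: a closed subgroup containing the points [g k]
    also contains [ex v]. *)
Lemma ex_limit (g : nat -> G) (v : V) : `|v| < erad -> g @ \oo --> (1%g : G) ->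
  (fun k => 2 ^+ k *: lcoord (g k)) @ \oo --> v ->
  (fun k => g k ^+ (2 ^ k))%g @ \oo --> ex v.
Proof.
move=> vr g1 gv.
have H := dexp_limit mC2 eq_gt0 eq_mr eq_C lsq0 lsq_est vr gv.
have : (fun k => lpt (iter k lsq (lcoord (g k)))) @ \oo --> ex v.
  apply: (cvg_comp _ lpt H); apply: lpt_cont; apply: lcod_dexp; exact: ltW.
apply: cvg_trans; apply: near_eq_cvg.
have N1 : \forall k \near \oo, ldom (g k).
  by apply: g1; apply: open_nbhs_nbhs; split; [exact: open_ldom|exact: ldom1].
have N2 : \forall k \near \oo, `|2 ^+ k *: lcoord (g k)| < erad by move/cvgr_norm_lt : gv; apply.
apply: filterS2 N1 N2 => k dk; rewrite normrZ gtr0_norm ?exprn_gt0// => rk.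
rewrite (@lpt_iter k) ?lcoordK//.
rewrite ler_pdivlMr ?exprn_gt0// mulrC; apply: ltW; apply: (lt_le_trans rk).
by rewrite /erad; have := eq_gt0; lra.
Qed.

Lemma cvg_half : (fun k : nat => (2 ^+ k)^-1 : R) @ \oo --> (0 : R).
Proof.
have := @cvg_geometric R 1 (2^-1) _.
rewrite gtr0_norm// invf_lt1// ltr1n => /(_ isT).
apply: cvg_trans; apply: near_eq_cvg; apply: nearW => k.
by rewrite /geometric/= mul1r exprVn.
Qed.

Lemma vel_seq (c : R -> G) v : vel c v ->
  (fun k : nat => c (2 ^+ k)^-1) @ \oo --> (1%g : G) /\
  (fun k : nat => 2 ^+ k *: lcoord (c (2 ^+ k)^-1)) @ \oo --> v.
Proof.
move=> [c0 cc dc]; split; first exact: (cvg_comp _ _ cvg_half cc).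
apply/cvgrPdist_le => e e0; have /is_derive_leP/(_ e e0) D := dc.
have N : \forall k \near \oo, `|(lcoord \o c) (0 + (2 ^+ k)^-1) - (lcoord \o c) 0 -
    (2 ^+ k)^-1 *: v| <= e * `|(2 ^+ k)^-1 : R| := @cvg_half _ D.
apply: filterS N => k /=.
rewrite !add0r c0 lcoord1 subr0; have p0 : 0 < (2 : R) ^+ k by rewrite exprn_gt0.
rewrite (gtr0_norm (_ : 0 < (2 ^+ k)^-1)) ?invr_gt0// -(ler_pM2l p0) (mulrC e) [in leRHS]mulrA
  divff ?gt_eqF// mul1r.
rewrite -{1}(gtr0_norm p0) -normrZ scalerBr scalerA divff ?gt_eqF// scale1r.
by rewrite distrC.
Qed.

Lemma hausdorffG : hausdorff_space G. Proof. exact: lie_hausdorff. Qed.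

Lemma cvg_uniqG (g : nat -> G) (a b : G) : g @ \oo --> a -> g @ \oo --> b -> a = b.
Proof. exact: (cvg_unique hausdorffG). Qed.

Local Notation hp k := (((2 : R) ^+ k)^-1)%R.

(** No one-parameter law is required, only doubling along dyadic times: then every power in
    [ex_limit] equals [c 1]. This identifies images under homomorphisms, inverses and products of
    exponentials. *)
Lemma ex_curve (c : R -> G) v : vel c v -> `|v| < erad ->
  (forall k : nat, (c (hp k.+1) * c (hp k.+1))%g = c (hp k)) ->
  c 1 = ex v.
Proof.
move=> vc vr H; have [c1 cv] := vel_seq vc.
apply: (cvg_uniqG _ (ex_limit vr c1 cv)).
have E k : (c (hp k) ^+ (2 ^ k))%g = c 1.
  elim: k => [|k IH]; first by rewrite expr0 invr1 expn0 expg1.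
  by rewrite expnS expgnA expg2 H.
under eq_fun do rewrite E; exact: cvg_cst.
Qed.

Lemma ex_lim_lpt (v : V) : `|v| < erad ->
  (fun k => lpt (hp k *: v)%R ^+ (2 ^ k))%g @ \oo --> ex v.
Proof. by move=> vr; have [a b] := vel_seq (vel_line v); exact: ex_limit. Qed.

Lemma ex_sqr (v : V) : `|v| < erad -> (ex (2^-1 *: v)%R * ex (2^-1 *: v)%R)%g = ex v.
Proof.
move=> vr; have vr2 : `|2^-1 *: v| < erad.
  by rewrite normrZ ger0_norm//; have := normr_ge0 v; lra.
have H := ex_lim_lpt vr2.
have H2 : (fun k => lpt (hp k *: (2^-1 *: v))%R ^+ (2 ^ k) * lpt (hp k *: (2^-1 *: v))%R ^+ (2 ^ k))%g
    @ \oo --> (ex (2^-1 *: v)%R * ex (2^-1 *: v)%R)%g by exact: mulg_cvg.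
have H1 : (fun k => lpt (hp k.+1 *: v)%R ^+ (2 ^ k.+1))%g @ \oo --> ex v.
  move=> P /(ex_lim_lpt vr) [N _ HN]; exists N => // k Nk.
  by apply: HN => /=; exact: leqW.
apply: (cvg_uniqG _ H1); move: H2; apply: cvg_trans; apply: near_eq_cvg.
apply: nearW => k /=; rewrite -expgnDr addnn -mul2n -expnS scalerA.
by rewrite exprS invfM mulrC.
Qed.

Lemma vel_ex_line (v : V) : vel (fun t => ex (t *: v)) v.
Proof.
have e0 := erad_gt0.
have N : \forall t \near (0 : R), `|t *: v| < erad.
  have : (fun t : R => t *: v) @ (0 : R) --> (0 : R) *: v by apply: cvgZr_tmp; exact: cvg_id.
  by rewrite scale0r => /cvgr0_norm_lt; apply.
split; first by rewrite scale0r ex0.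
  have E0 : {for (0 : R) *: v, continuous ex} by apply: ex_cont; rewrite scale0r normr0.
  have : (fun t : R => t *: v) @ (0 : R) --> (0 : R) *: v by apply: cvgZr_tmp; exact: cvg_id.
  by move=> H; have := cvg_comp _ ex H E0; rewrite /prop_for /= scale0r ex0.
apply/is_derive_leP => e ep.
pose K := 4 * mC * (`|v| + 1) * (`|v| + 1).
have K0 : 0 < K by rewrite /K !mulr_gt0 ?mC_gt0// ltr_wpDl.
have N2 : \forall t \near (0 : R), `|t| <= e / K by apply: nbhs0_ler; rewrite divr_gt0.
apply: filterS2 N N2 => t tr tK; rewrite /= add0r scale0r.
have := ex_strict (lexx _) (ltW tr : `|t *: v| <= erad) (_ : `|0| <= erad).
move=> _; have := @ex_strict (t *: v) 0 `|t *: v| (ltW tr) (lexx _).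
rewrite normr0 => /(_ (normr_ge0 _)); rewrite !subr0 => h; apply: (le_trans h).
rewrite normrZ; have -> : 4 * mC * (`|t| * `|v|) * (`|t| * `|v|) =
  (4 * mC * `|v| * `|v| * `|t|) * `|t| by ring.
rewrite ler_wpM2r//; apply: le_trans (_ : K * `|t| <= e); last first.
  by rewrite mulrC -ler_pdivlMr.
rewrite ler_wpM2r// /K ler_pM// ?lerDl//.
- by rewrite !mulr_ge0// ltW ?mC_gt0.
- by rewrite ler_wpM2l ?lerDl// mulr_ge0// ltW// mC_gt0.
Qed.
End Exponential.

(** * One-parameter subgroups and the global exponential map *)

Section OneParameter.
Context {R : realType} {n : nat} {G : lieGroupType R n}.
Local Notation V := 'rV[R]_n.
Local Notation ex := (@ex R n G).
Local Notation erad := (@erad R n G).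
Local Notation hp k := (((2 : R) ^+ k)^-1)%R.

Lemma norm_hp k (v : V) : `|v| < erad -> `|hp k *: v| < erad.
Proof.
move=> vr; rewrite normrZ gtr0_norm ?invr_gt0 ?exprn_gt0//.
apply: le_lt_trans vr; rewrite ler_piMl// invf_le1 ?exprn_gt0//.
by rewrite exprn_ege1// ler1n.
Qed.

Lemma ex_hp k (v : V) : `|v| < erad ->
  (ex (hp k.+1 *: v)%R * ex (hp k.+1 *: v)%R)%g = ex (hp k *: v).
Proof.
move=> vr; rewrite -[RHS]ex_sqr; last exact: norm_hp.
by rewrite !scalerA exprS invfM.
Qed.

Lemma ex_morph (F : G -> G) (v : V) : {morph F : x y / (x * y)%g} -> smooth_endo F ->
  `|v| < erad -> `|tmap F v| < erad -> F (ex v) = ex (tmap F v).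
Proof.
move=> hF sF vr wr.
have := ex_curve (vel_tmap sF (@vel_ex_line R n G v)) wr; rewrite /= scale1r; apply.
by move=> k; rewrite -hF ex_hp.
Qed.

Lemma ex_opp (v : V) : `|v| < erad -> ex (- v) = (ex v)^-1%g.
Proof.
move=> vr; have nr : `|- v| < erad by rewrite normrN.
have := ex_curve (vel_inv (vel_ex_line v)) nr; rewrite /= scale1r => -> // k.
by rewrite -invgM ex_hp.
Qed.

Lemma ex_pow2 k (v : V) : `|v| < erad -> (ex (hp k *: v)%R ^+ (2 ^ k))%g = ex v.
Proof.
move=> vr; elim: k => [|k IH]; first by rewrite expr0 invr1 scale1r expn0 expg1.
by rewrite expnS expgnA expg2 ex_hp.
Qed.

Lemma morph_conj (g : G) : {morph (fun x => g * x * g^-1)%g : x y / (x * y)%g}.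
Proof. by move=> x y; rewrite !mulgA mulgVK. Qed.

(* [ex v] commutes with its roots [ex (v / 2 ^ k)], whose directions converge to [v] *)
Lemma Ad_ex (v : V) : `|v| < erad -> Ad (ex v) v = v.
Proof.
move=> vr.
have [a1 a2] := vel_seq (vel_conj (ex v) (vel_ex_line v)).
have [b1 b2] := vel_seq (@vel_ex_line R n G v).
apply: (cvg_unique _ a2) => //.
move: b2; apply: cvg_trans; apply: near_eq_cvg; apply: nearW => k /=.
congr (_ *: lcoord _); have := ex_pow2 k vr.
set x := ex (hp k *: v) => <-; apply: (mulIg (x ^+ (2 ^ k))%g).
by rewrite mulgVK -expgSr -expgS.
Qed.

Lemma Ad_0 (g : G) : Ad g 0 = 0.
Proof. by have := Ad_lin g (-1) 0 0; rewrite scaleN1r oppr0 addr0 scaleN1r addNr. Qed.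

Lemma Ad_linear (g : G) a (v : V) : Ad g (a *: v) = a *: Ad g v.
Proof. by have := Ad_lin g a v 0; rewrite Ad_0 !addr0. Qed.

Lemma ex_commute (v : V) a b : `|a *: v| < erad -> `|b *: v| < erad ->
  commute (ex (a *: v)) (ex (b *: v)).
Proof.
move=> ar br; have [->|a0] := eqVneq a 0.
  by rewrite scale0r ex0; exact/commute_sym/commute1.
have E : Ad (ex (a *: v)) (b *: v) = b *: v.
  have := Ad_ex ar; rewrite Ad_linear => /(congr1 (fun u => (b / a) *: u)).
  by rewrite !scalerA mulfVK// -Ad_linear.
have := ex_morph (@morph_conj (ex (a *: v))) (smooth_endo_conj _) br.
rewrite -/(Ad (ex (a *: v)) (b *: v)) E => /(_ br) H.
by rewrite /commute -{2}H mulgVK.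
Qed.

Lemma ex_add (v : V) a b : `|a *: v| < erad -> `|b *: v| < erad ->
  `|(a + b) *: v| < erad -> ex ((a + b) *: v) = (ex (a *: v)%R * ex (b *: v)%R)%g.
Proof.
move=> ar br abr.
have H := vel_mul (@vel_ex_line R n G (a *: v)) (@vel_ex_line R n G (b *: v)).
rewrite -scalerDl in H.
have := ex_curve H abr; rewrite !scale1r => -> // k.
have com : commute (ex (hp k.+1 *: (a *: v))) (ex (hp k.+1 *: (b *: v))).
  by rewrite !scalerA; apply: ex_commute; rewrite -scalerA; exact: norm_hp.
rewrite -(ex_hp k ar) -(ex_hp k br).
move: (ex (hp k.+1 *: (a *: v))) (ex (hp k.+1 *: (b *: v))) com => x y com.
by rewrite -!mulgA (mulgA y) -com !mulgA.
Qed.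

Lemma scale_ex (v : V) : exists k, `|hp k *: v| < erad.
Proof.
have : (fun k : nat => hp k *: v) @ \oo --> (0 : R) *: v.
  by apply: cvgZr_tmp; exact: cvg_half.
rewrite scale0r => /cvgr0_norm_lt /(_ _ (@erad_gt0 R n G)) [k _ H].
by exists k; apply: H => /=.
Qed.

(** Extends [ex] from a ball to all vectors by raising a small root to the power 2^k; by [gexpE]
    every admissible [k] gives the same point. *)
Definition gexp (v : V) : G :=
  let k := projT1 (cid (scale_ex v)) in (ex (hp k *: v)%R ^+ (2 ^ k))%g.

Lemma gexpE (v : V) k : `|hp k *: v| < erad -> gexp v = (ex (hp k *: v)%R ^+ (2 ^ k))%g.
Proof.
rewrite /gexp; case: cid => /= m.
wlog km : k m / (k <= m)%N.
  move=> H mr kr; have [km|/ltnW mk] := leqP k m; first exact: H.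
  by apply/esym; apply: (H m k).
move=> mr kr; rewrite -(subnK km) expnD expgnA; congr (_ ^+ _)%g.
rewrite -[RHS](ex_pow2 (m - k)) // scalerA.
by rewrite exprD invfM.
Qed.

Lemma gexp_ex (v : V) : `|v| < erad -> gexp v = ex v.
Proof. by move=> vr; rewrite (@gexpE v 0%N) ?expr0 ?invr1 ?scale1r// expn0 expg1. Qed.

Lemma scale_ex2 (v w : V) : exists k, `|hp k *: v| < erad /\ `|hp k *: w| < erad.
Proof.
have [k kv] := scale_ex v; have [m mw] := scale_ex w.
exists (k + m)%N; split.
  by rewrite addnC exprD invfM -scalerA; exact: norm_hp.
by rewrite exprD invfM -scalerA; exact: norm_hp.
Qed.

Lemma gexpD (v : V) a b : gexp ((a + b) *: v) = (gexp (a *: v)%R * gexp (b *: v)%R)%g.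
Proof.
have [k [ka kb]] := scale_ex2 (a *: v) (b *: v).
have [m [ma mb]] := scale_ex2 ((a + b) *: v) ((a + b) *: v).
have h1 : `|hp (k + m) *: (a *: v)| < erad by rewrite addnC exprD invfM -scalerA; exact: norm_hp.
have h2 : `|hp (k + m) *: (b *: v)| < erad by rewrite addnC exprD invfM -scalerA; exact: norm_hp.
have h3 : `|hp (k + m) *: ((a + b) *: v)| < erad by rewrite exprD invfM -scalerA; exact: norm_hp.
rewrite (gexpE h1) (gexpE h2) (gexpE h3) !scalerA mulrDr.
rewrite scalerA in h1; rewrite scalerA in h2; rewrite scalerA mulrDr in h3.
by rewrite ex_add// expgMn//; exact: ex_commute.
Qed.

Lemma gexp0 : gexp 0 = 1%g.
Proof. by rewrite gexp_ex ?ex0// normr0; exact: erad_gt0. Qed.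

Lemma gexpN (v : V) : gexp (- v) = (gexp v)^-1%g.
Proof.
apply: (mulIg (gexp v)); rewrite mulVg.
by rewrite -{2}[v]scale1r -scaleN1r -gexpD addNr scale0r gexp0.
Qed.

Lemma vel_gexp (v : V) : vel (fun t => gexp (t *: v)) v.
Proof.
apply: vel_near (vel_ex_line v).
have : (fun t : R => t *: v) @ (0 : R) --> (0 : R) *: v by apply: cvgZr_tmp; exact: cvg_id.
rewrite scale0r => /cvgr0_norm_lt /(_ _ (@erad_gt0 R n G)).
by apply: filterS => t tr; rewrite gexp_ex.
Qed.

Lemma gexp_morph (F : G -> G) (v : V) : {morph F : x y / (x * y)%g} -> smooth_endo F ->
  F (gexp v) = gexp (tmap F v).
Proof.
move=> hF sF; have [k [kv kw]] := scale_ex2 v (tmap F v).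
have E : hp k *: tmap F v = tmap F (hp k *: v).
  have := tmap_lin (hp k) v 0 sF.
  have -> : tmap F 0 = 0.
    by have := tmap_lin (-1) 0 0 sF; rewrite scaleN1r oppr0 addr0 scaleN1r addNr.
  by rewrite !addr0.
rewrite (gexpE kv) (gexpE kw) E -ex_morph// -?E//.
elim: (2 ^ k)%N => [|j IH]; first by rewrite !expg0; exact: sF.1.
by rewrite !expgS hF IH.
Qed.

Lemma gexp_cont (v : V) : continuous (fun t : R => gexp (t *: v)).
Proof.
move=> t.
have E : (fun s => gexp (s *: v)) = (fun s => gexp (t *: v) * gexp ((s - t) *: v)%R)%g.
  by apply/funext => s; rewrite -gexpD addrC subrK.
have H0 : (fun s : R => gexp ((s - t) *: v)) @ t --> (1%g : G).
  have [_ c0 _] := vel_gexp v.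
  have : (fun s : R => s - t) @ t --> t - t by apply: cvgB; [exact: cvg_id|exact: cvg_cst].
  by rewrite subrr => H; exact: (cvg_comp _ _ H c0).
have H : (fun s : R => gexp (t *: v) * gexp ((s - t) *: v)%R)%g @ t --> (gexp (t *: v) * 1)%g.
  by apply: mulg_cvg => //; exact: cvg_cst.
by rewrite mulg1 -E in H.
Qed.

Lemma gexp_curve (v : V) : integral_curve (rinv v) (fun t => gexp (t *: v) : G).
Proof.
split; first exact: gexp_cont.
move=> t; have H : vel (fun s => gexp ((t + s) *: v)%R * (gexp (t *: v)%R)^-1)%g v.
  by apply: vel_ext (vel_gexp v) => s; rewrite addrC gexpD mulgK.
move=> f fs; rewrite rinvE//; exact: (vel_velocity H fs).
Qed.

Lemma integral_curve_gexp (v : V) (c : R -> G) :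
  integral_curve (rinv v) c -> c 0 = 1%g -> forall t, c t = gexp (t *: v).
Proof.
move=> [cc cv] c0 t.
have vc s : vel (fun h => c (s + h) * (c s)^-1)%g v.
  have [w [vw E]] := velocity_vel (cv s).
  suff -> : v = w by [].
  apply: dfe_inj => f fs.
  have fs' := smoothG_mulr (c s)^-1%g fs.
  have := E _ fs'; rewrite rinvE//.
  have -> : (fun x => f (x * c s / c s)%g) = f by apply/funext => x; rewrite mulgK.
  by [].
(* The quotient of the two curves. Its velocity is a conjugate of [- v + v], hence zero. *)
pose z s := (gexp (- s *: v)%R * c s)%g.
have zc : continuous z.
  move=> s; apply: mulg_cvg; last exact: cc.
  have H := @gexp_cont (- v) s.
  rewrite /continuous_at scalerN -scaleNr in H.
  by apply: cvg_trans H; apply: near_eq_cvg; apply: nearW => u; rewrite scalerN scaleNr.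
have : z t = z 0.
  apply: (curve_const zc) => s.
  have := vel_conj (gexp (- s *: v)) (vel_mul (vel_gexp (- v)) (vc s)).
  rewrite addNr Ad_0; apply: vel_ext => h; rewrite /z.
  by rewrite invgM opprD gexpD scalerN -scaleNr !mulgA.
rewrite /z oppr0 scale0r gexp0 c0 mulg1 scaleNr gexpN => /(congr1 (fun x => gexp (t *: v)%R * x)%g).
by rewrite mulVKg mulg1.
Qed.
End OneParameter.

(** * Control systems *)

Section FlowSeries.
Context {R : realType} {n : nat} {G : lieGroupType R n}.
Local Notation V := 'rV[R]_n.
Variable X : linear_field G.
Local Notation phi := (lf_flow X).
Local Notation D := (lf_der X).

Lemma lf_der_right_invariant (Y : operator G) : right_invariant Y -> right_invariant (D Y).
Proof. by have [[H _] _] := lf_derivation X; exact: H. Qed.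

(** By [lf_differential] the function of [s] is a power series with coefficients
    [iter k D Y f 1 / k!]. Its formal derivative is the series of [D Y], so differentiation term by
    term gives the claim. *)
Lemma flow_operator_derive (Y : operator G) (f : G -> R) (t : R) :
  right_invariant Y -> smoothG f ->
  is_derive t (1 : R) (fun s => Y (fun x => f (phi s x)) 1%g) (D Y (fun x => f (phi t x)) 1%g).
Proof.
move=> rY fs.
pose c (Z : operator G) (k : nat) : R := iter k D Z f 1%g / k`!%:R.
have cE Z s : right_invariant Z ->
    pseries (c Z) s @ \oo --> (Z (fun x => f (phi s x)) 1%g : R).
  move=> rZ; have := @lf_differential _ _ _ X s Z f rZ fs.
  rewrite (_ : (fun k => _) = (fun k => c Z k * s ^+ k))//.
  by apply/funext => k; rewrite /c /exp_coeff /= mulrC -!mulrA; congr (_ * _); rewrite mulrC.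
have cl Z s : right_invariant Z -> limn (pseries (c Z) s) = Z (fun x => f (phi s x)) 1%g.
  by move=> rZ; apply/cvg_lim => //; exact: cE.
have dE Z : pseries_diffs (c Z) = c (D Z).
  apply/funext => k; rewrite /pseries_diffs /c iterSr factS natrM.
  have k0 : k.+1%:R != 0 :> R by rewrite pnatr_eq0.
  by rewrite invfM [X in _ * X]mulrCA mulVKf.
have rD := lf_der_right_invariant rY; have rDD := lf_der_right_invariant rD.
have cv Z s : right_invariant Z -> cvgn (pseries (c Z) s).
  by move=> rZ; apply/cvg_ex; eexists; exact: cE.
(* Term-by-term differentiation asks for convergence of the series and of its first two formal
   derivatives at a point beyond |t|. *)
have := @pseries_snd_diffs R (c Y) (`|t| + 1) t.
rewrite !dE => /(_ (cv _ _ rY) (cv _ _ rD) (cv _ _ rDD)).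
rewrite (@ger0_norm _ (`|t| + 1)) ?addr_ge0// ltrDl ltr01 => /(_ isT).
rewrite cl//; rewrite (_ : (fun s => limn _) = fun s => Y (fun x => f (phi s x)) 1%g)//.
by apply/funext => s; rewrite cl.
Qed.

Lemma fieldE (f : G -> R) (g : G) : smoothG f ->
  lf_field X f g = dfe (fun x => f (x * g)%g) (kappa X g).
Proof.
move=> fs; have H := flow_derive X g 0 fs; rewrite lf_flow0 in H.
have := vel_derive (kappaP X g) (smoothG_mulr g fs).
rewrite (_ : _ \o _ = fun s => f (phi s g)); last by apply/funext => s /=; rewrite mulgVK.
by case=> _ <-; case: H => _ ->.
Qed.

(** The curve [phi (- t) (a t^-1 * b t)] is constant: the common control term cancels, and by the
    cocycle identity of [kappa] what is left is the velocity that the backward flow removes. With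
    equal initial values this is uniqueness; in general it says that a change of initial value is
    carried along by the flow. *)
Lemma solution_uniq (a b : R -> G) (w : R -> V) (s : seq R) (T : R) : 0 <= T ->
  continuous a -> continuous b ->
  (forall t, 0 < t -> t < T -> t \notin s ->
    vel (fun h => a (t + h) * (a t)^-1)%g (kappa X (a t) + w t) /\
    vel (fun h => b (t + h) * (b t)^-1)%g (kappa X (b t) + w t)) ->
  b T = (a T * phi T ((a 0)^-1 * b 0))%g.
Proof.
move=> T0 ca cb H.
pose z t := phi (- t) ((a t)^-1 * b t)%g.
have cz : continuous z.
  move=> t; apply: (flow_cvg (a := fun t => - t)).
    by apply: cvgN; exact: cvg_id.
  by apply: mulg_cvg; [apply: invg_cvg; exact: ca|exact: cb].
have E : z T = z 0.
  apply: (@curve_const_except _ _ _ z s 0 T T0 cz) => t t0 tT ts.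
  have [va vb] := H t t0 tT ts.
  set z0 := ((a t)^-1 * b t)%g.
  have k0 : kappa X z0 = Ad (a t)^-1%g (kappa X (b t) - kappa X (a t)).
    have := kappaM X (a t) z0; rewrite /z0 mulVKg => ->.
    by rewrite addrAC subrr add0r AdK.
  have vC := vel_conj (a t)^-1%g (vel_mul (vel_inv va) vb).
  have vE : - (kappa X (a t) + w t) + (kappa X (b t) + w t) = kappa X (b t) - kappa X (a t).
    by rewrite opprD addrACA addNr addr0 addrC.
  rewrite vE -k0 in vC.
  have v1 := vel_mul (vel_flow_apply X (-1) vC) (vel_scale (-1) (kappaP X z0)).
  rewrite scaleN1r subrr in v1.
  have v2 := vel_tmap (smooth_endo_flow X (- t)) v1.
  have E0 : tmap (phi (- t)) 0 = 0 :> V := dflow_0 X (- t).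
  rewrite E0 in v2; apply: vel_ext v2 => h; rewrite /z /= mulN1r.
  rewrite opprD lf_flowD -flowV -flowM; congr (phi _ _).
  rewrite mulgA -flowM; congr (_ * _)%g; congr (phi _ _).
  by rewrite /z0 invgK !invgM !invgK !mulgA mulVg mul1g mulgK mulgVK.
move: E; rewrite /z oppr0 lf_flow0 => /(congr1 (phi T)); rewrite flowVK => <-.
by rewrite mulVKg.
Qed.
End FlowSeries.

Section ControlSystems.
Context {R : realType} {n m : nat} {G : lieGroupType R n}.
Local Notation V := 'rV[R]_n.
Variable S : linear_control_system m G.
Local Notation X := (drift S).
Local Notation phi := (lf_flow (drift S)).
Local Notation Om := (control_range S).

Lemma switching_cst (T : Type) (c : T) : switching_times (fun _ : R => c) = set0.
Proof.
apply/seteqP; split=> // t; apply; near=> s => //.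
Unshelve. all: by end_near. Qed.

Lemma controls_cst c : Om c -> controls S (fun=> c).
Proof.
move=> Oc; split=> // a b; rewrite switching_cst set0I; exact: finite_set0.
Qed.

Lemma control_small : exists2 r : R, 0 < r & forall u, `|u| < r -> Om u.
Proof.
have := control_range_interior S; rewrite /interior => /nbhs_normP[r r0 H].
by exists r => // u ur; apply: H; rewrite subr0.
Qed.

Lemma controls0 : controls S (fun=> 0).
Proof. by apply: controls_cst; have [r r0] := control_small; apply; rewrite normr0. Qed.

(** The trajectory from 1 with the constant control [(r / 2) *: delta_mx 0 i] has a velocity vector
    at time 0. The drift vanishes at 1, so this vector is r/2 times the control field there. *)
Lemma control_vector_ex i : exists v : V, control_field S i = rinv v.
Proof.
have [r r0 H] := control_small.
pose u : 'rV[R]_m := (r / 2) *: delta_mx 0 i.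
have Ou : Om u.
  apply: H; apply: (@le_lt_trans _ _ (r / 2)); last by rewrite ltr_pdivrMr// ltr_pMr// ltr1n.
  apply: norm_rV_le => [|j]; first by rewrite divr_ge0// ltW.
  have r2 : 0 <= r / 2 by rewrite divr_ge0// ltW.
  by rewrite /u !mxE eqxx /=; case: (j == i); rewrite ?mulr1 ?mulr0 ?normr0 ?ger0_norm.
have [cc c0 cv] := trajectoryP (1%g : G) (controls_cst Ou).
have n0 : ~ switching_times (fun _ : R => u) 0 by rewrite switching_cst.
have [v [_ vE]] := velocity_vel (cv 0 n0).
have r20 : r / 2 != 0 by rewrite gt_eqF// divr_gt0.
exists ((r / 2)^-1 *: v); apply: right_invariant_eq.
- exact: control_field_right_invariant.
- exact: right_invariant_rinv.
- move=> f fs; rewrite rinv1// dfeZ//.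
  have := vE f fs; rewrite c0 field1// add0r.
  under [in RHS]eq_fun do rewrite mulg1.
  move=> <-; rewrite (bigD1 i)//= big1 ?addr0; last first.
    by move=> j ji; rewrite !mxE eqxx (negbTE ji) mulr0 mul0r.
  by rewrite !mxE !eqxx mulr1 mulrA mulVf// mul1r.
Qed.

Definition control_vector i : V := projT1 (cid (control_vector_ex i)).

Lemma control_vectorP i : control_field S i = rinv (control_vector i).
Proof. by rewrite /control_vector; case: cid. Qed.

Definition cvec (u : 'rV[R]_m) : V := \sum_i u 0 i *: control_vector i.

Lemma cvecE (f : G -> R) g (u : 'rV[R]_m) : smoothG f ->
  \sum_(i < m) u 0 i * control_field S i f g = dfe (fun x => f (x * g)%g) (cvec u).
Proof.
move=> fs; have fs' := smoothG_mulr g fs.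
rewrite dfe_sum//; apply: eq_bigr => i _.
by rewrite dfeZ// control_vectorP rinvE.
Qed.

Lemma trajectory_vel x u t : controls S u -> ~ switching_times u t ->
  vel (fun h => trajectory S (t + h) x u * (trajectory S t x u)^-1)%g
      (kappa X (trajectory S t x u) + cvec (u t)).
Proof.
move=> cu nu; have [cc c0 cv] := trajectoryP x cu.
have [v [vv vE]] := velocity_vel (cv t nu).
suff -> : kappa X (trajectory S t x u) + cvec (u t) = v by [].
apply: dfe_inj => f fs; set g := trajectory S t x u in vE *.
have fs' := smoothG_mulr g^-1%g fs; have := vE _ fs'.
rewrite fieldE// cvecE// dfeD//.
by rewrite (_ : (fun x0 => f (x0 * g / g)%g) = f)//; apply/funext => y; rewrite mulgK.
Qed.

Lemma trajectory_cont x u : controls S u -> continuous (fun t => trajectory S t x u).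
Proof. by move=> cu; have [] := trajectoryP x cu. Qed.

Lemma trajectory0 x u : controls S u -> trajectory S 0 x u = x.
Proof. by move=> cu; have [] := trajectoryP x cu. Qed.

(** The controls are compared only inside the open interval, since finitely many values do not
    affect a trajectory. After time [s] a trajectory is one from the identity multiplied by the flow
    of the point reached. *)
Lemma trajectory_shift x u v s T : 0 <= T -> controls S u -> controls S v ->
  (forall t, 0 < t -> t < T -> v t = u (s + t)) ->
  trajectory S (s + T) x u = (trajectory S T 1%g v * phi T (trajectory S s x u))%g.
Proof.
move=> T0 cu cv uv.
have /finite_seqP[e1 E1] := cv.1 0 T.
have fin : finite_set (switching_times u `&` `[s, s + T]) by exact: cu.1.
have /finite_seqP[e2 E2] := fin.
have H := @solution_uniq _ _ _ X (fun t => trajectory S t 1%g v)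
  (fun t => trajectory S (s + t) x u) (fun t => cvec (v t))
  (e1 ++ map (fun t => t - s) e2) T T0.
rewrite addr0 (trajectory0 1%g cv) invg1 mul1g in H; apply: H.
- exact: trajectory_cont.
- move=> t; apply: (@continuous_comp _ _ _ (fun t => s + t) (fun t => trajectory S t x u)).
    by apply: continuousD; [exact: cst_continuous|exact: cvg_id].
  exact: trajectory_cont.
- move=> t t0 tT; rewrite mem_cat negb_or => /andP[n1 n2]; split.
    apply: trajectory_vel => // sw.
    have : (switching_times v `&` `[0, T]) t by split=> //; rewrite /= in_itv/= !ltW.
    by rewrite E1 /= (negbTE n1).
  have nu : ~ switching_times u (s + t).
    move=> sw; have : (switching_times u `&` `[s, s + T]) (s + t).
      by split=> //=; rewrite in_itv/= lerDl lerD2l !ltW.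
    rewrite E2 /= => ine; move: n2; rewrite -[t in t \in _](addKr s) addrC => /negP; apply.
    by apply/mapP; exists (s + t).
  have := trajectory_vel x cu nu; rewrite uv//.
  by apply: vel_ext => h; rewrite addrA.
Qed.

Lemma trajectory_causal u v T : 0 <= T -> controls S u -> controls S v ->
  (forall t, 0 < t -> t < T -> v t = u t) -> trajectory S T 1%g u = trajectory S T 1%g v.
Proof.
move=> T0 cu cv uv.
have := @trajectory_shift 1%g u v 0 T T0 cu cv; rewrite add0r trajectory0// flow1 mulg1.
by apply=> t t0 tT; rewrite add0r; exact: uv.
Qed.
End ControlSystems.

(** * Subgroups invariant under the system *)

Section Subspaces.
Context {F : fieldType} {n : nat}.

(** Take a matrix of maximal rank among those whose rows satisfy [P]: adjoining one more vector of
    [P] cannot raise the rank. *)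
Lemma subspace_mx (P : 'rV[F]_n -> Prop) : P 0 ->
  (forall a v w, P v -> P w -> P (a *: v + w)) ->
  exists M : 'M[F]_n, forall v, P v <-> (v <= M)%MS.
Proof.
move=> P0 PD.
pose Q k := `[< exists M : 'M[F]_n, (forall i, P (row i M)) /\ \rank M = k >].
have Q0 : exists k, Q k.
  exists 0%N; apply/asboolP; exists 0; split; last by rewrite mxrank0.
  by move=> i; rewrite row0.
have Qn k : Q k -> (k <= n)%N by move=> /asboolP[M [_ <-]]; exact: rank_leq_row.
have Psum (p : nat) (A : 'M[F]_(p, n)) (v : 'rV[F]_n) :
    (forall i, P (row i A)) -> (v <= A)%MS -> P v.
  move=> PA /submxP[D ->]; rewrite mulmx_sum_row.
  elim/big_rec : _ => // i x _ Px; exact: PD.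
case: (ex_maxnP Q0 Qn) => k /asboolP[M [MP Mk]] kmax.
exists M => v; split => [Pv|]; last exact: Psum.
have PA : forall i, P (row i (<<col_mx M v>>)%MS).
  move=> i; apply: (@Psum _ (col_mx M v)); last first.
    by rewrite (submx_trans (row_sub _ _))// genmxE.
  move=> j; case: (split_ordP j) => j' ->; rewrite ?rowKu ?rowKd//.
  by rewrite (_ : row j' v = v)//; apply/rowP => l; rewrite mxE ord1.
have sM : (M <= <<col_mx M v>>)%MS by rewrite genmxE -addsmxE addsmxSl.
have : (\rank (<<col_mx M v>>)%MS <= \rank M)%N.
  by rewrite Mk; apply: kmax; apply/asboolP; exists (<<col_mx M v>>)%MS.
rewrite (geq_leqif (mxrank_leqif_sup sM)) genmxE => H.
by apply: submx_trans H; rewrite -addsmxE addsmxSr.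
Qed.

Lemma subspace_functional (P : 'rV[F]_n -> Prop) (v : 'rV[F]_n) : P 0 ->
  (forall a v w, P v -> P w -> P (a *: v + w)) -> ~ P v ->
  exists a : 'I_n -> F, (forall w, P w -> \sum_i w 0 i * a i = 0) /\
    \sum_i v 0 i * a i != 0.
Proof.
move=> P0 PD nP; have [M ME] := subspace_mx P0 PD.
have : v *m cokermx M != 0 by rewrite -submxE; apply/negP => /ME.
case/rV0Pn => j vj; exists (fun i => cokermx M i j); split.
  by move=> w /ME; rewrite submxE => /eqP/rowP/(_ j); rewrite !mxE.
by move: vj; rewrite mxE.
Qed.

End Subspaces.

(** * Continuity of [Ad] and [kappa], and mixed derivatives *)

Section Frames.
Context {R : realType} {n : nat} {G : lieGroupType R n}.
Local Notation V := 'rV[R]_n.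
Local Notation lpt := (@lpt R n G).
Local Notation lcod := (@lcod R n G).

(** The coordinates of [u x] solve a linear system whose matrix is continuous and is the identity at
    [x0]. The matrix is not inverted: its deviation from the identity is absorbed into the left-hand
    side. *)
Lemma frame_continuous (u : G -> V) (x0 : G) :
  (forall f : G -> R, smoothG f -> continuous (fun x => dfe (fun y => f (y * x)%g) (u x))) ->
  {for x0, continuous u}.
Proof.
move=> H.
pose f i : G -> R := fun y => xc i (y * x0^-1)%g.
have fs i : smoothG (f i) by exact: (smoothG_mulr x0^-1%g (xc_smooth i)).
have f1 i : (fun y => f i (y * x0)%g) = xc i.
  by apply/funext => y; rewrite /f mulgK.
pose M i j (x : G) : R := rinv (delta_mx 0 j) (f i) x.
pose b i (x : G) : R := dfe (fun y => f i (y * x)%g) (u x).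
have bE i x : b i x = \sum_j u x 0 j * M i j x.
  rewrite /b dfe_coord; last exact: smoothG_mulr.
  by apply: eq_bigr => j _; rewrite /M rinvE.
have M0 i j : M i j x0 = (i == j)%:R.
  by rewrite /M rinvE// f1 dfe_xc mxE eqxx.
have b0 i : b i x0 = u x0 0 i by rewrite /b f1 dfe_xc.
apply/cvgrPdist_le => e e0.
pose A : R := n%:R * `|u x0| + 1.
have A0 : 0 < A by rewrite ltr_wpDl// mulr_ge0.
(* The first bound absorbs [n * eta * d] into [d / 2], the second leaves [e / 2] for the rest. *)
pose eta : R := Num.min (2 * n.+1%:R)^-1 (e / (2 * A)).
have eta0 : 0 < eta by rewrite lt_min invr_gt0 mulr_gt0//= divr_gt0// mulr_gt0.
have nM : \forall x \near x0, forall i j, `|M i j x0 - M i j x| <= eta.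
  apply: filter_forall => i; apply: filter_forall => j.
  have := @smoothG_continuous _ _ _ _ (smooth_rinv (delta_mx 0 j) (fs i)) x0.
  by move/cvgrPdist_le => /(_ _ eta0).
have nb : \forall x \near x0, forall i, `|b i x0 - b i x| <= eta.
  apply: filter_forall => i; have := H _ (fs i) x0.
  by move/cvgrPdist_le => /(_ _ eta0).
near=> x.
have Mx : forall i j, `|M i j x0 - M i j x| <= eta by near: x.
have bx : forall i, `|b i x0 - b i x| <= eta by near: x.
set d := `|u x0 - u x|.
have dle : d <= eta * (n%:R * `|u x| + 1).
  apply: norm_rV_le => [|i]; first by rewrite mulr_ge0// ?ltW// ltr_wpDl// mulr_ge0.
  have -> : (u x0 - u x) 0 i = (b i x0 - b i x) - \sum_j u x 0 j * (M i j x0 - M i j x).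
    under eq_bigr do rewrite mulrBr; rewrite sumrB -bE.
    rewrite (_ : \sum_j u x 0 j * M i j x0 = u x 0 i); last first.
      rewrite (bigD1 i)//= M0 eqxx mulr1 big1 ?addr0// => j ji.
      by rewrite M0 eq_sym (negbTE ji) mulr0.
    by rewrite b0 !mxE opprB addrA subrK.
  apply: le_trans (ler_normB _ _) _.
  rewrite mulrDr mulr1 addrC lerD//.
  apply: le_trans (ler_norm_sum _ _ _) _.
  apply: (@le_trans _ _ (\sum_(j < n) eta * `|u x|)).
    apply: ler_sum => j _; rewrite normrM mulrC ler_pM// norm_coord //.
  by rewrite sumr_const card_ord -[_ *+ n]mulr_natl mulrCA.
have ux : `|u x| <= `|u x0| + d.
  by rewrite /d -{1}(subKr (u x0) (u x)) (le_trans (ler_normB _ _)).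
have d0 : 0 <= d by exact: normr_ge0.
have n0 : 0 <= n%:R :> R by [].
have e1 : eta * (n%:R * d) <= d / 2.
  apply: (@le_trans _ _ ((2 * n.+1%:R)^-1 * (n%:R * d))).
    by rewrite ler_wpM2r ?mulr_ge0// ge_min lexx.
  rewrite mulrC ler_pdivrMr ?mulr_gt0//.
  rewrite (_ : d / 2 * _ = n.+1%:R * d); last by field.
  by rewrite ler_wpM2r// ler_nat.
have e2 : eta * A <= e / 2.
  apply: (@le_trans _ _ (e / (2 * A) * A)).
    by apply: ler_wpM2r; [exact: ltW|rewrite ge_min lexx orbT].
  by rewrite le_eqVlt; apply/orP; left; apply/eqP; field; rewrite gt_eqF.
have : d <= eta * (n%:R * d) + eta * A.
  apply: le_trans dle _; rewrite -mulrDr; apply: ler_wpM2l; first exact: ltW.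
  rewrite /A addrA lerD2r -mulrDr ler_wpM2l// addrC//.
lra.
Unshelve. all: by end_near. Qed.

(** The left-invariant field with value [w] at the identity, applied to [f]. *)
Definition ldf (f : G -> R) (w : V) (x : G) : R := dfe (fun y => f (x * y)%g) w.

Lemma tmap_invg (w : V) : tmap (fun x : G => x^-1)%g w = - w.
Proof. exact: (vel_uniq (vel_tmap smooth_endo_inv (vel_line w)) (vel_inv (vel_line w))). Qed.

Lemma ldf_smooth (f : G -> R) (w : V) : smoothG f -> smoothG (ldf f w).
Proof.
move=> fs; have fi := smoothG_inv fs.
rewrite (_ : ldf f w = fun x => rinv (- w) (fun y => f y^-1%g) x^-1%g).
  exact/smoothG_inv/smooth_rinv.
apply/funext => x; rewrite rinvE// -tmap_invg -tmapE//.
- by rewrite /ldf; congr dfe; apply/funext => y /=; rewrite invgM !invgK.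
- exact: smooth_endo_inv.
- exact: (smoothG_mulr x^-1%g fi).
Qed.

Lemma ldf_Ad (f : G -> R) (w : V) x : smoothG f ->
  ldf f w x = dfe (fun y => f (y * x)%g) (Ad x w).
Proof.
move=> fs; rewrite /Ad -tmapE; [|exact: smooth_endo_conj|exact: smoothG_mulr].
by rewrite /ldf; congr dfe; apply/funext => y /=; rewrite mulgVK.
Qed.

Lemma Ad_cont (w : V) : continuous (fun x : G => Ad x w).
Proof.
move=> x; apply: frame_continuous => f fs.
rewrite (_ : (fun _ => _) = ldf f w); first exact/smoothG_continuous/ldf_smooth.
by apply/funext => y; rewrite ldf_Ad.
Qed.

Lemma kappa_cont (X : linear_field G) : continuous (kappa X).
Proof.
move=> x; apply: frame_continuous => f fs.
rewrite (_ : (fun _ => _) = lf_field X f); first exact/smoothG_continuous/field_smooth.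
by apply/funext => y; rewrite fieldE.
Qed.

Lemma derive_comm_slices (F : V * V -> R) (v w : V) :
  classC 2 [set z : V * V | lcod z.1 /\ lcod z.2] F ->
  'D_v (fun x : V => 'D_w (fun y : V => F (x, y)) (0 : V)) (0 : V) =
  'D_w (fun y : V => 'D_v (fun x : V => F (x, y)) (0 : V)) (0 : V).
Proof.
move=> FC.
have oU : open [set z : V * V | lcod z.1 /\ lcod z.2].
  rewrite openE => -[u1 u2] /= [c1 c2]; exists (lcod, lcod) => //=.
  by split; apply: open_nbhs_nbhs; split=> //; exact: open_lcod.
have E := @derive_comm R _ _ F ((0 : V), (0 : V)) ((v, 0) : V * V) ((0, w) : V * V) oU
  (conj (lcod0 G) (lcod0 G)) FC.
have E1 : (fun x : V => 'D_w (fun y : V => F (x, y)) (0 : V)) =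
    (fun x : V => ('D_((0, w) : V * V) F) (x, (0 : V))).
  by apply/funext => x; exact: (esym (@derive_slicer R n _ F w x 0)).
have E2 : (fun y : V => 'D_v (fun x : V => F (x, y)) (0 : V)) =
    (fun y : V => ('D_((v, 0) : V * V) F) ((0 : V), y)).
  by apply/funext => y; exact: (esym (@derive_slicel R n _ F v 0 y)).
rewrite E1 E2.
have E3 := @derive_slicel R n _ ('D_((0, w) : V * V) F) v 0 0.
have E4 := @derive_slicer R n _ ('D_((v, 0) : V * V) F) w 0 0.
by move: E; rewrite E3 E4.
Qed.

(** Both sides are mixed second derivatives of the product f(xy) at the identity, taken in opposite
    orders. *)
Lemma dfe_ldf (f : G -> R) (v w : V) : smoothG f ->
  dfe (ldf f w) v = rinv w (rinv v f) 1%g.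
Proof.
move=> fs; rewrite rinv1; last exact: smooth_rinv.
have E := derive_comm_slices v w (smoothG_lpt2 2 fs).
transitivity ('D_w (fun y : V => 'D_v (fun x : V => f (lpt x * lpt y)%g) (0 : V)) (0 : V)).
  exact: E.
rewrite /dfe; congr ('D_w _ _); apply/funext => y /=.
by rewrite rinvE.
Qed.

(** Needed because the orbit supplies curves for nonnegative times only. *)
Lemma vel_glue (c d : R -> G) (v : V) : vel c v -> vel d v ->
  vel (fun t => if t < 0 then d t else c t) v.
Proof.
move=> vc vd; have c0 : c 0 = 1%g by case: vc.
have d0 : d 0 = 1%g by case: vd.
apply: velI; first by rewrite ltxx.
move=> f fs; apply/is_derive_leP => e e0.
have /is_derive_leP/(_ _ e0) Hc := vel_derive vc fs.
have /is_derive_leP/(_ _ e0) Hd := vel_derive vd fs.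
near=> h.
have Hch : `|(f \o c) (0 + h) - (f \o c) 0 - h *: dfe f v| <= e * `|h| by near: h.
have Hdh : `|(f \o d) (0 + h) - (f \o d) 0 - h *: dfe f v| <= e * `|h| by near: h.
by move: Hch Hdh; rewrite /= add0r ltxx c0 d0; case: ifP.
Unshelve. all: by end_near. Qed.

End Frames.

(** * Brackets of right-invariant fields and open subgroups *)

Section Brackets.
Context {R : realType} {n : nat} {G : lieGroupType R n}.

Lemma vector_field_zero (Y : operator G) : vector_field Y -> Y (fun=> 0) = (fun=> 0).
Proof.
move=> vY; have := vf_linear vY (-1) (smoothG_cst 0) (smoothG_cst 0).
have -> : (fun _ : G => -1 * 0 + 0) = (fun=> 0 : R) by apply/funext => x; rewrite mulr0 addr0.
by move=> ->; apply/funext => x; rewrite mulN1r addNr.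
Qed.

Lemma right_invariant_bracket (Y Z : operator G) :
  right_invariant Y -> right_invariant Z -> right_invariant (bracket Y Z).
Proof.
move=> [vY rY] [vZ rZ]; have sY := vf_smooth vY; have sZ := vf_smooth vZ.
split.
  split.
  - move=> f fs; rewrite /bracket.
    have -> : (fun x => Y (Z f) x - Z (Y f) x) = (fun x => (-1) * Z (Y f) x + Y (Z f) x).
      by apply/funext => x; rewrite mulN1r addrC.
    by apply: smoothGD; [apply: smoothGM; [exact: smoothG_cst|]|]; auto.
  - move=> f nf; apply/funext => x; rewrite /bracket (vf_junk vZ nf) (vf_junk vY nf).
    have E W : vector_field W -> W (0 : G -> R) x = 0.
      by move=> vW; have := vector_field_zero vW => /(congr1 (fun F => F x)).
    by rewrite !E// subrr.
  - move=> a f h fs hs; apply/funext => x; rewrite /bracket.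
    rewrite (vf_linear vZ a fs hs) (vf_linear vY a fs hs).
    by rewrite (vf_linear vY a (sZ _ fs) (sZ _ hs)) (vf_linear vZ a (sY _ fs) (sY _ hs)); ring.
  - move=> f h fs hs; apply/funext => x; rewrite /bracket.
    rewrite (vf_leibniz vZ fs hs) (vf_leibniz vY fs hs).
    have E W W' : vector_field W -> vector_field W' ->
        W' (fun x => f x * W h x + W f x * h x) = 
        (fun x => f x * W' (W h) x + W' f x * W h x + (W f x * W' h x + W' (W f) x * h x)).
      move=> vW vW'; have sW := vf_smooth vW.
      have fW : smoothG (fun x => f x * W h x) by apply: smoothGM; auto.
      have Wf : smoothG (fun x => W f x * h x) by apply: smoothGM; auto.
      have := vf_linear vW' 1 fW Wf.
      have -> : (fun x => 1 * (f x * W h x) + W f x * h x) = (fun x => f x * W h x + W f x * h x).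
        by apply/funext => y; rewrite mul1r.
      move=> ->; apply/funext => y; rewrite mul1r.
      by rewrite (vf_leibniz vW' fs (sW _ hs)) (vf_leibniz vW' (sW _ fs) hs).
    by rewrite (E _ _ vZ vY) (E _ _ vY vZ); ring.
move=> g f fs; apply/funext => x; rewrite /bracket (rY g f fs) (rZ g f fs).
by rewrite (rY g _ (sZ _ fs)) (rZ g _ (sY _ fs)).
Qed.
End Brackets.

Lemma open_subgroup_full {R : realType} {n : nat} {G : lieGroupType R n} (A : set G) : connected [set: G] -> nbhs (1%g : G) A ->
  (forall x y, A x -> A y -> A (x * y)%g) -> (forall x, A x -> A x^-1%g) -> A = setT.
Proof.
move=> cG nA AM AV.
have shift (x : G) : nbhs (x : G) ((fun y : G => x^-1 * y)%g @^-1` A).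
  have cx : (fun y : G => x^-1 * y)%g @ x --> (x^-1 * x)%g.
    by apply: mulg_cvg; [exact: cvg_cst|exact: cvg_id].
  by rewrite mulVg in cx; exact: (cx _ nA).
apply: (cG A); first by exists 1%g; exact: nbhs_singleton.
- exists A; last by rewrite setTI.
  rewrite openE => x Ax; rewrite /interior.
  apply: (@filterS G (nbhs (x : G)) _ _ _ _ (shift x)) => y /= Ay.
  by rewrite -(mulVKg x y); exact: AM.
- exists A; last by rewrite setTI.
  move=> x clx; have [y [Ay /= Axy]] := clx _ (shift x).
  have -> : x = (y * (x^-1 * y)^-1)%g by rewrite invgM invgK mulVKg.
  by apply: AM => //; exact: AV.
Qed.

Lemma control_direction {R : realType} {n m : nat} {G : lieGroupType R n}
    (S : linear_control_system m G) (i : 'I_m) :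
  exists (c : R) (u : 'rV[R]_m),
    [/\ 0 < c, control_range S u & cvec S u = c *: control_vector S i].
Proof.
have [r r0 Hr] := control_small S; have r2 : 0 < r / 2 by rewrite divr_gt0.
exists (r / 2), ((r / 2) *: delta_mx 0 i); split=> //.
  apply: Hr; apply: (@le_lt_trans _ _ (r / 2)); last by rewrite ltr_pdivrMr// ltr_pMr// ltr1n.
  apply: norm_rV_le => [|j]; first exact: ltW.
  rewrite !mxE eqxx /=; case: (j == i); rewrite ?mulr1 ?mulr0 ?normr0 ?(ltW r2)//.
  by rewrite ger0_norm// ltW.
rewrite /cvec (bigD1 i)//= big1 ?addr0; last first.
  by move=> j ji; rewrite !mxE eqxx (negbTE ji) mulr0 scale0r.
by rewrite !mxE !eqxx mulr1.
Qed.

Lemma vel_trajectory_start {R : realType} {n m : nat} {G : lieGroupType R n}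
    (S : linear_control_system m G) (u : 'rV[R]_m) : control_range S u ->
  vel (fun t => trajectory S t 1%g (fun=> u)) (cvec S u).
Proof.
move=> Ou; have cu := controls_cst Ou.
have n0 : ~ switching_times (fun _ : R => u) 0 by rewrite switching_cst.
have := trajectory_vel 1%g cu n0; rewrite (trajectory0 1%g cu) kappa1 add0r.
by apply: vel_ext => h; rewrite add0r invg1 mulg1.
Qed.

(** * The Lie algebra of an invariant subgroup *)

Section LieSubgroups.
Context {R : realType} {n m : nat} {G : lieGroupType R n}.
Local Notation V := 'rV[R]_n.
Variable S : linear_control_system m G.
Local Notation X := (drift S).
Local Notation phi := (lf_flow (drift S)).
Local Notation D := (lf_der (drift S)).
Variable L : set G.
Hypothesis L1 : L 1%g.
Hypothesis LM : forall x y, L x -> L y -> L (x * y)%g.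
Hypothesis LV : forall x, L x -> L x^-1%g.
Hypothesis Lflow : forall t x, L x -> L (phi t x).
Hypothesis Lorbit : positive_orbit S 1%g `<=` L.

(** Tangent vectors at 1 of curves inside [L]. Being curve velocities, they form a subspace without
    any closedness or smoothness of [L]. *)
Definition lalg (v : V) : Prop := exists c : R -> G, (forall t, L (c t)) /\ vel c v.

Lemma lalg0 : lalg 0.
Proof. by exists (fun=> 1%g); split=> //; exact: vel_cst. Qed.

Lemma lalg_lin (a : R) v w : lalg v -> lalg w -> lalg (a *: v + w).
Proof.
move=> [c [Lc vc]] [d [Ld vd]]; exists (fun t => c (a * t)%R * d t)%g; split.
  by move=> t; exact: LM.
exact: vel_mul (vel_scale a vc) vd.
Qed.

Lemma lalg_Ad g v : L g -> lalg v -> lalg (Ad g v).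
Proof.
move=> Lg [c [Lc vc]]; exists (fun t => g * c t * g^-1)%g; split.
  by move=> t; apply: LM; [exact: LM|exact: LV].
exact: vel_conj.
Qed.

Lemma lalg_dflow t v : lalg v -> lalg (dflow X t v).
Proof.
move=> [c [Lc vc]]; exists (phi t \o c); split; first by move=> s; exact: Lflow.
exact: (vel_tmap (smooth_endo_flow X t) vc).
Qed.

Lemma lalg_control i : lalg (control_vector S i).
Proof.
have [r [u [r0 Ou uE]]] := control_direction S i; have cu := controls_cst Ou.
pose g t := trajectory S t 1%g (fun=> u).
have vg : vel g (cvec S u) := vel_trajectory_start Ou.
(* For negative times the trajectory is replaced by the inverse of its value at the opposite time,
   which has the same velocity and lies in [L]. *)
have vg' : vel (fun t => (g (-1 * t)%R)^-1)%g (cvec S u).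
  by have := vel_inv (vel_scale (-1) vg); rewrite scaleN1r opprK.
have La : lalg (cvec S u).
  exists (fun t => if t < 0 then (g (-1 * t)%R)^-1%g else g t); split; last exact: vel_glue.
  move=> t; case: ltP => t0.
    by apply/LV/Lorbit; exists (-1 * t), (fun=> u); split=> //; rewrite mulN1r oppr_gt0.
  case: (eqVneq t 0) => [->|tn]; first by rewrite /g trajectory0.
  by apply: Lorbit; exists t, (fun=> u); split=> //; rewrite lt_neqAle eq_sym tn.
rewrite uE in La; have := lalg_lin r^-1 La lalg0.
by rewrite addr0 scalerA mulVf ?scale1r// gt_eqF.
Qed.

(** Functions with zero differential satisfy the premise of the hypothesis, so [Y f] at 1 depends on
    the differential of [f] only and [f] may be replaced by a combination [xl] of coordinate
    functions. A functional separating the resulting vector from [lalg] would contradict the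
    hypothesis. *)
Lemma lalg_operator (Y : operator G) : right_invariant Y ->
  (forall f : G -> R, smoothG f -> (forall w, lalg w -> dfe f w = 0) -> Y f 1%g = 0) ->
  exists2 v, lalg v & Y = rinv v.
Proof.
move=> rY H.
pose xl (a : 'I_n -> R) : G -> R := fun x => \sum_(i < n) a i * xc i x.
have sumE (s : seq 'I_n) (a : 'I_n -> R) (Z : operator G) : right_invariant Z ->
    smoothG (fun x : G => \sum_(i <- s) a i * xc i x) /\
    Z (fun x => \sum_(i <- s) a i * xc i x) 1%g = \sum_(i <- s) a i * Z (xc i) 1%g.
  move=> [rZ _]; elim: s => [|i s [IH1 IH2]].
    have E : (fun x : G => \sum_(i <- [::]) a i * xc i x) = (fun=> 0).
      by apply/funext => x; rewrite big_nil.
    rewrite E big_nil; split; first exact: smoothG_cst.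
    by rewrite (vector_field_zero rZ).
  have E : (fun x : G => \sum_(j <- i :: s) a j * xc j x) =
           (fun x : G => a i * xc i x + \sum_(j <- s) a j * xc j x).
    by apply/funext => x; rewrite big_cons.
  rewrite E big_cons (vf_linear rZ)//; last exact: xc_smooth.
  split; last by rewrite IH2.
  apply: smoothGD IH1; apply: smoothGM; [exact: smoothG_cst|exact: xc_smooth].
have xls a : smoothG (xl a) by have [] := sumE (index_enum 'I_n) a Y rY.
have xlY a : Y (xl a) 1%g = \sum_i a i * Y (xc i) 1%g.
  by have [_] := sumE (index_enum 'I_n) a Y rY.
have xld a w : dfe (xl a) w = \sum_i w 0 i * a i.
  have [_] := sumE (index_enum 'I_n) a (rinv w) (right_invariant_rinv w).
  rewrite rinv1; last exact: xls.
  by move=> ->; apply: eq_bigr => i _; rewrite rinv1 ?dfe_xc 1?mulrC//; exact: xc_smooth.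
pose v : V := \row_i Y (xc i) 1%g.
exists v; last first.
  apply: right_invariant_eq => //; first exact: right_invariant_rinv.
  move=> f fs; rewrite rinv1//.
  pose a i := dfe f (delta_mx 0 i).
  have fa : dfe f v = Y (xl a) 1%g.
    by rewrite xlY dfe_coord//; apply: eq_bigr => i _; rewrite mxE mulrC.
  have h0 : Y (fun x => (-1) * xl a x + f x) 1%g = 0.
    apply: H; first by apply: smoothGD => //; apply: smoothGM => //; exact: smoothG_cst.
    move=> w _; rewrite dfe_linf// xld (dfe_coord w fs) /a; lra.
  move: h0; rewrite (vf_linear rY.1)// fa; lra.
apply: contrapT => nv.
have [a [aP av]] := subspace_functional lalg0 lalg_lin nv.
move/eqP: av; apply; rewrite -[RHS](H (xl a) (xls a)); last by move=> w /aP; rewrite xld.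
by rewrite xlY; apply: eq_bigr => i _; rewrite mxE mulrC.
Qed.

Lemma rinv_lin (a : R) (v w : V) :
  (fun f x => a * rinv v f x + rinv w f x) = rinv (a *: v + w) :> operator G.
Proof.
apply/funext => f; apply/funext => x; rewrite /rinv; case: asboolP => fs.
  by rewrite dfe_lin//; exact: smoothG_mulr.
by rewrite mulr0 addr0.
Qed.

Lemma rinv_0 : (fun _ _ => 0) = rinv 0 :> operator G.
Proof.
have := rinv_lin 0 0 0; rewrite scale0r addr0 => <-.
apply/funext => f; apply/funext => x.
rewrite mul0r add0r /rinv; case: asboolP => fs //.
by rewrite dfe0//; exact: smoothG_mulr.
Qed.

(** The image under the derivation is the derivative at time 0 of the curve [dflow X s v], which
    stays in [lalg]; a function whose differential vanishes on [lalg] is thus killed. *)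
Lemma lalg_derivation v : lalg v -> exists2 w, lalg w & D (rinv v) = rinv w.
Proof.
move=> lv; apply: lalg_operator; first exact/lf_der_right_invariant/right_invariant_rinv.
move=> f fs H; have := flow_operator_derive X 0 (right_invariant_rinv v) fs.
rewrite (_ : (fun x => f (phi 0 x)) = f); last by apply/funext => x; rewrite lf_flow0.
rewrite (_ : (fun s => _) = fun=> 0); last first.
  apply/funext => s; have fs' : smoothG (fun x => f (phi s x)) by exact: (smooth_endo_flow X s).2.
  rewrite rinv1// (tmapE (f := f) v (smooth_endo_flow X s))//.
  by apply: H; exact: lalg_dflow.
move=> [_ <-]; exact: derive_cst.
Qed.

(** Along a curve [c] in [L] with velocity [v], compare the left- and right-invariant derivatives of
    [f] in direction [w]. Their difference is the derivative along [Ad (c s) w - w], an element of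
    [lalg], and up to sign its rate of change at 0 is the bracket applied to [f]. *)
Lemma lalg_bracket v w : lalg v -> lalg w ->
  exists2 u, lalg u & bracket (rinv v) (rinv w) = rinv u :> operator G.
Proof.
move=> lv lw; apply: lalg_operator.
  by apply: right_invariant_bracket; exact: right_invariant_rinv.
move=> f fs H; rewrite /bracket; have [c [Lc vc]] := lv.
have c0 : c 0 = 1%g by case: vc.
have fv := smooth_rinv v fs; have fw := smooth_rinv w fs.
pose h s := ldf f w (c s) - rinv w f (c s).
have d1 : is_derive (0 : R) (1 : R) h (dfe (ldf f w) v - dfe (rinv w f) v).
  exact: is_deriveB (vel_derive vc (ldf_smooth w fs)) (vel_derive vc fw).
suff d2 : is_derive (0 : R) (1 : R) h 0.
  have : dfe (ldf f w) v - dfe (rinv w f) v = 0 by case: d1 => _ <-; case: d2.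
  by rewrite dfe_ldf// (rinv1 v fw); lra.
have h0 : h 0 = 0 by rewrite /h c0 ldf_Ad// Ad1 -rinvE// subrr.
pose b i (x : G) := rinv (delta_mx 0 i) f x.
pose W s := Ad (c s) w - w.
(* By hypothesis the coefficients at 1 pair to zero with [W s], so they may be subtracted. One
   factor is then o(1) and the other O(s), hence [h] has derivative 0. *)
have hE s : h s = \sum_i W s 0 i * (b i (c s) - b i 1%g).
  have LW : lalg (W s).
    by have := lalg_lin (-1) lw (lalg_Ad (Lc s) lw); rewrite scaleN1r addrC.
  have E0 : \sum_i W s 0 i * b i 1%g = 0.
    by rewrite -[RHS](H _ LW) dfe_coord//; apply: eq_bigr => i _; rewrite /b rinv1.
  under eq_bigr do rewrite mulrBr; rewrite sumrB E0 subr0.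
  rewrite /h ldf_Ad// rinvE// -dfeB; last exact: smoothG_mulr.
  rewrite dfe_coord; last exact: smoothG_mulr.
  by apply: eq_bigr => i _; rewrite /b rinvE.
pose l i := dfe (rinv (delta_mx 0 i) f) v.
pose K := 1 + \sum_i `|l i|.
have K0 : 0 < K by rewrite ltr_pwDl// sumr_ge0.
have n1 : 0 < n%:R * K + 1 by rewrite ltr_wpDl// mulr_ge0// ltW.
apply/is_derive_leP => e e0.
have nW : \forall s \near (0 : R), `|W s| <= e / (n%:R * K + 1).
  have cW : (fun s : R => Ad (c s) w) @ (0 : R) --> Ad (1%g : G) w.
    have [_ cc _] := vc; exact: (cvg_comp _ _ cc (@Ad_cont _ _ _ w 1%g)).
  move/cvgrPdist_le : cW => /(_ (e / (n%:R * K + 1))); rewrite divr_gt0// => /(_ isT).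
  by apply: filterS => s; rewrite Ad1 distrC.
have nb : nbhs (0 : R) [set s : R | forall i, `|b i (c s) - b i 1%g| <= K * `|s|].
  apply: (@filter_forall R _ (fun (i : 'I_n) (s : R) => `|b i (c s) - b i 1%g| <= K * `|s|) (nbhs (0 : R)) _) => i.
  have fi := smooth_rinv (delta_mx 0 i) fs.
  have /is_derive_leP/(_ _ ltr01) := vel_derive vc fi.
  apply: filterS => s /=; rewrite add0r c0 => Hs.
  rewrite -[b i _ - _](subrK (s *: l i)) (le_trans (ler_normD _ _))//.
  rewrite mulrDl lerD//; rewrite normrM mulrC ler_wpM2r//.
  by rewrite (bigD1 i)//= lerDl sumr_ge0.
near=> s; rewrite add0r scaler0 subr0 h0 subr0 hE.
have Ws : `|W s| <= e / (n%:R * K + 1) by near: s.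
have bs : forall i, `|b i (c s) - b i 1%g| <= K * `|s| by near: s.
apply: le_trans (ler_norm_sum _ _ _) _.
apply: (@le_trans _ _ (\sum_(i < n) e / (n%:R * K + 1) * (K * `|s|))).
  apply: ler_sum => i _; rewrite normrM; apply: ler_pM => //.
  by apply: le_trans Ws; exact: norm_coord.
rewrite sumr_const card_ord -[_ *+ n]mulr_natl.
have -> (q : R) : n%:R * (e * q * (K * `|s|)) = (n%:R * K) * q * (e * `|s|) by ring.
apply: ler_piMl; first by rewrite mulr_ge0// ltW.
by rewrite ler_pdivrMr// mul1r lerDl.
Unshelve. all: by end_near. Qed.

Lemma larc_lalg (Y : operator G) : LARC S -> right_invariant Y ->
  exists2 v, lalg v & Y = rinv v.
Proof.
move=> larc; rewrite larc => H.
pose h' : set (operator G) := [set Y | exists2 v, lalg v & Y = rinv v].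
apply: (H h'); split; last first.
  by move=> _ [i _ <-]; exists (control_vector S i);
    [exact: lalg_control|exact: control_vectorP].
split; last by move=> _ [v lv ->]; exact: lalg_derivation.
split.
- by move=> _ [v _ ->]; exact: right_invariant_rinv.
- by exists 0; [exact: lalg0|exact: rinv_0].
- by move=> a _ _ [v lv ->] [w lw ->]; exists (a *: v + w);
    [exact: lalg_lin|exact: rinv_lin].
- by move=> _ _ [v lv ->] [w lw ->]; exact: lalg_bracket.
Qed.

Lemma lalg_full : LARC S -> forall v, lalg v.
Proof.
move=> larc v; have [w lw E] := larc_lalg larc (right_invariant_rinv v).
suff -> : v = w by [].
by apply: (@dfe_inj _ _ G) => f fs; rewrite -(rinv1 v fs) -(rinv1 w fs) E.
Qed.

(** By LARC every vector is the velocity of a curve in [L]. The powers of its points at dyadic times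
    converge to an exponential, which lies in the closed set [L]; so [L] contains a neighbourhood of
    1. *)
Lemma subgroup_full : LARC S -> closed L -> connected [set: G] -> L = setT.
Proof.
move=> larc cL cG.
have Lpow x k : L x -> L (x ^+ k)%g.
  by move=> Lx; elim: k => [|k IH]; rewrite ?expg0// expgS; exact: LM.
have Lex (v : V) : `|v| < @erad R n G -> L (@ex R n G v).
  move=> vr; have [c [Lc vc]] := lalg_full larc v.
  have [cv1 cv2] := vel_seq vc.
  apply: (closed_cvg _ cL _ _ (ex_limit vr cv1 cv2)).
  by near=> k; apply: Lpow; exact: Lc.
have L1' : nbhs (1%g : G) L.
  have e0 : 0 < @erad R n G / 2 by rewrite divr_gt0// erad_gt0.
  apply: filterS (@ex_nbhs _ _ G _ e0) => _ [v /= ve <-]; apply: Lex.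
  by apply: le_lt_trans ve _; rewrite ltr_pdivrMr// ltr_pMr ?ltr1n// erad_gt0.
by apply: open_subgroup_full.
Unshelve. all: by end_near. Qed.

End LieSubgroups.

(** The case where the subgroup is the whole group; this supplies the hypothesis [HR] below. *)
Lemma larc_rinv {R : realType} {n m : nat} {G : lieGroupType R n}
    (S : linear_control_system m G) (Y : operator G) : LARC S -> right_invariant Y ->
  exists v, Y = rinv v.
Proof.
move=> larc rY; have [] := @larc_lalg _ _ _ _ S setT _ _ _ _ _ _ larc rY => // v _ ->.
by exists v.
Qed.

(** * One-parameter groups of linear maps *)

Section LinearFlows.
Context {R : realType} {n : nat}.
Local Notation V := 'rV[R]_n.
Implicit Types (T : R -> V -> V) (d f : V -> V).

Definition lin f : Prop := forall (a : R) v w, f (a *: v + w) = a *: f v + f w.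

Lemma linD f v w : lin f -> f (v + w) = f v + f w.
Proof. by move=> H; rewrite -[v]scale1r H !scale1r. Qed.

Lemma lin0 f : lin f -> f 0 = 0.
Proof. by move=> H; have := linD 0 0 H; rewrite addr0 => /(congr1 (+%R^~ (- f 0))); rewrite addrK subrr. Qed.

Lemma linZ f a v : lin f -> f (a *: v) = a *: f v.
Proof. by move=> H; rewrite -[a *: v]addr0 H lin0// addr0. Qed.

Lemma linN f v : lin f -> f (- v) = - f v.
Proof. by move=> H; rewrite -scaleN1r linZ// scaleN1r. Qed.

Lemma linB f v w : lin f -> f (v - w) = f v - f w.
Proof. by move=> H; rewrite linD// linN. Qed.

Lemma lin_sum f (I : Type) (s : seq I) (F : I -> V) : lin f ->
  f (\sum_(i <- s) F i) = \sum_(i <- s) f (F i).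
Proof. by move=> H; apply: (big_morph f _ (lin0 H)) => v w; exact: linD. Qed.

Lemma lin_coord f v : lin f -> f v = \sum_i v 0 i *: f (delta_mx 0 i).
Proof.
move=> H; rewrite {1}[v]row_sum_delta lin_sum//.
by apply: eq_bigr => i _; rewrite linZ.
Qed.

Lemma lin_iter f k : lin f -> lin (iter k f).
Proof. by move=> H; elim: k => // k IH a v w /=; rewrite IH H. Qed.

Lemma lin_bound_le f (c : 'I_n -> R) v : lin f -> (forall i, `|f (delta_mx 0 i)| <= c i) ->
  `|f v| <= (\sum_i c i) * `|v|.
Proof.
move=> H Hc; rewrite lin_coord// mulr_suml (le_trans (ler_norm_sum _ _ _))//.
by apply: ler_sum => i _; rewrite normrZ mulrC ler_pM// norm_coord.
Qed.

Lemma lin_bound f : lin f -> exists2 K : R, 0 < K & forall v, `|f v| <= K * `|v|.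
Proof.
move=> H; exists (1 + \sum_i `|f (delta_mx 0 i)|); first by rewrite ltr_pwDl// sumr_ge0.
move=> v; have := @lin_bound_le f (fun i => `|f (delta_mx 0 i)|) v H (fun i => lexx _).
by move=> /le_trans; apply; rewrite ler_wpM2r// lerDr.
Qed.

Lemma lin_cvg f (U : Type) (F : set_system U) (c : U -> V) l : Filter F -> lin f ->
  c @ F --> l -> (fun t => f (c t)) @ F --> f l.
Proof.
move=> FF H cl; have [K K0 HK] := lin_bound H.
apply/cvgrPdist_le => e e0.
move/cvgrPdist_le : cl => /(_ (e / K)); rewrite divr_gt0// => /(_ isT).
apply: filterS => t Ht; rewrite -linB// (le_trans (HK _))//.
by rewrite mulrC -ler_pdivlMr.
Qed.

Lemma is_derive_lin f (c : R -> V) (t : R) l : lin f ->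
  is_derive t (1 : R) c l -> is_derive t (1 : R) (fun s => f (c s)) (f l).
Proof.
move=> H /is_derive_leP Hc; have [K K0 HK] := lin_bound H.
apply/is_derive_leP => e e0; have := Hc (e / K); rewrite divr_gt0// => /(_ isT).
apply: filterS => h Hh; rewrite -linZ// -!linB// (le_trans (HK _))//.
by rewrite mulrC -ler_pdivlMr// mulrAC.
Qed.

Lemma is_derive_coord (c : R -> V) (t : R) l i :
  is_derive t (1 : R) c l -> is_derive t (1 : R) (fun s => c s 0 i) (l 0 i).
Proof.
move=> /is_derive_leP Hc; apply/is_derive_leP => e e0; have := Hc e e0.
apply: filterS => h; apply: le_trans.
by have := norm_coord (c (t + h) - c t - h *: l) i; rewrite !mxE.
Qed.

Lemma derive0_cst (c : R -> V) : (forall t, is_derive t (1 : R) c 0) -> forall t, c t = c 0.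
Proof.
move=> H t; apply/rowP => i; apply: (@is_derive_0_is_cst R (fun s => c s 0 i)) => s.
by have := is_derive_coord i (H s); rewrite mxE.
Qed.

Record linear_flow T d : Prop := LinearFlow {
  lflow_lin : forall t, lin (T t);
  lflow_gen : lin d;
  lflow0 : forall v, T 0 v = v;
  lflowD : forall s t v, T (s + t) v = T s (T t v);
  lflow_derive : forall t v, is_derive t (1 : R) (fun s => T s v) (T t (d v)) }.

Lemma lflowNK T d t v : linear_flow T d -> T (- t) (T t v) = v.
Proof. by move=> H; rewrite -(lflowD H) addNr (lflow0 H). Qed.

Lemma lflowKN T d t v : linear_flow T d -> T t (T (- t) v) = v.
Proof. by move=> H; rewrite -(lflowD H) subrr (lflow0 H). Qed.

Lemma lflow_product T d (c : R -> V) t l : linear_flow T d -> is_derive t (1 : R) c l ->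
  is_derive t (1 : R) (fun s => T s (c s)) (T t (d (c t)) + T t l).
Proof.
move=> H Hc; apply: is_derive_rV => j.
pose e i : V := delta_mx 0 i.
have E s u : (T s u) 0 j = (\sum_(i < n) (fun s' => u 0 i * (T s' (e i)) 0 j)) s.
  by rewrite fct_sumE (lin_coord u (lflow_lin H s)) summxE; apply: eq_bigr => i _; rewrite mxE.
have := @is_derive_sum R R R n (fun i s => c s 0 i * (T s (e i)) 0 j) t 1
  (fun i => c t 0 i * (T t (d (e i))) 0 j + (T t (e i)) 0 j * l 0 i).
move=> /(_ _)[].
  move=> i; have := is_deriveM (is_derive_coord i Hc) (is_derive_coord j (lflow_derive H t (e i))).
  exact.
move=> D1 D2.
have -> : (fun s => (T s (c s)) 0 j) = \sum_(i < n) (fun s => c s 0 i * (T s (e i)) 0 j).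
  by apply/funext => s; rewrite E !fct_sumE.
split; first exact: D1.
rewrite D2 big_split /= !mxE; congr (_ + _).
  rewrite (lin_coord (d (c t)) (lflow_lin H t)).
  have dl : lin (fun v => T t (d v)) by move=> a v w; rewrite (lflow_gen H) (lflow_lin H).
  by rewrite -(lin_coord _ (lflow_lin H t)) (lin_coord (c t) dl) summxE; apply: eq_bigr => i _; rewrite mxE.
by rewrite (lin_coord l (lflow_lin H t)) summxE; apply: eq_bigr => i _; rewrite mxE mulrC.
Qed.

Lemma lflow_rev T d : linear_flow T d -> linear_flow (fun t => T (- t)) (fun v => - d v).
Proof.
move=> H; split.
- by move=> t; exact: (lflow_lin H).
- by move=> a v w; rewrite (lflow_gen H) opprD scalerN.
- by move=> v; rewrite oppr0 (lflow0 H).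
- by move=> s t v; rewrite opprD (lflowD H).
- move=> t v; apply/is_derive_leP => e e0.
  have /is_derive_leP/(_ _ e0) := lflow_derive H (- t) v.
  move=> /nbhs_normP[r r0 Hr]; apply/nbhs_normP; exists r => // h hr.
  have := Hr (- h); rewrite subr0 normrN -opprD; rewrite subr0 in hr => /(_ hr).
  by rewrite (linN _ (lflow_lin H _)) scalerN scaleNr.
Qed.

Lemma lflow_ode T d (c : R -> V) : linear_flow T d ->
  (forall t, is_derive t (1 : R) c (d (c t))) -> forall t, c t = T t (c 0).
Proof.
move=> H Hc t; have H' := lflow_rev H.
have E : T (- t) (c t) = c 0.
  have := @derive0_cst (fun s => T (- s) (c s)); rewrite oppr0 (lflow0 H); apply=> s.
  have := lflow_product H' (Hc s).
  by rewrite (linN _ (lflow_lin H _)) addNr.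
by rewrite -E (lflowKN _ _ H).
Qed.

Lemma lflow_derive_gen T d t v : linear_flow T d ->
  is_derive t (1 : R) (fun s => T s v) (d (T t v)).
Proof.
move=> H; suff -> : d (T t v) = T t (d v) by exact: (lflow_derive H).
have H0 := lflow_derive H 0 (T t v); rewrite (lflow0 H) in H0.
have := lflow_derive H t v; move/is_derive_shift0.
rewrite (_ : (fun s => _) = (fun s => T s (T t v))); last first.
  by apply/funext => s; rewrite addrC (lflowD H).
by case=> _ <-; case: H0.
Qed.

Lemma lflow_genC T d t v : linear_flow T d -> d (T t v) = T t (d v).
Proof.
by move=> H; have [_ <-] := lflow_derive H t v; have [_ <-] := lflow_derive_gen t v H.
Qed.

Lemma lflow_uniq T T' d : linear_flow T d -> linear_flow T' d -> forall t v, T t v = T' t v.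
Proof.
move=> H H' t v; have := @lflow_ode _ _ (fun s => T s v) H'; rewrite (lflow0 H); apply=> s.
exact: (lflow_derive_gen _ _ H).
Qed.

Lemma lflow_comm_lin T d f t v : linear_flow T d -> lin f ->
  (forall u, f (d u) = d (f u)) -> f (T t v) = T t (f v).
Proof.
move=> H Hf fd; have := @lflow_ode _ _ (fun s => f (T s v)) H; rewrite (lflow0 H); apply=> s.
by rewrite -fd; apply: is_derive_lin => //; exact: (lflow_derive_gen _ _ H).
Qed.

Lemma lflow_comp T T' d d' : linear_flow T d -> linear_flow T' d' ->
  (forall u, d (d' u) = d' (d u)) ->
  linear_flow (fun t v => T t (T' t v)) (fun v => d v + d' v).
Proof.
move=> H H' dd.
have TT' s t v : T' s (T t v) = T t (T' s v).
  apply: (lflow_comm_lin _ _ H (lflow_lin H' s)) => u.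
  by rewrite (lflow_comm_lin _ _ H' (lflow_gen H)).
split.
- by move=> t a v w; rewrite (lflow_lin H') (lflow_lin H).
- by move=> a v w; rewrite (lflow_gen H) (lflow_gen H') scalerDr addrACA.
- by move=> v; rewrite (lflow0 H') (lflow0 H).
- by move=> s t v; rewrite (lflowD H) (lflowD H') TT'.
- move=> t v; have := lflow_product H (lflow_derive H' t v).
  rewrite (lflow_comm_lin t v H' (lflow_gen H)) -?(linD _ _ (lflow_lin H t)) -?(linD _ _ (lflow_lin H' t))//.
Qed.

End LinearFlows.

(** * Eigenvectors and growth of nilpotent flows *)

Section Growth.
Context {R : realType} {n : nat}.
Local Notation V := 'rV[R]_n.
Variables (T : R -> V -> V) (d : V -> V).
Hypothesis HT : linear_flow T d.

Lemma is_derive_scalev (g : R -> R) (t l : R) (x : V) :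
  is_derive t (1 : R) g l -> is_derive t (1 : R) (fun s => g s *: x) (l *: x).
Proof.
move=> /is_derive_leP Hg; apply/is_derive_leP => e e0.
have x1 : 0 < `|x| + 1 by rewrite ltr_wpDl.
have := Hg (e / (`|x| + 1)); rewrite divr_gt0// => /(_ isT).
apply: filterS => h Hh; rewrite scalerA -!scalerBl normrZ.
apply: (@le_trans _ _ (e / (`|x| + 1) * `|h| * (`|x| + 1))).
  by apply: ler_pM => //; rewrite lerDl.
by rewrite mulrAC divfK// gt_eqF.
Qed.

Lemma is_derive_scaling (a t : R) : is_derive t (1 : R) (fun s => a * s) a.
Proof.
apply/is_derive_leP => e e0; near=> h.
rewrite (_ : _ - _ = 0) ?normr0 ?mulr_ge0// ?ltW//.
by rewrite /GRing.scale /=; ring.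
Unshelve. all: by end_near. Qed.

Lemma lflow_eigen (x : V) (a t : R) : d x = a *: x -> T t x = expR (a * t) *: x.
Proof.
move=> dx; have := @lflow_ode _ _ _ _ (fun s => expR (a * s) *: x) HT.
rewrite mulr0 expR0 scale1r => H; apply/esym; apply: H => s.
rewrite (linZ _ _ (lflow_gen HT)) dx scalerA; apply: is_derive_scalev.
have := is_derive1_comp (is_derive_expR (a * s)) (is_derive_scaling a s); exact.
Qed.

Lemma lflow_rotation (x y : V) (b t : R) : d x = - (b *: y) -> d y = b *: x ->
  T t x = cos (b * t) *: x - sin (b * t) *: y.
Proof.
move=> dx dy; have := @lflow_ode _ _ _ _ (fun s => cos (b * s) *: x - sin (b * s) *: y) HT.
rewrite mulr0 cos0 sin0 scale1r scale0r subr0 => H; apply/esym; apply: H => s.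
rewrite (linB _ _ (lflow_gen HT)) !(linZ _ _ (lflow_gen HT)) dx dy.
have -> : cos (b * s) *: - (b *: y) - sin (b * s) *: (b *: x) =
          (- sin (b * s) * b) *: x - (cos (b * s) * b) *: y.
  by rewrite scalerN !scalerA mulNr scaleNr addrC.
apply: is_deriveB; apply: is_derive_scalev.
  have := is_derive1_comp (is_derive_cos (b * s)) (is_derive_scaling b s); exact.
have := is_derive1_comp (is_derive_sin (b * s)) (is_derive_scaling b s); exact.
Qed.

Lemma lflow_uniform (P : set R) (g : R -> R) : (forall t, 0 <= g t) ->
  (forall v, exists C, forall t, P t -> `|T t v| <= C * g t) ->
  exists2 C, 0 < C & forall t v, P t -> `|T t v| <= C * g t * `|v|.
Proof.
move=> g0 H; have c i := cid (H (delta_mx 0 i)).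
exists (1 + \sum_i `|projT1 (c i)|); first by rewrite ltr_pwDl// sumr_ge0.
move=> t v Pt.
have := @lin_bound_le _ _ _ (fun i => `|projT1 (c i)| * g t) v (lflow_lin HT t) _.
rewrite -mulr_suml => /(_ _)/le_trans; apply.
  move=> i; apply: le_trans (projT2 (c i) t Pt) _.
  by rewrite ler_wpM2r// ler_norm.
by rewrite ler_wpM2r// ler_wpM2r// lerDr.
Qed.

Lemma lflow_diff_ge0 (v : V) (t M : R) : 0 <= t -> 0 <= M ->
  (forall s, 0 <= s -> s <= t -> `|T s (d v)| <= M) -> `|T t v - v| <= M * t.
Proof.
move=> t0 M0 H; apply: norm_rV_le => [|i]; first by rewrite mulr_ge0.
have D s := is_derive_coord i (lflow_derive HT s v).
have := @lipschitz_except R (fun s => T s v 0 i) (fun s => T s (d v) 0 i) [::] M 0 t t0.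
rewrite subr0 (lflow0 HT) !mxE; apply => //.
  move=> s; apply: differentiable_continuous; apply/derivable1_diffP.
  by case: (D s).
move=> s s0 st _; split; first exact: D.
by apply: le_trans (norm_coord _ _) _; apply: H; exact: ltW.
Qed.

(** At the last level of the nilpotent chain the flow is affine in time, [u + t *: d u]. It is also
    the image of a bounded curve under a power of [d], so its slope vanishes, which shortens the
    chain. *)
Lemma lflow_nil_unbounded (w : V) (k : nat) (M : R) : iter k d w = 0 ->
  (forall t, 0 <= t -> `|T t w| <= M) -> d w = 0.
Proof.
move=> kw HM; case: k kw => [/= ->|k]; first exact/lin0/(lflow_gen HT).
elim: k => // k IH kw; apply: IH; set u := iter k d w.
have du : d (d u) = 0 by exact: kw.
rewrite iterS -/u.
have Tu t : T t u = u + t *: d u.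
  have := @lflow_ode _ _ _ _ (fun s => u + s *: d u) HT.
  rewrite scale0r addr0 => H; apply/esym; apply: H => s.
  rewrite (linD _ _ (lflow_gen HT)) (linZ _ _ (lflow_gen HT)) du scaler0 addr0.
  rewrite -[X in is_derive _ _ _ X]add0r; apply: is_deriveD.
  have := is_derive_scalev (d u) (is_derive_id s (1 : R)); rewrite scale1r; exact.
have [K K0 HK] := lin_bound (lin_iter k (lflow_gen HT)).
have Tk t : T t u = iter k d (T t w).
  rewrite /u; elim: k {kw u du Tu K K0 HK} => //= k IHk.
  by rewrite -(lflow_genC _ _ HT) IHk.
apply: contrapT => /eqP; rewrite -normr_gt0 => du0.
(* A time at which [t *: d u] has norm exactly one more than the bound allows. *)
pose t := (K * M + `|u| + 1) / `|d u|.
have M0 : 0 <= M by apply: le_trans (HM 0 (lexx _)).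
have t0 : 0 <= t by rewrite divr_ge0// !addr_ge0// mulr_ge0// ltW.
have : `|t *: d u| <= K * M + `|u|.
  have -> : t *: d u = T t u - u by rewrite Tu addrAC subrr add0r.
  apply: le_trans (ler_normB _ _) _; rewrite lerD2r Tk (le_trans (HK _))//.
  by rewrite ler_wpM2l ?HM// ltW.
rewrite normrZ ger0_norm// /t divfK ?gt_eqF//; lra.
Qed.

End Growth.

(** Induction on the order of nilpotency: the derivative grows at rate e/2, and the factor |t|
    produced by integration is at most (2/e) exp (e |t| / 2). Negative times follow by reversing the
    flow. *)
Lemma lflow_nil_growth {R : realType} {n : nat} (T : R -> 'rV[R]_n -> 'rV[R]_n) d
    (k : nat) (v : 'rV[R]_n) (e : R) : linear_flow T d -> iter k d v = 0 -> 0 < e ->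
  exists C, forall t, `|T t v| <= C * expR (e * `|t|).
Proof.
move=> H + e0; have [m] : {m | (k <= m)%N} by exists k.
elim: k v e e0 m => [|k IH] v e e0 m.
  by move=> _ /= ->; exists 0 => t; rewrite (lin0 (lflow_lin H t)) normr0 mul0r.
move=> _; rewrite iterSr => kv.
have e20 : 0 < e / 2 by rewrite divr_gt0.
have [C HC] := IH (d v) (e / 2) e20 k (leqnn k) kv.
have C0 : 0 <= C.
  by have := HC 0; rewrite normr0 mulr0 expR0 mulr1; apply: le_trans.
have key (S : R -> 'rV[R]_n -> 'rV[R]_n) g t : linear_flow S g -> 0 <= t ->
    (forall s, `|S s (g v)| <= C * expR (e / 2 * `|s|)) ->
    `|S t v| <= (`|v| + C * (2 / e)) * expR (e * `|t|).
  move=> HS t0 HSg; have E2 : expR (e * `|t|) = expR (e / 2 * `|t|) * expR (e / 2 * `|t|).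
    by rewrite -expRD; congr expR; field.
  have E1 : 1 <= expR (e / 2 * `|t|) by rewrite -[X in X <= _]expR0 ler_expR mulr_ge0 ?(ltW e20).
  have t1 : t <= 2 / e * expR (e / 2 * `|t|).
    have := expR_ge1Dx (e / 2 * t); rewrite ger0_norm// => Ht.
    have Et : t = 2 / e * (e / 2 * t) by field; rewrite gt_eqF.
    rewrite {1}Et; apply: ler_wpM2l; first by rewrite divr_ge0// ltW.
    lra.
  have := @lflow_diff_ge0 _ _ S g HS v t (C * expR (e / 2 * `|t|)) t0.
  rewrite mulr_ge0 ?expR_ge0// => /(_ isT) Hd.
  have Hd' : `|S t v - v| <= C * expR (e / 2 * `|t|) * t.
    apply: Hd => s s0 st; apply: le_trans (HSg s) _.
    rewrite ler_wpM2l// ler_expR ler_wpM2l ?(ltW e20)//.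
    by rewrite !ger0_norm.
  rewrite -[S t v](subrK v) (le_trans (ler_normD _ _))// mulrDl addrC lerD//.
    by rewrite ler_peMr// E2 mulr_ege1.
  apply: le_trans Hd' _; rewrite E2; move: (expR (e / 2 * `|t|)) E1 t1 => E E1 t1.
  have -> : C * (2 / e) * (E * E) = C * (E * (2 / e * E)) by ring.
  rewrite -mulrA; apply: ler_wpM2l => //; apply: ler_wpM2l => //.
  exact: le_trans E1.
exists (`|v| + C * (2 / e)) => t; case: (leP 0 t) => t0; first exact: (key _ _ _ H).
have := @key _ _ (- t) (lflow_rev H); rewrite opprK normrN; apply; first by rewrite oppr_ge0 ltW.
by move=> s; rewrite (linN _ (lflow_lin H _)) normrN -(normrN s).
Qed.

(** * The Jordan decomposition of the flow *)

Lemma dfe_dflow {R : realType} {n : nat} {G : lieGroupType R n} (X : linear_field G) (t : R)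
    (f : G -> R) (u : 'rV[R]_n) : smoothG f ->
  dfe f (dflow X t u) = dfe (f \o lf_flow X t) u.
Proof. by move=> fs; rewrite (tmapE u (smooth_endo_flow X t) fs). Qed.

Section Generators.
Context {R : realType} {n : nat} {G : lieGroupType R n}.
Local Notation V := 'rV[R]_n.
Hypothesis HR : forall Y : operator G, right_invariant Y -> exists v : V, Y = rinv v.

Lemma rinv_inj (v w : V) : rinv v = rinv w :> operator G -> v = w.
Proof.
by move=> E; apply: (@dfe_inj _ _ G) => f fs; rewrite -(rinv1 v fs) -(rinv1 w fs) E.
Qed.

Lemma rinv_sum (I : Type) (s : seq I) (a : I -> R) (v : I -> V) :
  (fun f x => \sum_(i <- s) a i * rinv (v i) f x) =
  rinv (\sum_(i <- s) a i *: v i) :> operator G.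
Proof.
elim: s => [|i s IH].
  rewrite big_nil -rinv_0; apply/funext => f; apply/funext => x; exact: big_nil.
rewrite big_cons -rinv_lin -IH; apply/funext => f; apply/funext => x; exact: big_cons.
Qed.

Lemma gen_ex (X : linear_field G) (v : V) : exists w : V, lf_der X (rinv v) = rinv w.
Proof. exact/HR/lf_der_right_invariant/right_invariant_rinv. Qed.

Definition gen (X : linear_field G) (v : V) : V := projT1 (cid (gen_ex X v)).

Lemma genE X v : lf_der X (rinv v) = rinv (gen X v).
Proof. by rewrite /gen; case: cid. Qed.

Lemma gen_lin X : lin (gen X).
Proof.
move=> a v w; apply: rinv_inj; rewrite -rinv_lin -!genE -rinv_lin.
by have [[_ H] _] := lf_derivation X; rewrite H//; exact: right_invariant_rinv.
Qed.

Lemma dflow_linear_flow X : linear_flow (dflow X) (gen X).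
Proof.
split.
- by move=> t a v w; exact: dflow_lin.
- exact: gen_lin.
- exact: dflow0.
- exact: dflowD.
- move=> t v; apply: is_derive_rV => i.
  have := flow_operator_derive X t (right_invariant_rinv v) (xc_smooth i).
  rewrite genE.
  have fs s : smoothG (fun x => xc i (lf_flow X s x)).
    exact: (smooth_endo_flow X s).2 (xc_smooth i).
  rewrite (rinv1 _ (fs t)) (tmapE (f := xc i) _ (smooth_endo_flow X t) (xc_smooth i)) dfe_xc.
  have -> : (fun s => rinv v (fun x => xc i (lf_flow X s x)) 1%g) = (fun s => dflow X s v 0 i).
    apply/funext => s.
    by rewrite (rinv1 _ (fs s)) (tmapE (f := xc i) _ (smooth_endo_flow X s) (xc_smooth i)) dfe_xc.
  exact.
Qed.

Lemma ReD (x y : R[i]) : complex.Re (x + y) = complex.Re x + complex.Re y.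
Proof. by case: x; case: y. Qed.
Lemma ImD (x y : R[i]) : complex.Im (x + y) = complex.Im x + complex.Im y.
Proof. by case: x; case: y. Qed.

Lemma Re_sum (I : Type) (s : seq I) (F : I -> R[i]) :
  complex.Re (\sum_(i <- s) F i) = \sum_(i <- s) complex.Re (F i).
Proof. by apply: (big_morph _ ReD). Qed.
Lemma Im_sum (I : Type) (s : seq I) (F : I -> R[i]) :
  complex.Im (\sum_(i <- s) F i) = \sum_(i <- s) complex.Im (F i).
Proof. by apply: (big_morph _ ImD). Qed.

(** Decompose the coordinate vector of [v] over complex eigenvectors; [x i] and [y i] are the real
    and imaginary parts of the components, and since [v] is real it is the sum of the real parts. *)
Lemma semisimple_decomposition (Q : R[i] -> Prop) X v : semisimple_with Q (lf_der X) ->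
  exists (k : nat) (x y : 'I_k -> V) (a b : 'I_k -> R),
    v = \sum_i x i /\ forall i, [/\ gen X (x i) = a i *: x i - b i *: y i,
      gen X (y i) = b i *: x i + a i *: y i & Q (a i +i* b i)%C].
Proof.
case=> k [bs [A [[rb ub] bA [P Pu Pd] ev]]].
set AC := map_mx _ A in Pd ev.
have /choice[beta bE] : forall i, exists w : V, bs i = rinv w by move=> i; exact: HR.
(* The diagonal form of [AC]: the rows of [P] are eigenvectors and the entries [M i i] their
   eigenvalues. *)
pose M := P *m AC *m invmx P.
have Mrow i j : (P *m AC) i j = M i i * P i j.
  have -> : P *m AC = M *m P by rewrite /M mulmxKV.
  rewrite mxE (bigD1 i)//= big1 ?addr0// => l li.
  have /diagonalizable_forP -> := Pd; rewrite ?mul0r//.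
  by rewrite eq_sym; move: li; apply: contra => /eqP e; apply/eqP/val_inj.
have Mev i : Q (M i i).
  apply: ev; apply/eigenvalueP; exists (row i P).
    by apply/rowP => j; rewrite -row_mul [LHS]mxE Mrow [RHS]mxE; congr (_ * _); rewrite mxE.
  apply/negP => /eqP r0; have := mulmxV Pu; move/matrixP/(_ i i).
  rewrite [LHS]mxE [RHS]mxE eqxx big1; first by move/eqP; rewrite eq_sym oner_eq0.
  by move=> j _; move/rowP: r0 => /(_ j); rewrite mxE => ->; rewrite mxE mul0r.
have [c [cE _]] := ub _ (right_invariant_rinv v).
pose cC : 'rV[R[i]]_k := map_mx (fun x => x%:C%C) c.
pose mu := cC *m invmx P.
pose z i j := mu 0 i * P i j.
have cz j : c 0 j = \sum_i complex.Re (z i j).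
  rewrite -Re_sum; have -> : \sum_i z i j = (mu *m P) 0 j by rewrite mxE.
  by rewrite /mu mulmxKV// mxE.
have zA i j : \sum_l z i l * (A l j)%:C%C = M i i * z i j.
  rewrite /z [RHS]mulrCA -Mrow; have -> : (P *m AC) i j = \sum_l P i l * AC l j by rewrite mxE.
  rewrite mulr_sumr.
  by apply: eq_bigr => l _; rewrite -mulrA; congr (_ * (_ * _)); rewrite mxE.
have gb l : gen X (beta l) = \sum_j A l j *: beta j.
  apply: rinv_inj; rewrite -genE -bE bA -rinv_sum.
  by apply/funext => f; apply/funext => x; apply: eq_bigr => j _; rewrite bE.
have gsum (u : 'I_k -> R) :
    gen X (\sum_l u l *: beta l) = \sum_j (\sum_l u l * A l j) *: beta j.
  rewrite (lin_sum _ _ (gen_lin X)) (eq_bigr (fun l => \sum_j (u l * A l j) *: beta j)).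
    by rewrite exchange_big; apply: eq_bigr => j _; rewrite scaler_suml.
  move=> l _; rewrite (linZ _ _ (gen_lin X)) gb scaler_sumr.
  by apply: eq_bigr => j _; rewrite scalerA.
exists k, (fun i => \sum_l complex.Re (z i l) *: beta l),
  (fun i => \sum_l complex.Im (z i l) *: beta l),
  (fun i => complex.Re (M i i)), (fun i => complex.Im (M i i)); split.
  apply: rinv_inj; rewrite cE exchange_big /=.
  rewrite (eq_bigr (fun j => c 0 j *: beta j)); last first.
    by move=> j _; rewrite -scaler_suml -cz.
  rewrite -rinv_sum; apply/funext => f; apply/funext => x.
  by apply: eq_bigr => j _; rewrite bE.
move=> i; split; last by case: (M i i) (Mev i).
- rewrite gsum !scaler_sumr -sumrB; apply: eq_bigr => j _.
  rewrite !scalerA -scalerBl; congr (_ *: _).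
  have -> : complex.Re (M i i) * complex.Re (z i j) - complex.Im (M i i) * complex.Im (z i j) =
      complex.Re (M i i * z i j) by case: (M i i); case: (z i j).
  rewrite -zA Re_sum; apply: eq_bigr => l _.
  by case: (z i l) => p q /=; rewrite mulr0 subr0.
- rewrite gsum !scaler_sumr -big_split; apply: eq_bigr => j _.
  rewrite /= !scalerA -scalerDl; congr (_ *: _).
  have -> : complex.Im (M i i) * complex.Re (z i j) + complex.Re (M i i) * complex.Im (z i j) =
      complex.Im (M i i * z i j).
    by case: (M i i) => p q; case: (z i j) => p' q' /=; rewrite addrC.
  rewrite -zA Im_sum; apply: eq_bigr => l _.
  by case: (z i l) => p q /=; rewrite mulr0 add0r.
Qed.

End Generators.

Local Opaque dflow gen kappa tmap.

(** * Elliptic, hyperbolic and nilpotent parts of the flow *)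

Section Jordan.
Context {R : realType} {n : nat} {G : lieGroupType R n}.
Local Notation V := 'rV[R]_n.
Hypothesis HR : forall Y : operator G, right_invariant Y -> exists v : V, Y = rinv v.
Variables (X : linear_field G) (J : jordan_decomposition X).
Local Notation E := (ell_part J).
Local Notation H := (hyp_part J).
Local Notation N := (nil_part J).
Local Notation gen := (gen HR).
Local Notation LX := (dflow_linear_flow HR X).
Local Notation LE := (dflow_linear_flow HR E).
Local Notation LH := (dflow_linear_flow HR H).
Local Notation LN := (dflow_linear_flow HR N).

Lemma gen_commute (Z Z' : linear_field G) : lie_commute (lf_der Z) (lf_der Z') ->
  forall v, gen Z (gen Z' v) = gen Z' (gen Z v).
Proof. by move=> C v; apply: (@rinv_inj _ _ G); rewrite -!genE C//; exact: right_invariant_rinv. Qed.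

Lemma genEH v : gen E (gen H v) = gen H (gen E v).
Proof. by apply: gen_commute; case: (parts_der_commute J). Qed.
Lemma genEN v : gen E (gen N v) = gen N (gen E v).
Proof. by apply: gen_commute; case: (parts_der_commute J). Qed.
Lemma genHN v : gen H (gen N v) = gen N (gen H v).
Proof. by apply: gen_commute; case: (parts_der_commute J). Qed.

Lemma genX v : gen X v = gen E v + (gen H v + gen N v).
Proof.
apply: (@rinv_inj _ _ G); rewrite -genE (parts_der_sum J) ?genE; last exact: right_invariant_rinv.
have L (u w : V) : (fun f x => rinv u f x + rinv w f x) = rinv (u + w) :> operator G.
  rewrite -[u in RHS]scale1r -rinv_lin; apply/funext => f; apply/funext => x.
  by rewrite mul1r.
by rewrite -!L; apply/funext => f; apply/funext => x; rewrite addrA.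
Qed.

Lemma genXH v : gen X (gen H v) = gen H (gen X v).
Proof.
have A := gen_lin HR H.
by rewrite !genX !(linD _ _ A) genEH genHN.
Qed.

Lemma jordan_flow t v : dflow X t v = dflow E t (dflow H t (dflow N t v)).
Proof.
have C u : gen E (gen H u + gen N u) = gen H (gen E u) + gen N (gen E u).
  by rewrite (linD _ _ (gen_lin HR E)) genEH genEN.
have C2 := lflow_comp LE (lflow_comp LH LN genHN) C.
have gE : gen X = fun v => gen E v + (gen H v + gen N v) by apply/funext => u; rewrite genX.
by have L := LX; rewrite gE in L; exact: (lflow_uniq L C2).
Qed.

Lemma dflow_commute (Z Z' : linear_field G) s t v :
  (forall u, gen Z (gen Z' u) = gen Z' (gen Z u)) ->
  dflow Z t (dflow Z' s v) = dflow Z' s (dflow Z t v).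
Proof.
move=> C; have L := dflow_linear_flow HR Z; have L' := dflow_linear_flow HR Z'.
apply/esym/(lflow_comm_lin t v L (lflow_lin L' s)) => u.
exact/esym/(lflow_comm_lin s u L' (gen_lin HR Z) C).
Qed.

Lemma flow_XH s t v : dflow X t (dflow H s v) = dflow H s (dflow X t v).
Proof. exact/dflow_commute/genXH. Qed.

Lemma flow_HN s t v : dflow N t (dflow H s v) = dflow H s (dflow N t v).
Proof. by apply: dflow_commute => u; exact/esym/genHN. Qed.

Lemma ell_bound : exists2 C : R, 0 < C & forall t v, `|dflow E t v| <= C * `|v|.
Proof.
have [|v|C C0 HC] := @lflow_uniform _ _ _ _ LE setT (fun=> 1).
- by [].
- have [k [x [y [a [b [-> Hxy]]]]]] := semisimple_decomposition HR v (ell_part_elliptic J).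
  exists (\sum_i (`|x i| + `|y i|)) => t _; rewrite mulr1.
  rewrite (lin_sum _ _ (lflow_lin LE t)) (le_trans (ler_norm_sum _ _ _))//.
  apply: ler_sum => i _; have [dx dy /= a0] := Hxy i.
  rewrite a0 scale0r add0r in dx; rewrite a0 scale0r addr0 in dy.
  rewrite (lflow_rotation LE t dx dy) (le_trans (ler_normB _ _))// lerD// normrZ ler_piMl//.
    by rewrite ler_norml cos_geN1 cos_le1.
  by rewrite ler_norml sin_geN1 sin_le1.
by exists C => // t v; rewrite -[C]mulr1 HC.
Qed.

Lemma nil_power : exists k, forall v, iter k (gen N) v = 0.
Proof.
have [k Hk] := nil_part_nilpotent J; exists k => v; apply: (@rinv_inj _ _ G).
rewrite -rinv_0 -(Hk _ (right_invariant_rinv v)).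
by elim: k {Hk} => //= k <-; rewrite genE.
Qed.

Lemma nil_bound e : 0 < e -> exists2 C : R, 0 < C &
  forall t v, `|dflow N t v| <= C * expR (e * `|t|) * `|v|.
Proof.
move=> e0; have [k Hk] := nil_power.
have [|v|C C0 HC] := @lflow_uniform _ _ _ _ LN setT (fun t => expR (e * `|t|)).
- by move=> t; exact: expR_ge0.
- by have [C HC] := lflow_nil_growth LN (Hk v) e0; exists C => t _.
by exists C => // t v; apply: HC.
Qed.

Lemma hyp_decomposition v : exists (k : nat) (x : 'I_k -> V) (a : 'I_k -> R),
  v = \sum_i x i /\ forall i, gen H (x i) = a i *: x i.
Proof.
have [k [x [y [a [b [-> Hxy]]]]]] := semisimple_decomposition HR v (hyp_part_hyperbolic J).
exists k, x, a; split=> // i; have [dx _ /= b0] := Hxy i.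
by rewrite dx b0 scale0r subr0.
Qed.

Lemma eigen_flow t x a : gen H x = a *: x ->
  dflow X t x = expR (a * t) *: dflow E t (dflow N t x).
Proof.
move=> Hx; rewrite jordan_flow -flow_HN (lflow_eigen LH t Hx).
by rewrite (linZ _ _ (lflow_lin LN t)) (linZ _ _ (lflow_lin LE t)).
Qed.

Lemma eigen_decay x a : gen H x = a *: x -> a < 0 ->
  exists C : R, forall t, 0 <= t -> `|dflow X t x| <= C * expR (a / 2 * t).
Proof.
move=> Hx a0; have [CE CE0 HE] := ell_bound.
have [|CN CN0 HN] := @nil_bound (- a / 2); first by rewrite divr_gt0// oppr_gt0.
exists (CE * CN * `|x|) => t t0; rewrite (eigen_flow t Hx) normrZ ger0_norm ?expR_ge0//.
rewrite (_ : expR (a / 2 * t) = expR (a * t) * expR (- a / 2 * t)); last first.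
  by rewrite -expRD; congr expR; field.
rewrite mulrCA ler_wpM2l ?expR_ge0// (le_trans (HE _ _))//.
have := HN t x; rewrite ger0_norm//; move: (expR (- a / 2 * t)) => q Hq.
have -> : CE * CN * `|x| * q = CE * (CN * q * `|x|) by ring.
by rewrite ler_wpM2l ?(ltW CE0).
Qed.

(** On [x] the flow is exp (a t) times an elliptic and a nilpotent factor. Undoing the latter two
    costs at most exp (a t / 4), and the assumed bound is used with the rate a/4; this leaves |x|
    below a constant times exp (- a t / 2). *)
Lemma eigen_growth x a : gen H x = a *: x -> 0 < a ->
  (forall e, 0 < e -> exists C : R, forall t, 0 <= t -> `|dflow X t x| <= C * expR (e * t)) ->
  x = 0.
Proof.
move=> Hx a0 Hb; have [CE CE0 HE] := ell_bound.
have a4 : 0 < a / 4 by rewrite divr_gt0.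
have [CN CN0 HN] := nil_bound a4; have [C HC] := Hb _ a4.
have key t : 0 <= t -> `|x| <= CN * CE * C * expR (- (a / 2) * t).
  move=> t0.
  have E1 : expR (a * t) *: x = dflow N (- t) (dflow E (- t) (dflow X t x)).
    rewrite (eigen_flow t Hx) (linZ _ _ (lflow_lin LE _)) (linZ _ _ (lflow_lin LN _)).
    by rewrite (lflowNK _ _ LE) (lflowNK _ _ LN).
  have : `|expR (a * t) *: x| <= CN * expR (a / 4 * t) * (CE * (C * expR (a / 4 * t))).
    rewrite E1; apply: le_trans (HN _ _) _; rewrite normrN ger0_norm// ler_wpM2l//.
      by rewrite mulr_ge0 ?expR_ge0 ?ltW.
    by apply: le_trans (HE _ _) _; rewrite ler_wpM2l ?HC ?(ltW CE0).
  rewrite normrZ ger0_norm ?expR_ge0// => Hn.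
  have E2 : expR (- (a / 2) * t) = expR (- (a * t)) * (expR (a / 4 * t) * expR (a / 4 * t)).
    by rewrite -!expRD; congr expR; field.
  rewrite E2; move: (expRxMexpNx_1 (a * t)) (expR_ge0 (- (a * t))) Hn.
  move: (expR (a * t)) (expR (- (a * t))) (expR (a / 4 * t)) => P p q PE p0 Hn.
  have -> : `|x| = p * (P * `|x|) by rewrite mulrA (mulrC p) PE mul1r.
  have -> : CN * CE * C * (p * (q * q)) = p * (CN * q * (CE * (C * q))) by ring.
  exact: ler_wpM2l.
apply/eqP; rewrite -normr_eq0 eq_le normr_ge0 andbT.
apply/ler_addgt0Pr => e e0; rewrite add0r.
set K := CN * CE * C in key.
have K0 : 0 <= K by apply: le_trans (_ : `|x| <= _) => //; have := key 0; rewrite mulr0 expR0 mulr1; apply.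
pose t := 2 / a * (K / e).
have t0 : 0 <= t by rewrite mulr_ge0// divr_ge0// ltW.
apply: le_trans (key t t0) _.
have -> : - (a / 2) * t = - (K / e) by rewrite /t; field; rewrite !gt_eqF.
rewrite expRN ler_pdivrMr ?expR_gt0//.
have := expR_ge1Dx (K / e) => He.
apply: (@le_trans _ _ (e * (1 + K / e))); last by rewrite ler_wpM2l// ltW.
by rewrite mulrDr mulr1 [e * _]mulrC divfK ?gt_eqF// lerDr ltW.
Qed.

Lemma bounded_nil w M : gen H w = 0 -> (forall t, 0 <= t -> `|dflow X t w| <= M) ->
  gen N w = 0.
Proof.
move=> Hw HM; have [CE CE0 HE] := ell_bound; have [k Hk] := nil_power.
have Hw' : gen H w = 0 *: w by rewrite scale0r.
apply: (lflow_nil_unbounded LN (Hk w) (M := CE * M)) => t t0.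
have -> : dflow N t w = dflow E (- t) (dflow X t w).
  by rewrite (eigen_flow t Hw') mul0r expR0 scale1r (lflowNK _ _ LE).
by apply: le_trans (HE _ _) _; rewrite ler_wpM2l ?HM// ltW.
Qed.

(** On the common kernel of the hyperbolic and nilpotent generators the flow is purely elliptic, and
    its inverse is bounded. *)
Lemma ell_lower : exists2 C : R, 0 < C &
  forall t w, gen H w = 0 -> gen N w = 0 -> `|w| <= C * `|dflow X t w|.
Proof.
have [CE CE0 HE] := ell_bound; exists CE => // t w Hw Nw.
have Hw' : gen H w = 0 *: w by rewrite scale0r.
have Nw' : gen N w = 0 *: w by rewrite scale0r.
rewrite (eigen_flow t Hw') (lflow_eigen LN t Nw') !mul0r !expR0 !scale1r.
by rewrite -{1}(lflowNK t w LE) HE.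
Qed.

(** * Projection along the contracting directions *)

Section NoGrowth.
Hypothesis Hneg : forall x a, 0 < a -> gen H x = a *: x -> x = 0.

Lemma expR_decay (a : R) : a < 0 -> expR (a * t) @[t --> +oo] --> (0 : R).
Proof.
move=> a0; apply/cvgrPdist_le => e e0; near=> t.
rewrite sub0r normrN ger0_norm ?expR_ge0//.
have -> : a * t = - (- a * t) by ring.
rewrite expRN -[leRHS]invrK lef_pV2 ?posrE ?invr_gt0 ?expR_gt0//.
apply: le_trans (expR_ge1Dx _).
have : e^-1 / - a <= t by near: t; apply: nbhs_pinfty_ge; exact: num_real.
by rewrite ler_pdivrMr ?oppr_gt0// mulrC => /le_trans; apply; rewrite lerDr.
Unshelve. all: by end_near. Qed.

Lemma cvg_bigsum (U I : Type) (F : set_system U) (s : seq I) (f : I -> U -> V) (l : I -> V) :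
  Filter F -> (forall i, f i @ F --> l i) ->
  (fun t => \sum_(i <- s) f i t) @ F --> \sum_(i <- s) l i.
Proof.
move=> FF Hf; elim: s => [|i s IH].
  by rewrite big_nil; under eq_fun do rewrite big_nil; exact: cvg_cst.
by rewrite big_cons; under eq_fun do rewrite big_cons; exact: cvgD.
Qed.

Lemma hyp_eigen_limit x a : gen H x = a *: x ->
  dflow H t x @[t --> +oo] --> (if a < 0 then 0 else x : V).
Proof.
move=> Hx; have -> : (fun t => dflow H t x) = (fun t => expR (a * t) *: x).
  by apply/funext => t; rewrite (lflow_eigen LH t Hx).
case: ltP => ai.
  suff : expR (a * t) *: x @[t --> +oo] --> (0 : R) *: x by rewrite scale0r.
  by apply: cvgZr_tmp; exact: expR_decay.
move: ai; rewrite le_eqVlt => /orP[/eqP <-|ai].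
  by under eq_fun do rewrite mul0r expR0 scale1r; exact: cvg_cst.
rewrite (Hneg ai Hx); under eq_fun do rewrite scaler0; exact: cvg_cst.
Qed.

Lemma hyp_limit v : exists w : V, dflow H t v @[t --> +oo] --> w.
Proof.
have [k [x [a [-> Hx]]]] := hyp_decomposition v.
exists (\sum_i (if a i < 0 then 0 else x i)).
have -> : (fun t => dflow H t (\sum_i x i)) = (fun t => \sum_i dflow H t (x i)).
  by apply/funext => t; rewrite (lin_sum _ _ (lflow_lin LH t)).
by apply: cvg_bigsum => i; exact: hyp_eigen_limit.
Qed.

(** In the absence of positive eigenvalues, this limit is the projection onto the kernel of the
    hyperbolic generator along its negative eigenspaces. *)
Definition hproj v : V := projT1 (cid (hyp_limit v)).

Lemma hproj_cvg v : dflow H t v @[t --> +oo] --> hproj v.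
Proof. by rewrite /hproj; case: cid. Qed.

Lemma hproj_uniq v (w : V) : dflow H t v @[t --> +oo] --> w -> w = hproj v.
Proof. by move=> Hw; exact: (cvg_unique (@norm_hausdorff _ _) Hw (@hproj_cvg v)). Qed.

Lemma hproj_lin : lin hproj.
Proof.
move=> a v w; apply/esym/hproj_uniq.
have -> : (fun t => dflow H t (a *: v + w)) = (fun t => a *: dflow H t v + dflow H t w).
  by apply/funext => t; rewrite (lflow_lin LH).
by apply: cvgD; [apply: cvgZl_tmp; exact: hproj_cvg|exact: hproj_cvg].
Qed.

Lemma hproj_fix s v : dflow H s (hproj v) = hproj v.
Proof.
apply: hproj_uniq.
have Hs : dflow H (t + s) v @[t --> +oo] --> hproj v.
  exact: (cvg_comp _ _ (cvg_addrr s) (@hproj_cvg v)).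
have : dflow H s (dflow H t v) @[t --> +oo] --> dflow H s (hproj v).
  exact: (lin_cvg _ (lflow_lin LH s) (@hproj_cvg v)).
have -> : (fun t => dflow H s (dflow H t v)) = (fun t => dflow H (t + s) v).
  by apply/funext => t; rewrite addrC dflowD.
by move=> Ht; have -> := cvg_unique (@norm_hausdorff _ _) Ht Hs; exact: hproj_cvg.
Qed.

Lemma hproj_idem v : hproj (hproj v) = hproj v.
Proof.
apply/esym/hproj_uniq; under eq_fun do rewrite hproj_fix; exact: cvg_cst.
Qed.

Lemma hproj_negative v : hproj v = 0 -> exists (k : nat) (x : 'I_k -> V) (a : 'I_k -> R),
  v = \sum_i x i /\ forall i, a i < 0 /\ gen H (x i) = a i *: x i.
Proof.
move=> v0; have [k [x [a [vE Hx]]]] := hyp_decomposition v.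
(* Components with nonnegative eigenvalue add up to [hproj v], which vanishes; they are replaced by
   0, with the dummy eigenvalue -1 to keep the index set. *)
exists k, (fun i => if a i < 0 then x i else 0), (fun i => if a i < 0 then a i else -1); split.
  apply/eqP; rewrite -subr_eq0 {1}vE -sumrB -[X in _ == X]v0 {1}vE (lin_sum _ _ hproj_lin).
  apply/eqP; apply: eq_bigr => i _; rewrite -(hproj_uniq (hyp_eigen_limit (Hx i))).
  by case: ifP => _; rewrite ?subrr ?subr0.
move=> i; case: ifP => ai //; split; first by rewrite ltrN10.
by rewrite scaler0 (lin0 (gen_lin HR H)).
Qed.

(** The kernel of [hproj] is spanned by the finitely many vectors
    [delta_mx 0 i - hproj (delta_mx 0 i)], so pointwise decay on them is uniform on the kernel.
    Stated for a general family [T], since both the drift and its hyperbolic part need it. *)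
Lemma uniform_decay (T : R -> V -> V) e : (forall t, lin (T t)) ->
  (forall x a, a < 0 -> gen H x = a *: x -> T t x @[t --> +oo] --> (0 : V)) -> 0 < e ->
  \forall t \near +oo, forall v, hproj v = 0 -> `|T t v| <= e * `|v|.
Proof.
move=> lT HT e0; pose f (i : 'I_n) : V := delta_mx 0 i - hproj (delta_mx 0 i).
have Pf i : hproj (f i) = 0 by rewrite (linB _ _ hproj_lin) hproj_idem subrr.
have Tf i : T t (f i) @[t --> +oo] --> (0 : V).
  have [k [x [a [-> Hx]]]] := hproj_negative (Pf i).
  have -> : (fun t => T t (\sum_i x i)) = (fun t => \sum_i T t (x i)).
    by apply/funext => t; rewrite (lin_sum _ _ (lT t)).
  suff : (fun t => \sum_i T t (x i)) @ +oo --> \sum_(i < k) (0 : V) by rewrite big1.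
  by apply: cvg_bigsum => j; have [aj xj] := Hx j; exact: HT aj xj.
have vf v : hproj v = 0 -> v = \sum_i v 0 i *: f i.
  move=> v0; rewrite /f; under eq_bigr do rewrite scalerBr.
  by rewrite sumrB -(lin_coord v hproj_lin) v0 subr0 -row_sum_delta.
have n1 : 0 < n.+1%:R :> R by [].
have near_f : \forall t \near +oo, forall i, `|T t (f i)| <= e / n.+1%:R.
  apply: filter_forall => i.
  have /cvgrPdist_le/(_ (e / n.+1%:R)) := Tf i; rewrite divr_gt0// => /(_ isT).
  by apply: filterS => t; rewrite sub0r normrN.
apply: filterS near_f => t Ht v v0; rewrite {1}(vf _ v0) (lin_sum _ _ (lT t)).
apply: le_trans (ler_norm_sum _ _ _) _.
apply: (@le_trans _ _ (\sum_(i < n) e / n.+1%:R * `|v|)).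
  apply: ler_sum => i _; rewrite (linZ _ _ (lT t)) normrZ mulrC ler_pM//.
  exact: norm_coord.
rewrite sumr_const card_ord -[_ *+ n]mulr_natl mulrA ler_wpM2r//.
rewrite mulrCA ler_piMr ?ltW//.
by rewrite ltr_pdivrMr// mul1r ltr_nat.
Qed.

Lemma decay_X e : 0 < e ->
  \forall t \near +oo, forall v, hproj v = 0 -> `|dflow X t v| <= e * `|v|.
Proof.
apply: uniform_decay; first exact: (lflow_lin LX).
move=> x a a0 Hx; have [C HC] := eigen_decay Hx a0.
have a20 : a / 2 < 0 by rewrite ltr_pdivrMr// mul0r.
have Hd : C * expR (a / 2 * t) @[t --> +oo] --> C * 0.
  by apply: cvgMl_tmp; exact: expR_decay.
rewrite mulr0 in Hd; apply/cvgrPdist_le => eps eps0.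
near=> t; rewrite sub0r normrN; apply: (@le_trans _ _ (C * expR (a / 2 * t))).
  by apply: HC; near: t; apply: nbhs_pinfty_ge; exact: num_real.
have : `|0 - C * expR (a / 2 * t)| <= eps by near: t; move/cvgrPdist_le: Hd; exact.
by rewrite sub0r normrN; apply: le_trans; exact: ler_norm.
Unshelve. all: by end_near. Qed.

Lemma decay_H e : 0 < e ->
  \forall t \near +oo, forall v, hproj v = 0 -> `|dflow H t v| <= e * `|v|.
Proof.
apply: uniform_decay; first exact: (lflow_lin LH).
by move=> x a a0 Hx; have := hyp_eigen_limit Hx; rewrite a0.
Qed.

End NoGrowth.
End Jordan.

(** * The projection onto the fixed points of the hyperbolic flow *)

Section Projection.
Context {R : realType} {n : nat} {G : lieGroupType R n}.
Local Notation V := 'rV[R]_n.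
Local Notation erad := (@erad R n G).
Local Notation gexp := (@gexp R n G).

Lemma gexp_nbhs e : 0 < e -> nbhs (1%g : G) (gexp @` [set v | `|v| <= e]).
Proof.
move=> e0; have r0 := @erad_gt0 R n G.
have e1 : 0 < Num.min e (erad / 2) by rewrite lt_min e0 divr_gt0.
apply: filterS (@ex_nbhs _ _ G _ e1) => _ [v /= ve <-]; exists v => /=.
  by apply: le_trans ve _; rewrite ge_min lexx.
apply: gexp_ex; apply: le_lt_trans ve _; rewrite gt_min; apply/orP; right.
by rewrite ltr_pdivrMr// ltr_pMr ?ltr1n.
Qed.

Lemma gexp_cont_small (v : V) : `|v| < erad -> {for v, continuous gexp}.
Proof.
move=> vr; apply: near_eq_continuous (ex_cont vr).
apply/nbhs_normP; exists (erad - `|v|); first by rewrite subr_gt0.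
move=> u uv; rewrite gexp_ex//.
by rewrite -(subrK v u) (le_lt_trans (ler_normD _ _))// -ltrBrDr.
Qed.

Lemma gexp_small (W : set G) : nbhs (1%g : G) W ->
  exists2 d : R, 0 < d & forall v, `|v| < d -> W (gexp v).
Proof.
move=> nW; have := @gexp_cont_small 0; rewrite normr0 erad_gt0 => /(_ isT).
move=> c0; have c1 : gexp @ (0 : V) --> (1%g : G) by have := c0; rewrite /prop_for /continuous_at (@gexp0 R n G).
have /nbhs_normP[d d0 Hd] := c1 _ nW.
by exists d => // v vd; apply: Hd; rewrite subr0.
Qed.

Lemma gexp_flow (X : linear_field G) t v : lf_flow X t (gexp v) = gexp (dflow X t v).
Proof. exact: (gexp_morph v (flowM X t) (smooth_endo_flow X t)). Qed.

Hypothesis cG : connected [set: G].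
Hypothesis HR : forall Y : operator G, right_invariant Y -> exists v : V, Y = rinv v.
Variables (X : linear_field G) (J : jordan_decomposition X).
Local Notation H := (hyp_part J).
Local Notation phi := (lf_flow X).
Local Notation phiH := (lf_flow H).

(** The differentials commute, so the flows do on exponentials. The points where they commute form a
    subgroup, which contains a neighbourhood of 1 and is thus everything. *)
Lemma flow_commute s t g : phi t (phiH s g) = phiH s (phi t g).
Proof.
pose A := [set g | forall s t, phi t (phiH s g) = phiH s (phi t g)].
suff -> : A g by [].
suff -> : A = setT by [].
apply: open_subgroup_full => //.
- apply: filterS (gexp_nbhs ltr01) => _ [v _ <-] s' t'.
  by rewrite !gexp_flow (flow_XH HR).
- by move=> x y Ax Ay s' t'; rewrite !flowM Ax Ay.
- by move=> x Ax s' t'; rewrite !flowV Ax.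
Qed.

Lemma G0_subgroup : is_subgroup (G0 J).
Proof.
split; first by move=> t; rewrite flow1.
by move=> x y Hx Hy t; rewrite flowM flowV Hx Hy.
Qed.

Lemma G0M x y : G0 J x -> G0 J y -> G0 J (x * y)%g.
Proof. by move=> Hx Hy t; rewrite flowM Hx Hy. Qed.

Lemma G0V x : G0 J x -> G0 J x^-1%g.
Proof. by move=> Hx t; rewrite flowV Hx. Qed.

Lemma G0_flow t x : G0 J x -> G0 J (phi t x).
Proof. by move=> Hx s; rewrite -flow_commute Hx. Qed.

Lemma closed_fixed (Z : linear_field G) : closed [set g | forall t, lf_flow Z t g = g].
Proof.
move=> x clx t; apply: (@hausdorffG _ _ G) => A B nA nB.
have nA' : nbhs x (lf_flow Z t @^-1` A) by exact: (flow_cont nA).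
have [y [Hy [/= Ay By]]] := clx _ (filterI nA' nB).
by exists y; split=> //; rewrite -(Hy t).
Qed.

Hypothesis Hneg : forall x a, 0 < a -> gen HR H x = a *: x -> x = 0.
Local Notation hproj := (hproj Hneg).

Lemma hproj_bound : exists2 C : R, 0 < C & forall v, `|hproj v| <= C * `|v|.
Proof. exact: lin_bound (hproj_lin Hneg). Qed.

Lemma small_ball : exists2 e : R, 0 < e < erad & forall v, `|v| <= e -> `|hproj v| < erad.
Proof.
have [C C0 HC] := hproj_bound; have r0 := @erad_gt0 R n G.
have D0 : 0 < 2 * (1 + C) by have := C0; lra.
exists (erad / (2 * (1 + C))).
  apply/andP; split; first exact: divr_gt0.
  by rewrite ltr_pdivrMr// ltr_pMr//; have := C0; lra.
move=> v vr; apply: le_lt_trans (HC v) _; apply: le_lt_trans (ler_wpM2l (ltW C0) vr) _.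
rewrite mulrA ltr_pdivrMr//.
by rewrite mulrC ltr_pM2l//; have := C0; lra.
Qed.

Lemma flow_gexp_limit v : `|hproj v| < erad -> phiH t (gexp v) @[t --> +oo] --> gexp (hproj v).
Proof.
move=> vr; have -> : (fun t => phiH t (gexp v)) = gexp \o (fun t => dflow H t v).
  by apply/funext => t; rewrite gexp_flow.
apply: continuous_cvg; [exact: gexp_cont_small|exact: hproj_cvg].
Qed.

(** The points with a limit form a subgroup, and near 1 the linear limit [hproj] passes through the
    exponential. *)
Lemma limit_ex g : exists p : G, phiH t g @[t --> +oo] --> p.
Proof.
pose A := [set g | exists p : G, phiH t g @[t --> +oo] --> p].
suff AT : A = setT by have : A g by rewrite AT.
apply: open_subgroup_full => //.
- have [e /andP[e0 _] He] := small_ball.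
  apply: filterS (gexp_nbhs e0) => _ [v /= ve <-].
  by exists (gexp (hproj v)); apply: flow_gexp_limit; exact: He.
- move=> x y [p Hp] [q Hq]; exists (p * q)%g.
  by under eq_fun do rewrite flowM; exact: mulg_cvg.
- by move=> x [p Hp]; exists (p^-1)%g; under eq_fun do rewrite flowV; exact: invg_cvg.
Qed.

Definition gproj g : G := projT1 (cid (limit_ex g)).

Lemma gproj_cvg g : phiH t g @[t --> +oo] --> gproj g.
Proof. by rewrite /gproj; case: cid. Qed.

Lemma gproj_uniq g (p : G) : phiH t g @[t --> +oo] --> p -> gproj g = p.
Proof. by move=> Hp; exact: (cvg_unique (@hausdorffG _ _ G) (@gproj_cvg g) Hp). Qed.

Lemma gprojM x y : gproj (x * y)%g = (gproj x * gproj y)%g.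
Proof.
by apply: gproj_uniq; under eq_fun do rewrite flowM; apply: mulg_cvg; exact: gproj_cvg.
Qed.

Lemma gprojV x : gproj x^-1%g = (gproj x)^-1%g.
Proof. by apply: gproj_uniq; under eq_fun do rewrite flowV; apply: invg_cvg; exact: gproj_cvg. Qed.

Lemma gproj_G0 x : G0 J x -> gproj x = x.
Proof. by move=> Hx; apply: gproj_uniq; under eq_fun do rewrite Hx; exact: cvg_cst. Qed.

Lemma gproj1 : gproj 1%g = 1%g.
Proof. by apply: gproj_G0 => t; rewrite flow1. Qed.

Lemma G0_gproj x : G0 J (gproj x).
Proof.
move=> s; apply/esym/gproj_uniq.
have Hs : phiH (t + s) x @[t --> +oo] --> gproj x.
  exact: (cvg_comp _ _ (cvg_addrr s) (@gproj_cvg x)).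
have E : (fun t => phiH s (phiH t x)) = (fun t => phiH (t + s) x).
  by apply/funext => t; rewrite addrC lf_flowD.
have Ht : phiH s (phiH t x) @[t --> +oo] --> phiH s (gproj x).
  by apply: continuous_cvg; [exact: flow_cont|exact: gproj_cvg].
rewrite E in Ht; rewrite (cvg_unique (@hausdorffG _ _ G) Ht Hs); exact: gproj_cvg.
Qed.

Lemma gproj_idem x : gproj (gproj x) = gproj x.
Proof. exact/gproj_G0/G0_gproj. Qed.

Lemma gproj_flow t x : gproj (phi t x) = phi t (gproj x).
Proof.
apply: gproj_uniq; under eq_fun do rewrite -flow_commute.
by apply: continuous_cvg; [exact: flow_cont|exact: gproj_cvg].
Qed.

Lemma gproj_gexp v : `|hproj v| < erad -> gproj (gexp v) = gexp (hproj v).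
Proof. by move=> vr; apply: gproj_uniq; exact: flow_gexp_limit. Qed.

(** Continuity at 1 is read from [hproj] through the exponential; the homomorphism property carries
    it to every point. *)
Lemma gproj_cont : continuous gproj.
Proof.
have c1 : gproj @ (1%g : G) --> (1%g : G).
  move=> U nU; have [d d0 Hd] := gexp_small nU.
  have [C C0 HC] := hproj_bound; have [e /andP[e0 _] He] := small_ball.
  have e1 : 0 < Num.min e (d / (2 * C)) by rewrite lt_min e0 divr_gt0// mulr_gt0.
  apply: filterS (gexp_nbhs e1) => _ [v /= ve <-].
  rewrite le_min in ve; move/andP: ve => [ve vd]; rewrite gproj_gexp ?He//.
  apply: Hd; apply: le_lt_trans (HC v) _; apply: le_lt_trans (ler_wpM2l (ltW C0) vd) _.
  rewrite mulrA ltr_pdivrMr ?mulr_gt0//.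
  by rewrite mulrC ltr_pM2l//; have := C0; lra.
move=> x; have cx : (fun y : G => x^-1 * y)%g @ x --> (1%g : G).
  rewrite -(mulVg x); apply: mulg_cvg; [exact: cvg_cst|exact: cvg_id].
have : (fun y => gproj x * gproj (x^-1 * y))%g @ x --> (gproj x * 1)%g.
  by apply: mulg_cvg; [exact: cvg_cst|exact: (cvg_comp _ _ cx c1)].
rewrite mulg1 (_ : (fun y => _) = gproj)//.
by apply/funext => y; rewrite -gprojM mulVKg.
Qed.

Lemma gproj_ker x : gproj (x * (gproj x)^-1)%g = 1%g.
Proof. by rewrite gprojM gprojV gproj_idem mulgV. Qed.

Lemma kernel_small : exists2 e : R, 0 < e & forall v, `|v| <= e ->
  gproj (gexp v) = 1%g -> hproj v = 0.
Proof.
have [e /andP[e0 er] He] := small_ball; exists e => // v ve.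
rewrite gproj_gexp ?He// gexp_ex ?He// -(ex0 (G := G)) => /ex_inj; apply.
  by rewrite ltW ?He.
by rewrite normr0 ltW ?erad_gt0.
Qed.

(** A small element of the kernel is the exponential of a vector killed by [hproj], so the linear
    decay transfers to the group, uniformly on [U]. *)
Lemma kernel_contraction : exists2 U : set G, nbhs (1%g : G) U & forall W, nbhs (1%g : G) W ->
  \forall t \near +oo, forall g, U g -> gproj g = 1%g -> W (phi t g) /\ W (phiH t g).
Proof.
have [e e0 He] := kernel_small; exists (gexp @` [set v | `|v| <= e]); first exact: gexp_nbhs.
move=> W nW; have [d d0 Hd] := gexp_small nW.
have d1 : 0 < d / (2 * e) by rewrite divr_gt0// mulr_gt0.
have nX := decay_X Hneg d1; have nH := decay_H Hneg d1.
apply: filterS2 nX nH => t HX HH _ [v /= ve <-] gv.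
have hv := He v ve gv; rewrite !gexp_flow.
have key (w : V) : `|w| <= d / (2 * e) * `|v| -> W (gexp w).
  move=> Hw; apply: Hd; apply: le_lt_trans Hw _.
  apply: le_lt_trans (ler_wpM2l (ltW d1) ve) _.
  by rewrite mulrAC ltr_pdivrMr ?mulr_gt0// ltr_pM2l//; have := e0; lra.
by split; apply: key; [exact: HX|exact: HH].
Qed.

End Projection.

(** * Reachable sets *)

Section Compactness.
Context {R : realType} {n : nat} {G : lieGroupType R n}.

Lemma compact_closedG (K : set G) : compact K -> closed K.
Proof. by apply: compact_closed; exact: hausdorffG. Qed.

Lemma compact_image2 (F : G -> G -> G) (A B : set G) :
  (forall p : G * G, (fun q : G * G => F q.1 q.2) @ p --> F p.1 p.2) ->
  compact A -> compact B -> compact [set F p.1 p.2 | p in A `*` B].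
Proof.
move=> Fc cA cB; apply: (@continuous_compact _ _ (fun p : G * G => F p.1 p.2)).
  by apply: continuous_subspaceT => p; exact: Fc.
exact: compact_setX.
Qed.

Lemma mul_compact (A B : set G) : compact A -> compact B ->
  compact [set (p.1 * p.2)%g | p in A `*` B].
Proof. by apply: (@compact_image2 (fun x y => x * y)%g) => p; exact: mulg_cont. Qed.

Lemma div_compact (A B : set G) : compact A -> compact B ->
  compact [set (p.1 * p.2^-1)%g | p in A `*` B].
Proof.
apply: (@compact_image2 (fun x y => x * y^-1)%g) => p.
by apply: mulg_cvg; [exact: cvg_fst|apply: invg_cvg; exact: cvg_snd].
Qed.

Lemma bounded_subset_le (A K : set G) : compact K -> A `<=` K -> bounded_subset A.
Proof.
move=> cK AK; have /closure_id KE := compact_closedG cK.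
apply: (subclosed_compact _ cK); first exact: closed_closure.
by rewrite KE; exact: closureS.
Qed.

Lemma cluster_seq (K : set G) (x : nat -> G) : compact K -> (forall k, K (x k)) ->
  exists2 p, K p & forall U, nbhs p U -> forall N, exists2 k, (N <= k)%N & U (x k).
Proof.
move=> cK Kx; have [|p [Kp clp]] := cK (x @ \oo) _.
  by exists 0%N => // k _; exact: Kx.
exists p => // U nU N.
have [] := clp (x @` [set k | (N <= k)%N]) U; last by move=> _ [[k /= Nk <-] Uk]; exists k.
  by exists N => // k /= Nk; exists k.
exact: nU.
Qed.

(** Two terms close to the same cluster point have a quotient close to 1. *)
Lemma recurrent_seq (K : set G) (x : nat -> G) (U : set G) : compact K ->
  (forall k, K (x k)) -> nbhs (1%g : G) U -> exists k l, (k < l)%N /\ U ((x k)^-1 * x l)%g.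
Proof.
move=> cK Kx nU; have [p Kp Hp] := cluster_seq cK Kx.
have c : (fun q : G * G => q.1^-1 * q.2)%g @ (p, p) --> (p^-1 * p)%g.
  by apply: mulg_cvg; [apply: invg_cvg; exact: cvg_fst|exact: cvg_snd].
rewrite mulVg in c; have [[A B] /= [nA nB] AB] := c _ nU.
have nAB : nbhs p (A `&` B) by exact: filterI.
have [k _ [Ak _]] := Hp _ nAB 0%N; have [l kl [_ Bl]] := Hp _ nAB k.+1.
by exists k, l; split=> //; exact: (AB (x k, x l) (conj Ak Bl)).
Qed.

End Compactness.

(** * Concatenated controls and reachability in bounded time *)

Section Reachability.
Context {R : realType} {n m : nat} {G : lieGroupType R n}.
Variable S : linear_control_system m G.
Local Notation X := (drift S).
Local Notation phi := (lf_flow (drift S)).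
Local Notation Om := (control_range S).
Local Notation traj := (trajectory S).

Lemma control_shift u s : controls S u -> controls S (fun t => u (s + t)).
Proof.
move=> [pu Ou]; split=> [a b|t]; last exact: Ou.
have F := finite_image (fun t => t - s) (pu (s + a) (s + b)).
apply: sub_finite_set F => t [/= sw]; rewrite in_itv /= => /andP[ta tb].
exists (s + t); last by rewrite addrAC subrr add0r.
split; last by rewrite /= in_itv /= !lerD2l ta.
move=> H; apply: sw.
have c : (fun r : R => s + r) @ t --> s + t by apply: cvgD; [exact: cvg_cst|exact: cvg_id].
exact: (c _ H).
Qed.

Definition concat (t : R) (u v : R -> 'rV[R]_m) (s : R) := if s < t then u s else v (s - t).

Lemma control_concat t u v : controls S u -> controls S v -> controls S (concat t u v).
Proof.
move=> cu cv; have [pw _] := control_shift (- t) cv.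
case: cu cv => [pu Ou] [_ Ov]; split=> [a b|s]; last by rewrite /concat; case: ifP.
have F : finite_set ((switching_times u `&` `[a, b] `|`
    switching_times (fun s => v (- t + s)) `&` `[a, b]) `|` [set t]).
  by rewrite !finite_setU; split; [split; [exact: pu|exact: pw]|exact: finite_set1].
apply: sub_finite_set F => s [sw ab].
case: (ltgtP s t) => st; last by right.
- left; left; split=> // H; apply: sw.
  have nt : \forall r \near s, r < t by exact: lt_nbhsl.
  by apply: filterS2 H nt => r Hr rt; rewrite /concat rt st.
- left; right; split=> // H; apply: sw.
  have nt : \forall r \near s, t < r by exact: lt_nbhsr.
  apply: filterS2 H nt => r Hr rt; rewrite /concat ltNge (ltW rt) ltNge (ltW st) /=.
  by rewrite addrC Hr addrC.
Qed.

Lemma cvec0 : cvec S 0 = 0.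
Proof. by rewrite /cvec big1// => i _; rewrite mxE scale0r. Qed.

Lemma trajectory_rest t : 0 <= t -> traj t 1%g (fun=> 0) = 1%g.
Proof.
move=> t0; have c0 := controls0 S.
have := @solution_uniq _ _ _ X (fun s => traj s 1%g (fun=> 0)) (fun=> 1%g) (fun=> 0) [::] t t0.
rewrite (trajectory0 1%g c0) invg1 mul1g flow1 mulg1 => H; apply/esym/H.
- exact: trajectory_cont.
- exact: cst_continuous.
- move=> s s0 st _; split.
    have ns : ~ switching_times (fun _ : R => 0 : 'rV[R]_m) s by rewrite switching_cst.
    by have := trajectory_vel 1%g c0 ns; rewrite cvec0.
  by rewrite kappa1 addr0; exact: vel_cst.
Qed.

Lemma trajectory_concat t T u v : 0 <= t -> 0 <= T -> controls S u -> controls S v ->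
  traj (t + T) 1%g (concat t u v) = (traj T 1%g v * phi T (traj t 1%g u))%g.
Proof.
move=> t0 T0 cu cv; have cc := control_concat t cu cv.
rewrite (@trajectory_shift _ _ _ _ S _ (concat t u v) v)//.
  congr (_ * phi _ _)%g; apply: trajectory_causal => // s s0 st.
  by rewrite /concat st.
by move=> s s0 _; rewrite /concat ltNge lerDl (ltW s0) /= addrAC subrr add0r.
Qed.

Lemma control_bound : exists2 M : R, 0 <= M & forall (u : R -> 'rV[R]_m), controls S u ->
  forall t i, `|u t 0 i| <= M.
Proof.
have [M [_ HM]] := compact_bounded (@control_range_compact _ _ _ _ S).
exists (`|M| + 1); first by rewrite addr_ge0.
move=> u [_ Ou] t i; apply: le_trans (norm_coord _ _) _; apply: HM; last exact: Ou.
by rewrite (le_lt_trans (ler_norm _))// ltrDl.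
Qed.

(** A bump function equal to 1 at the start cannot drop to 0 before time [e]. Compactness of the
    control range makes the bound [M] on its rate independent of the control. *)
Lemma reach_small : exists e (K : set G), [/\ 0 < e, compact K &
  forall u t, controls S u -> 0 <= t -> t <= e -> K (traj t 1%g u)].
Proof.
have [K [cK nK _]] := @nbhs1_compact _ _ G setT filterT.
have [f [fs f1 f0 fK]] := smoothG_bump nK.
have [MX MX0 HMX] := closed_bound cK (field_smooth X fs).
have /choice[MY HMY] : forall i, exists M : R, 0 <= M /\ forall x, K x -> `|control_field S i f x| <= M.
  move=> i; have [vY _] := control_field_right_invariant S i.
  by have [M M0 HM] := closed_bound cK (vf_smooth vY fs); exists M.
have [Mu Mu0 HMu] := control_bound.
pose M := MX + \sum_i Mu * MY i + 1.
have S0 : 0 <= \sum_i Mu * MY i by apply: sumr_ge0 => i _; rewrite mulr_ge0//; case: (HMY i).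
have M0 : 0 < M by rewrite ltr_wpDl// addr_ge0.
exists (2 * M)^-1, K; split=> //; first by rewrite invr_gt0 mulr_gt0.
move=> u t cu t0 tM; apply: (fK).
have /finite_seqP[s sE] := cu.1 0 t.
have [tc _ tv] := trajectoryP 1%g cu.
have := @speed_bound _ _ _ K f (fun t => traj t 1%g u) (fun t => lf_field X f (traj t 1%g u) +
  \sum_(i < m) u t 0 i * control_field S i f (traj t 1%g u)) s M 0 t (compact_closedG cK) fK
  (smoothG_continuous fs) tc t0 (ltW M0) _.
rewrite subr0 (trajectory0 1%g cu) f1 => H.
have {}H : `|f (traj t 1%g u) - 1| <= M * t.
  apply: H => r r0 rt rs; split.
    apply: tv => // sw; have : (switching_times u `&` `[0, t]) r.
      by split=> //; rewrite /= in_itv /= !ltW.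
    by rewrite sE /= (negbTE rs).
  move=> Kr; apply: le_trans (ler_normD _ _) _; rewrite /M -addrA lerD ?HMX//.
  rewrite ler_wpDr// (le_trans (ler_norm_sum _ _ _))//; apply: ler_sum => i _.
  by rewrite normrM ler_pM ?HMu//; case: (HMY i) => _; apply.
apply/eqP => f00; move: H; rewrite f00 sub0r normrN normr1 => H.
have : M * t <= M * (2 * M)^-1 by rewrite ler_wpM2l// ltW.
rewrite invfM mulrCA mulfV ?gt_eqF// mulr1 => H2.
by have := le_trans H H2; rewrite -[leLHS]invr1 lef_pV2 ?posrE// lern1.
Qed.

(** Induction on the number of steps of length [e]: a longer trajectory is a point of [K] times the
    flow over time [e] of a point already reached. *)
Lemma reach_compact T : exists2 K : set G, compact K &
  forall u t, controls S u -> 0 <= t -> t <= T -> K (traj t 1%g u).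
Proof.
have [e [K [e0 cK HK]]] := reach_small.
suff H k : exists2 K : set G, compact K &
    forall u t, controls S u -> 0 <= t -> t <= k%:R * e -> K (traj t 1%g u).
  have T0 : 0 <= `|T / e| by [].
  have [K' cK' HK'] := H (Num.bound `|T / e|); exists K' => // u t cu t0 tT.
  apply: HK' => //; apply: le_trans tT _; rewrite -ler_pdivrMr//.
  by apply: le_trans (ler_norm _) _; apply/ltW/archi_boundP.
elim: k => [|k [K' cK' HK']].
  by exists K => // u t cu t0; rewrite mul0r => te; apply: HK => //; apply: le_trans te (ltW e0).
pose C := [set phi p.1 p.2 | p in (`[0, e] : set R) `*` K'].
have cC : compact C.
  apply: (@continuous_compact _ _ (fun p : R * G => phi p.1 p.2)).
    by apply: continuous_subspaceT => p; apply: flow_cvg; [exact: cvg_fst|exact: cvg_snd].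
  by apply: compact_setX => //; exact: segment_compact.
exists (K `|` [set (p.1 * p.2)%g | p in K `*` C]); first by apply: compactU => //; exact: mul_compact.
move=> u t cu t0 tk; case: (leP t e) => te; first by left; exact: HK.
right; pose s := t - e; have s0 : 0 <= s by rewrite subr_ge0 ltW.
have tE : t = s + e by rewrite subrK.
have cs := control_shift s cu.
rewrite tE (@trajectory_shift _ _ _ _ S _ u (fun r => u (s + r)))// ?ltW//.
exists (traj e 1%g (fun r => u (s + r)), phi e (traj s 1%g u)) => //; split=> /=.
  by apply: HK => //; exact: ltW.
exists (e, traj s 1%g u) => //; split=> /=; first by rewrite in_itv /= lexx ltW.
by apply: HK' => //; rewrite lerBlDr -{2}[e]mul1r -mulrDl natr1.
Qed.

End Reachability.

(** * Bounded trajectories and bounded orbits *)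

Section BoundedOrbit.
Context {R : realType} {n m : nat} {G : lieGroupType R n}.
Variable S : linear_control_system m G.
Local Notation X := (drift S).
Local Notation phi := (lf_flow (drift S)).
Local Notation traj := (trajectory S).
Local Notation orbit := (positive_orbit S 1%g).

Lemma orbit_bounded_trajectories u : bounded_subset orbit -> controls S u ->
  bounded_subset [set traj t 1%g u | t in [set t | 0 <= t]].
Proof.
move=> bO cu; apply: (@bounded_subset_le _ _ _ _ (closure orbit `|` [set 1%g])).
  by apply: compactU => //; exact: compact_set1.
move=> _ [t /= t0 <-]; case: (eqVneq t 0) => [->|tn].
  by right; rewrite trajectory0.
by left; apply: subset_closure; exists t, u; split=> //; rewrite lt_neqAle eq_sym tn.
Qed.

Definition bounded_trajectories : Prop := forall u, controls S u ->
  bounded_subset [set traj t 1%g u | t in [set t | 0 <= t]].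

(** Switching the control off after [t0] yields a bounded trajectory, so the flow of the point [g0]
    stays in a compact set [C]. A continuation multiplies that flow on the left by a point [g] of
    the orbit, and the product leaves [Q] as soon as [g] is outside the compact set of quotients of
    [Q] by [C]. *)
Lemma unbounded_stage t0 u0 (Q : set G) : bounded_trajectories -> ~ bounded_subset orbit ->
  0 <= t0 -> controls S u0 -> compact Q ->
  exists t1 u1, [/\ t0 + 1 <= t1, controls S u1, forall s, s < t0 -> u1 s = u0 s &
    ~ Q (traj t1 1%g u1)].
Proof.
move=> Hb nb t00 cu0 cQ; set g0 := traj t0 1%g u0.
have c0 := controls0 S.
set C := closure [set traj t 1%g (concat t0 u0 (fun=> 0)) | t in [set t | 0 <= t]].
have cC : compact C by apply: Hb; exact: control_concat.
have HC T : 0 <= T -> C (phi T g0).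
  move=> T0; apply: subset_closure; exists (t0 + T); first exact: addr_ge0.
  by rewrite trajectory_concat// trajectory_rest// mul1g.
have [K cK HK] := @reach_compact _ _ _ _ S 1.
(* Adding the set [K] reachable within time 1 forces the new stage to last longer than 1, so the
   stages exhaust the time axis. *)
have cB : compact ([set (p.1 * p.2^-1)%g | p in Q `*` C] `|` K).
  by apply: compactU => //; exact: div_compact.
have [g [T [v [T0 cv gE]] ng]] : exists2 g, orbit g &
    ~ ([set (p.1 * p.2^-1)%g | p in Q `*` C] `|` K) g.
  apply: contrapT => H; apply: nb; apply: (bounded_subset_le cB) => g Og.
  by apply: contrapT => ng; apply: H; exists g.
have T1 : 1 < T.
  by case: ltP => // T1; case: ng; right; rewrite gE; apply: HK => //; exact: ltW.
exists (t0 + T), (concat t0 u0 v); split.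
- by rewrite lerD2l ltW.
- exact: control_concat.
- by move=> s st; rewrite /concat st.
- rewrite trajectory_concat ?(ltW T0)// -gE => Qg; case: ng; left.
  exists ((g * phi T g0)%g, phi T g0) => /=; last by rewrite mulgK.
  by split=> //=; apply: HC; exact: ltW.
Qed.

(** In place of an exhaustion by compact sets, each stage avoids the translates by a fixed compact
    neighbourhood [W] of all earlier end points. A bounded trajectory through these points would
    violate [recurrent_seq]. *)
Lemma trajectories_bounded_orbit : bounded_trajectories -> bounded_subset orbit.
Proof.
move=> Hb; apply: contrapT => nb.
have [W [cW nW _]] := @nbhs1_compact _ _ G setT filterT.
pose state : Type := (R * (R -> 'rV[R]_m) * set G)%type.
pose inv (x : state) := [/\ 0 <= x.1.1, controls S x.1.2 & compact x.2].
pose pos (x : state) := traj x.1.1 1%g x.1.2.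
pose step (x y : state) := [/\ x.1.1 + 1 <= y.1.1, (forall s, s < x.1.1 -> y.1.2 s = x.1.2 s),
  ~ x.2 (pos y) & y.2 = x.2 `|` [set (pos y * w)%g | w in W]].
have /choice[f Hf] : forall x, exists y, inv x -> inv y /\ step x y.
  move=> [[t u] Q]; case: (pselect (inv (t, u, Q))) => [[/= t0 cu cQ]|ni]; last first.
    by exists (t, u, Q).
  have [t1 [u1 [t1E cu1 uE nQ]]] := unbounded_stage Hb nb t0 cu cQ.
  exists (t1, u1, Q `|` [set (traj t1 1%g u1 * w)%g | w in W]) => _; split; split=> //=.
    by apply: le_trans t1E; rewrite addr_ge0.
  apply: compactU => //; apply: continuous_compact => //; apply: continuous_subspaceT => w.
  by apply: mulg_cvg; [exact: cvg_cst|exact: cvg_id].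
pose st k := iter k f (0, (fun=> 0), set0).
have Hst k : inv (st k).
  elim: k => [|k IH]; last by have [] := Hf _ IH.
  by split=> //=; [exact: controls0|exact: compact0].
have Hstep k : step (st k) (st k.+1) by have [] := Hf _ (Hst k).
pose tt k := (st k).1.1; pose uu k := (st k).1.2.
have ttS k : tt k + 1 <= tt k.+1 by have [] := Hstep k.
have tt_ge k : k%:R <= tt k.
  elim: k => // k IH; apply: le_trans (ttS k); by rewrite -natr1 lerD2r.
have tt_le k l : (k <= l)%N -> tt k <= tt l.
  move=> kl; rewrite -(subnK kl); elim: (l - k)%N => // j IH.
  by rewrite addSn; apply: le_trans IH _; apply: le_trans (ttS _); rewrite lerDl.
have uu_eq k l s : (k <= l)%N -> s < tt k -> uu l s = uu k s.
  move=> kl; rewrite -(subnK kl); elim: (l - k)%N => // j IH sk; rewrite addSn -IH//.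
  have [_ H _ _] := Hstep (j + k)%N; apply: H; apply: lt_le_trans sk _.
  by apply: tt_le; exact: leq_addl.
(* The k-th stage ends no earlier than time k, so stage [N s] already determines the final control
   at time [s]. *)
pose N (s : R) := Num.bound `|s|.
have HN s : s < tt (N s).
  by apply: lt_le_trans (tt_ge _); apply: le_lt_trans (ler_norm s) _; exact: archi_boundP.
pose ui s := uu (N s) s.
have uiE k s : s < tt k -> ui s = uu k s.
  move=> sk; case: (leqP k (N s)) => kN; first exact: uu_eq.
  by rewrite /ui (uu_eq _ _ _ (ltnW kN)).
have cui : controls S ui.
  split=> [a b|s]; last by have [_ [_ H] _] := Hst (N s); exact: H.
  have [_ [pM _] _] := Hst (N b); apply: sub_finite_set (pM a b) => t [sw ab]; split=> // H.
  apply: sw; have tM : t < tt (N b).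
    by move: ab; rewrite /= in_itv /= => /andP[_ tb]; exact: le_lt_trans tb (HN b).
  have nt : \forall r \near t, r < tt (N b) by exact: lt_nbhsl.
  by apply: filterS2 H nt => r Hr rt; rewrite !(uiE (N b)).
have posE k : traj (tt k) 1%g ui = pos (st k).
  have [t0 ck _] := Hst k; apply: trajectory_causal => // s _ sk.
  by rewrite (uiE k).
have [k [l [kl]]] := recurrent_seq (Hb _ cui)
  (fun k => @subset_closure _ _ _ (ex_intro2 _ _ (tt k.+1) (le_trans (ler0n _ _) (tt_ge k.+1)) erefl)) nW.
rewrite !posE => Wkl.
(* End point [l.+1] lies in the translate of [W] by end point [k.+1], a set forbidden from stage
   [k.+1] on, hence at stage [l]. *)
have [_ _ nQ _] := Hstep l; apply: nQ.
have sub i j : (i <= j)%N -> (st i).2 `<=` (st j).2.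
  move=> ij; rewrite -(subnK ij); elim: (j - i)%N => // p IH.
  by rewrite addSn; have [_ _ _ ->] := Hstep (p + i)%N => x /IH; left.
apply: (sub k.+1 l kl); have [_ _ _ ->] := Hstep k; right.
by exists ((pos (st k.+1))^-1 * pos (st l.+1))%g => //; rewrite mulVKg.
Qed.

End BoundedOrbit.

(** * From the structure of the group to bounded orbits *)

Section NoPositiveEigenvalue.
Context {R : realType} {n : nat} {G : lieGroupType R n}.
Local Notation V := 'rV[R]_n.
Local Notation gexp := (@gexp R n G).
Hypothesis HR : forall Y : operator G, right_invariant Y -> exists v : V, Y = rinv v.
Variables (X : linear_field G) (J : jordan_decomposition X).
Local Notation H := (hyp_part J).
Local Notation phiH := (lf_flow H).

Lemma Gminus_limit g : Gminus J g -> phiH t g @[t --> +oo] --> (1%g : G).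
Proof.
move=> [_ [k [lam [Z [HZ ->]]]] [c [ic c0 c1]]].
have /choice[z zE] : forall i, exists w : V, Z i = rinv w.
  by move=> i; apply: HR; case: (HZ i).
have zl i : gen HR H (z i) = lam i *: z i.
  apply: (@rinv_inj _ _ G); rewrite -genE -zE; case: (HZ i) => _ _ ->; rewrite zE.
  have := rinv_lin (G := G) (lam i) (z i) 0; rewrite addr0 => <-.
  by rewrite -rinv_0; apply/funext => f; apply/funext => x; rewrite addr0.
have YE : lincomb (fun=> 1) Z = rinv (\sum_i z i) :> operator G.
  have := rinv_sum (G := G) (index_enum 'I_k) (fun=> 1) z.
  under [in RHS]eq_bigr do rewrite scale1r; move=> <-.
  by apply/funext => f; apply/funext => x; apply: eq_bigr => i _; rewrite zE.
rewrite YE in ic; have := integral_curve_gexp ic c0 1; rewrite c1 scale1r => ->.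
have -> : (fun t => phiH t (gexp (\sum_i z i))) = gexp \o (fun t => \sum_i dflow H t (z i)).
  apply/funext => t; rewrite gexp_flow /=.
  by rewrite (lin_sum _ _ (lflow_lin (dflow_linear_flow HR H) t)).
have Hs : (fun t => \sum_i dflow H t (z i)) @ +oo --> (0 : V).
  suff : (fun t => \sum_i dflow H t (z i)) @ +oo --> \sum_(i < k) (0 : V) by rewrite big1.
  apply: cvg_bigsum => i.
  have -> : (fun t => dflow H t (z i)) = (fun t => expR (lam i * t) *: z i).
    by apply/funext => t; exact: (lflow_eigen (dflow_linear_flow HR H) t (zl i)).
  suff : expR (lam i * t) *: z i @[t --> +oo] --> (0 : R) *: z i by rewrite scale0r.
  by apply: cvgZr_tmp; apply: expR_decay; case: (HZ i).
suff : (gexp \o (fun t => \sum_i dflow H t (z i))) @ +oo --> gexp 0 by rewrite (@gexp0 R n G).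
apply: continuous_cvg; last exact: Hs.
by apply: gexp_cont_small; rewrite normr0 erad_gt0.
Qed.

(** Along an eigenvector [w] with positive eigenvalue the hyperbolic flow runs through
    [gexp (r *: w)] with r tending to infinity, and this has a limit p. Shifting r by s gives p = p
    [gexp (s *: w)], so the one-parameter group is trivial and its velocity [w] vanishes. *)
Lemma Gminus0_no_growth : [set: G] = Gminus0 J ->
  forall w a, 0 < a -> gen HR H w = a *: w -> w = 0.
Proof.
move=> GE w a a0 Hw.
have [p Hp] : exists p : G, phiH t (gexp w) @[t --> +oo] --> p.
  have [x [y [Gx Gy ->]]] : Gminus0 J (gexp w) by rewrite -GE.
  exists (1 * y)%g; have -> : (fun t => phiH t (x * y)%g) = (fun t => phiH t x * y)%g.
    by apply/funext => t; rewrite flowM (Gy t).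
  by apply: mulg_cvg; [exact: Gminus_limit|exact: cvg_cst].
have HpE t : phiH t (gexp w) = gexp (expR (a * t) *: w).
  by rewrite gexp_flow (lflow_eigen (dflow_linear_flow HR H) t Hw).
have Hr : gexp (r *: w) @[r --> +oo] --> p.
  move=> U nU; have [t0 [t0r Ht0]] := Hp _ nU.
  exists (expR (a * t0)); split; first exact: num_real.
  move=> r rt; have r0 : 0 < r by exact: lt_trans (expR_gt0 _) rt.
  have := Ht0 (ln r / a); rewrite /= HpE (mulrC a) divfK ?gt_eqF// lnK ?posrE//; apply.
  by rewrite ltr_pdivlMr// mulrC -(expRK (a * t0)) ltr_ln ?posrE ?expR_gt0.
have F1 s : gexp (s *: w) = 1%g.
  have A : gexp ((r + s) *: w) @[r --> +oo] --> p := cvg_comp _ _ (cvg_addrr s) Hr.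
  have B : (gexp (r *: w)%R * gexp (s *: w)%R)%g @[r --> +oo] --> (p * gexp (s *: w)%R)%g.
    by apply: mulg_cvg; [exact: Hr|exact: cvg_cst].
  have E : (fun r => gexp (r *: w)%R * gexp (s *: w)%R)%g = (fun r => gexp ((r + s) *: w)).
    by apply/funext => r; rewrite gexpD.
  rewrite E in B; have pE : p = (p * gexp (s *: w))%g by exact: (cvg_unique (@hausdorffG _ _ G) A B).
  by apply: (mulgI p); rewrite mulg1 -pE.
apply: (@vel_uniq _ _ G _ _ _ (vel_gexp w)).
by apply: vel_ext (@vel_cst _ _ G) => t; rewrite F1.
Qed.

End NoPositiveEigenvalue.

(** * An absorbing set for the reachable sets *)

Section Contraction.
Context {R : realType} {n m : nat} {G : lieGroupType R n}.
Local Notation V := 'rV[R]_n.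
Variable S : linear_control_system m G.
Local Notation X := (drift S).
Local Notation phi := (lf_flow (drift S)).
Local Notation traj := (trajectory S).
Hypothesis cG : connected [set: G].
Hypothesis HR : forall Y : operator G, right_invariant Y -> exists v : V, Y = rinv v.
Variable J : jordan_decomposition X.
Local Notation H := (hyp_part J).
Local Notation phiH := (lf_flow H).
Hypothesis Hneg : forall x a, 0 < a -> gen HR H x = a *: x -> x = 0.
Hypothesis cG0 : compact (G0 J).
Local Notation gproj := (gproj cG Hneg).

(** The tube lemma along the compact group G^0, at whose points conjugation fixes 1. *)
Lemma conj_tube (U : set G) : nbhs (1%g : G) U ->
  exists2 W, nbhs (1%g : G) W & forall w k, W w -> G0 J k -> U (k * w * k^-1)%g.
Proof.
move=> nU; have nc := (compact_near_coveringP (G0 J)).1 cG0.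
have := nc G (nbhs (1%g : G)) (fun w k => U (k * w * k^-1)%g) _; move=> Hc.
have {}Hc : \forall w \near (1%g : G), G0 J `<=` (fun k => U (k * w * k^-1)%g).
  apply: Hc => k _.
  have c : (fun p : G * G => p.1 * p.2 * p.1^-1)%g @ (k, 1%g : G) --> (k * 1 * k^-1)%g.
    apply: mulg_cvg; last by apply: invg_cvg; exact: cvg_fst.
    by apply: mulg_cvg; [exact: cvg_fst|exact: cvg_snd].
  by rewrite mulg1 mulgV in c; exact: (c _ nU).
by exists [set w | G0 J `<=` (fun k => U (k * w * k^-1)%g)] => // w k Ww /Ww.
Qed.

Lemma gproj_flowH s g : gproj (phiH s g) = gproj g.
Proof.
apply: gproj_uniq; have -> : (fun t => phiH t (phiH s g)) = (fun t => phiH (t + s) g).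
  by apply/funext => t; rewrite lf_flowD.
exact: (cvg_comp _ _ (cvg_addrr s) (@gproj_cvg _ _ _ cG HR _ J Hneg g)).
Qed.

(** A trajectory over one time step is a kernel element times an element of G^0. Composing steps
    places the flow of the earlier point on the right, where contraction over time [T] brings a
    product of two kernel factors back to one; hence two factors and one element of the compact G^0
    suffice for all times. *)
Lemma no_growth_bounded_orbit : bounded_subset (positive_orbit S 1%g).
Proof.
have [U1 nU1 HU1] := kernel_contraction cG Hneg.
have [Uc [cUc nUc UcU1]] : exists Uc : set G, [/\ compact Uc, nbhs (1%g : G) Uc &
    forall x y, Uc x -> Uc y -> U1 (x * y)%g].
  have c : (fun p : G * G => p.1 * p.2)%g @ (1%g : G, 1%g : G) --> (1 * 1)%g.
    by apply: mulg_cvg; [exact: cvg_fst|exact: cvg_snd].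
  rewrite mulg1 in c; have [[A B] /= [nA nB] AB] := c _ nU1.
  have nAB : nbhs (1%g : G) (A `&` B) by exact: filterI.
  have [K [cK nK KAB]] := nbhs1_compact nAB; exists K; split=> // x y Kx Ky.
  by apply: (AB (x, y)); split; [case: (KAB _ Kx)|case: (KAB _ Ky)].
have [W nW HW] := conj_tube nUc.
(* Asking all conjugates by G^0 to stay in [Uc] makes [Om] invariant under conjugation, which [W]
   itself need not be. *)
pose Om : set G := [set g | gproj g = 1%g /\ forall k, G0 J k -> Uc (k * g * k^-1)%g].
have OmW g : gproj g = 1%g -> W g -> Om g.
  by move=> g1 Wg; split=> // k Hk; exact: HW.
have OmJ g k : Om g -> G0 J k -> Om (k * g * k^-1)%g.
  move=> [g1 Hg] Hk; split=> [|k' Hk'].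
    by rewrite !gprojM gprojV g1 mulg1 mulgV.
  have := Hg _ (G0M Hk' Hk); by rewrite invgM !mulgA.
have OmU g : Om g -> Uc g.
  by move=> [_ /(_ 1%g)]; rewrite invg1 mul1g mulg1; apply; case: (G0_subgroup J).
(* Products of two elements of [Om] lie in [U1] by the choice of [Uc]. They are contracted into [W],
   because kernel elements of [W] belong to [Om]. *)
have [T [T0 HT]] : exists T, 0 < T /\ forall g h, Om g -> Om h -> Om (phi T (g * h)%g).
  have nT := HU1 W nW; have n0 : \forall t \near +oo, (0 : R) < t.
    by apply: nbhs_pinfty_gt; exact: num_real.
  have [T [HT T0]] := filter_ex (filterI nT n0); exists T; split=> // g h Og Oh.
  have gh1 : gproj (g * h)%g = 1%g by rewrite gprojM (proj1 Og) (proj1 Oh) mulg1.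
  apply: OmW; first by rewrite gproj_flow gh1 flow1.
  by apply: (HT _ _ gh1).1; apply: UcU1; exact: OmU.
have [K cK HK] := @reach_compact _ _ _ _ S T.
pose nu (x : G) : G := (x * (gproj x)^-1)%g.
have nuc : continuous nu.
  by move=> x; apply: mulg_cvg; [exact: cvg_id|apply: invg_cvg; exact: gproj_cont].
have cC : compact (nu @` K) by apply: continuous_compact => //; exact: continuous_subspaceT.
(* Each point of this compact part of the kernel is moved into [U1] at some time [s0], together with
   its neighbours, and from there contraction leads into [W]. Compactness yields a common [s]. *)
have [s Hs] : exists s, forall c, (nu @` K) c -> Om (phiH s c).
  have nc := (compact_near_coveringP (nu @` K)).1 cC.
  have Hc : \forall s \near +oo, (nu @` K) `<=` (fun c => gproj c = 1%g -> W (phiH s c)).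
    apply: (nc R (+oo) (fun s c => gproj c = 1%g -> W (phiH s c))) => c [x Kx cE].
    have c1 : gproj c = 1%g by rewrite -cE; exact: gproj_ker.
    have lc : phiH t c @[t --> +oo] --> (1%g : G) by rewrite -c1; exact: gproj_cvg.
    have [s0 Hs0] : exists s0, nbhs (phiH s0 c) U1.
      have nU1' : nbhs (1%g : G) (interior U1) by exact: nbhs_interior.
      have ne : \forall t \near +oo, interior U1 (phiH t c) by exact: (lc _ nU1').
      by have [s0 Hs0] := filter_ex ne; exists s0.
    have nc0 : nbhs c (phiH s0 @^-1` U1) by exact: (flow_cont Hs0).
    have nt : \forall t \near +oo, forall g, U1 g -> gproj g = 1%g -> W (phiH (t - s0) g).
      have Ht : \forall t \near +oo, forall g, U1 g -> gproj g = 1%g ->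
          W (phi (t - s0) g) /\ W (phiH (t - s0) g).
        exact: (cvg_addrr (- s0) (HU1 W nW)).
      by apply: filterS Ht => t Ht g Ug g1; case: (Ht g Ug g1).
    exists ((phiH s0 @^-1` U1), [set t | forall g, U1 g -> gproj g = 1%g -> W (phiH (t - s0) g)]) => //=.
    move=> [c' t] /= [Uc' Ht] c'1.
    rewrite -(subrK s0 t) lf_flowD; apply: Ht => //.
    by rewrite gproj_flowH.
  have [s Hs] := filter_ex Hc; exists s => c Kc.
  have c1 : gproj c = 1%g by case: Kc => x _ <-; exact: gproj_ker.
  by apply: OmW; [rewrite gproj_flowH|exact: Hs].
(* The factor [g] comes from the last time step and [h] from the contracted past. *)
pose B : set G := [set x | exists g h k, [/\ Om (phiH s g), Om (phiH s h), G0 J k &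
  x = (g * h * k)%g]].
have Om1 : Om (phiH s 1%g).
  have [K0 _] := G0_subgroup J; rewrite flow1; split; first exact: gproj1.
  by move=> k _; rewrite mulg1 mulgV; exact: nbhs_singleton.
have decomp u t : controls S u -> 0 <= t -> t <= T ->
    exists g k, [/\ Om (phiH s g), G0 J k & traj t 1%g u = (g * k)%g].
  move=> cu t0 tT; set x := traj t 1%g u; exists (nu x), (gproj x); split.
  - by apply: Hs; exists x => //; exact: HK.
  - exact: G0_gproj.
  - by rewrite /nu mulgVK.
have cphi : compact (phiH (- s) @` Uc).
  by apply: continuous_compact => //; apply: continuous_subspaceT; exact: flow_cont.
pose Kb := [set (p.1 * p.2)%g | p in
  [set (p.1 * p.2)%g | p in (phiH (- s) @` Uc) `*` (phiH (- s) @` Uc)] `*` G0 J].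
have cKb : compact Kb by apply: mul_compact => //; exact: mul_compact.
apply: (bounded_subset_le cKb).
have BK : B `<=` Kb.
  move=> _ [g [h [k [Og Oh Hk ->]]]]; exists ((g * h)%g, k) => //; split=> //=.
  exists (g, h) => //; split=> /=.
    by exists (phiH s g); [exact: OmU|rewrite flowK].
  by exists (phiH s h); [exact: OmU|rewrite flowK].
suff key j u t : controls S u -> 0 <= t -> t <= j.+1%:R * T -> B (traj t 1%g u).
  move=> _ [t [u [t0 cu ->]]]; apply: BK; apply: (key (Num.bound `|t / T|)) => //.
    exact: ltW.
  rewrite -ler_pdivrMr//; apply: le_trans (ler_norm _) _.
  by apply: ltW; apply: lt_le_trans (archi_boundP _) _; rewrite ?ler_nat.
elim: j u t => [|j IH] u t cu t0.
  rewrite mul1r => tT; have [g [k [Og Hk ->]]] := decomp u t cu t0 tT.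
  by exists g, 1%g, k; split=> //; rewrite mulg1.
move=> tj; case: (leP t T) => tT.
  have [g [k [Og Hk ->]]] := decomp u t cu t0 tT.
  by exists g, 1%g, k; split=> //; rewrite mulg1.
pose r := t - T; have r0 : 0 <= r by rewrite subr_ge0 ltW.
have tE : t = r + T by rewrite subrK.
have cs := control_shift r cu.
rewrite tE (@trajectory_shift _ _ _ _ S _ u (fun q => u (r + q)))// ?ltW//.
have [g [k [Og Hk ->]]] := decomp _ T cs (ltW T0) (lexx T).
have [|g' [h' [k' [Og' Oh' Hk' ->]]]] := IH u r cu r0.
  by rewrite lerBlDr -{2}[T]mul1r -mulrDl natr1.
(* Moving [k] to the right conjugates the contracted past, which [Om] tolerates. The contraction
   also holds after enlarging by [phiH], since that flow commutes with [phi]. *)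
rewrite flowM; exists g, (k * phi T (g' * h') * k^-1)%g, (k * phi T k')%g; split=> //.
- rewrite !flowM Hk -flow_commute// flowV Hk; apply: OmJ => //.
  have := HT _ _ Og' Oh'; rewrite -flowM flow_commute//; by rewrite -!flow_commute// -!flowM.
- by apply: G0M => //; exact: G0_flow.
- by rewrite !mulgA mulgVK.
Qed.

End Contraction.

(** * From bounded orbits to the structure of the group *)

Section KappaDerivative.
Context {R : realType} {n : nat} {G : lieGroupType R n}.
Local Notation V := 'rV[R]_n.
Local Notation erad := (@erad R n G).
Local Notation ex := (@ex R n G).
Local Notation lcoord := (@lcoord R n G).
Local Notation mC := (@mC R n G).
Local Notation mr := (@mr R n G).
Hypothesis HR : forall Y : operator G, right_invariant Y -> exists v : V, Y = rinv v.
Variable X : linear_field G.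
Local Notation phi := (lf_flow X).
Local Notation kappa := (kappa X).
Local Notation delta := (gen HR X).
Local Notation LX := (dflow_linear_flow HR X).

Lemma lcoord_ex_bound (v : V) : `|v| <= erad ->
  `|lcoord (ex v)| <= 2 * `|v| /\ `|v| <= 2 * `|lcoord (ex v)|.
Proof.
move=> vr; have r0 := @erad_gt0 R n G.
have := @ex_half R n G v 0 vr; rewrite normr0 (ltW r0) => /(_ isT).
rewrite ex0 lcoord1 !subr0 => H.
have H1 : `|lcoord (ex v)| <= `|lcoord (ex v) - v| + `|v|.
  by rewrite -{1}(subrK v (lcoord (ex v))) ler_normD.
have H2 : `|v| <= `|lcoord (ex v) - v| + `|lcoord (ex v)|.
  by have := ler_normB (lcoord (ex v)) (lcoord (ex v) - v); rewrite subKr addrC.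
have := normr_ge0 v; split; lra.
Qed.

(** [kappa (ex w)] is the velocity of the product of [ex (dflow X s w)] and [ex (- w)]. In
    coordinates this product is [dflow X s w - w] up to a relative error of order |w|, and dividing
    by s gives the estimate. *)
Lemma kappa_ex_estimate : exists C r : R, [/\ 0 <= C, 0 < r, r <= erad &
  forall w : V, `|w| <= r -> `|kappa (ex w) - delta w| <= C * `|w| * `|delta w|].
Proof.
have [C0 mr0 mrl Hm] := @mCr R n G; have r0 := @erad_gt0 R n G.
have d4 : 0 < Num.min (erad / 4) (mr / 4) by rewrite lt_min; apply/andP; split; exact: divr_gt0.
(* 14 is 6 + 8: the product estimate at radius [4 * |w|] contributes 4 times 3/2, the strict
   estimate of [ex] at radius [2 * |w|] contributes 4 times 2. *)
exists (14 * mC), (Num.min (erad / 4) (mr / 4)); split=> //.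
- by rewrite mulr_ge0// ltW.
- by rewrite ge_min; apply/orP; left; rewrite ler_pdivrMr//; have := r0; lra.
move=> w; rewrite le_min => /andP[wr wm].
have [->|w0] := eqVneq w 0.
  by rewrite ex0 kappa1 (lin0 (gen_lin HR X)) subrr !normr0 mulr0.
have nw : 0 < `|w| by rewrite normr_gt0.
have w2 : 2 * `|w| <= erad / 2 by move: wr; have := r0; lra.
have wer : `|w| < erad by move: wr; have := r0; have := nw; lra.
pose L s := lcoord (phi s (ex w) * (ex w)^-1)%g.
pose a s := dflow X s w.
have LE : \forall s \near (0 : R), `|L s - (a s - w)| <= 14 * mC * `|w| * `|a s - w|.
  have na : \forall s \near (0 : R), `|a s| <= 2 * `|w|.
    have /is_derive_leP/(_ _ ltr01) Hd := lflow_derive LX 0 w.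
    have D0 : 0 < `|w| / (`|delta w| + 1) by rewrite divr_gt0// ltr_wpDl.
    near=> s.
    have Hs : `|dflow X (0 + s) w - dflow X 0 w - s *: dflow X 0 (delta w)| <= 1 * `|s| by near: s.
    rewrite add0r !dflow0 in Hs.
    have s1 : `|s| <= `|w| / (`|delta w| + 1).
      near: s; exact: (@nbhs0_ler R R _ D0).
    rewrite ler_pdivlMr ?ltr_wpDl// in s1.
    have := ler_normD (a s - w - s *: delta w) (w + s *: delta w).
    rewrite (addrC w) addrA subrK subrK => /le_trans; apply.
    have := ler_normD (s *: delta w) w; rewrite normrZ => H2.
    by move: Hs s1; rewrite /a mul1r mulrDr mulr1 => Hs s1; lra.
  apply: filterS na => s Hs.
  have ar : `|a s| < erad by move: Hs w2; have := r0; lra.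
  have Nw : `|- w| <= erad by rewrite normrN ltW.
  have LsE : L s = lmul (G := G) (lcoord (ex (a s)), lcoord (ex (- w))).
    rewrite /L (ex_morph (flowM X s) (smooth_endo_flow X s) wer)// -ex_opp//.
    by rewrite !lcoord_ex// ltW.
  have L0E : lmul (G := G) (lcoord (ex w), lcoord (ex (- w))) = 0.
    rewrite !lcoord_ex// ?(ltW wer)// -(lcoord1 G) -(mulgV (ex w)) -ex_opp//.
  have [xs1 _] := lcoord_ex_bound (ltW ar).
  have [xw1 _] := lcoord_ex_bound (ltW wer).
  have [y1 _] := lcoord_ex_bound Nw; rewrite normrN in y1.
  have w4 : 4 * `|w| <= mr by move: wm; lra.
  have [||||_] := Hm (lcoord (ex (a s))) (lcoord (ex (- w))) (lcoord (ex w)) (lcoord (ex (- w)))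
    (4 * `|w|) w4.
  - by move: xs1 Hs; lra.
  - by move: y1 nw; lra.
  - by move: xw1 nw; lra.
  - by move: y1 nw; lra.
  rewrite -LsE L0E subr0 !subrr normr0 !addr0 => E1.
  have E2 := ex_half (ltW ar) (ltW wer).
  have wr2 : 2 * `|w| <= erad by move: w2 nw; have := r0; lra.
  have E3 : `|lcoord (ex (a s)) - lcoord (ex w) - (a s - w)| <= 4 * mC * (2 * `|w|) * `|a s - w|.
    by apply: ex_strict => //; move: nw; lra.
  move: E1 E2 E3; set x := lcoord (ex (a s)) - lcoord (ex w); set q := a s - w => E1 E2 E3.
  have E4 : `|x| <= 3 / 2 * `|q|.
    have := ler_normD (x - q) q; rewrite subrK; lra.
  have E5 : mC * (4 * `|w|) * `|x| <= mC * (4 * `|w|) * (3 / 2 * `|q|).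
    by apply: ler_wpM2l => //; rewrite mulr_ge0// ?ltW// mulr_gt0.
  have := ler_normD (L s - x) (x - q); rewrite subrKA => /le_trans; apply.
  apply: le_trans (lerD (le_trans E1 E5) E3) _; rewrite le_eqVlt; apply/orP; left.
  by apply/eqP; field.
have [_ _ /is_derive_leP dL] := kappaP X (ex w).
have /is_derive_leP da := lflow_derive LX 0 w.
apply/ler_addgt0Pr => e e0; set k := kappa (ex w).
pose c := 14 * mC * `|w|.
have c0 : 0 <= c by rewrite !mulr_ge0// ltW.
pose e1 := e / (2 + c).
have e10 : 0 < e1 by rewrite divr_gt0// ltr_wpDr.
have [s [s0 [Hs1 Hs2 Hs3]]] : exists s : R, 0 < s /\
    [/\ `|L s - s *: k| <= e1 * s, `|a s - w - s *: delta w| <= e1 * s &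
        `|L s - (a s - w)| <= c * `|a s - w|].
  have /nbhs_normP[r1 r10 H1] := dL _ e10; have /nbhs_normP[r2 r20 H2] := da _ e10.
  have /nbhs_normP[r3 r30 H3] := LE.
  pose r := Num.min r1 (Num.min r2 r3); have rr : 0 < r by rewrite !lt_min r10 r20.
  have s0 : 0 < r / 2 by rewrite divr_gt0.
  have sr : r / 2 < r by rewrite ltr_pdivrMr// ltr_pMr// ltr1n.
  have [s1 s2 s3] : [/\ r / 2 < r1, r / 2 < r2 & r / 2 < r3].
    by move: sr; rewrite {2}/r !lt_min => /and3P.
  exists (r / 2); split=> //; split.
  - have := H1 (r / 2); rewrite subr0 gtr0_norm//= => /(_ s1).
    by rewrite add0r lf_flow0 mulgV lcoord1 subr0.
  - have := H2 (r / 2); rewrite subr0 gtr0_norm// => /(_ s2).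
    by rewrite add0r !dflow0.
  - by have := H3 (r / 2); rewrite subr0 gtr0_norm//; apply.
have F1 : s * `|k - delta w| <= s * (c * `|delta w| + e).
  rewrite -{1}(ger0_norm (ltW s0)) -normrZ scalerBr.
  have -> : s *: k - s *: delta w = (L s - (a s - w)) - (L s - s *: k) + (a s - w - s *: delta w).
    move: (L s) (s *: k) (s *: delta w) (a s - w) => l1 l2 l3 l4.
    by rewrite opprB (addrC (l1 - l4)) -addrA !subrKA.
  have := ler_normD (L s - (a s - w) - (L s - s *: k)) (a s - w - s *: delta w).
  have := ler_normB (L s - (a s - w)) (L s - s *: k).
  have G1 : `|a s - w| <= e1 * s + s * `|delta w|.
    have := ler_normD (a s - w - s *: delta w) (s *: delta w).
    by rewrite subrK normrZ (ger0_norm (ltW s0)); lra.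
  have G2 := ler_wpM2l c0 G1.
  have G3 : e1 * (2 + c) = e by rewrite /e1 divfK// gt_eqF// ltr_wpDr.
  have -> : s * (c * `|delta w| + e) = s * (c * `|delta w|) + e1 * s + e1 * s + c * (e1 * s).
    by rewrite -G3; ring.
  have -> : c * (e1 * s) = c * (e1 * s + s * `|delta w|) - s * (c * `|delta w|) by ring.
  lra.
by rewrite ler_pM2l// in F1.
Unshelve. all: by end_near. Qed.

(** Near time 0 write [c s] as [ex w]; then [w] is [s *: v] up to o(s), and [kappa_ex_estimate]
    differs from the linear term only by a quantity quadratic in |w|. *)
Lemma kappa_derive (c : R -> G) (v : V) : vel c v ->
  is_derive (0 : R) (1 : R) (fun s => kappa (c s)) (delta v).
Proof.
move=> vc; have [c0 cc /is_derive_leP dc] := vc.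
have [C [r [C0 r0 re HC]]] := kappa_ex_estimate.
have [K K0 HK] := lin_bound (gen_lin HR X).
have mC0 := @mC_gt0 R n G.
apply/is_derive_leP => e e0.
(* [D] is chosen so that the terms quadratic in |w| amount to at most [e / 2 * |s|] when |w| is
   below [e / (2 * D)]; the first-order error of the coordinates takes the other half. *)
pose D := (C * K + K * (4 * mC)) * (2 * (`|v| + 1)) + 1.
have D0 : 0 < D.
  by rewrite ltr_wpDl// mulr_ge0 ?addr_ge0 ?mulr_ge0 ?(ltW K0) ?(ltW mC0).
have e1 : 0 < Num.min 1 (e / (2 * K)) by rewrite lt_min ltr01/= divr_gt0// mulr_gt0.
have rho0 : 0 < Num.min r (e / (2 * D)) by rewrite lt_min r0/= divr_gt0// mulr_gt0.
have nw : \forall s \near (0 : R), exists2 w : V, `|w| <= Num.min r (e / (2 * D)) & ex w = c s.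
  by have := cc _ (@ex_nbhs _ _ G _ rho0).
have nd : \forall s \near (0 : R), `|lcoord (c s) - s *: v| <= Num.min 1 (e / (2 * K)) * `|s|.
  by apply: filterS (dc _ e1) => s /=; rewrite add0r c0 lcoord1 subr0.
apply: filterS2 nw nd => s [w wr wE]; rewrite add0r c0 kappa1 subr0 -wE.
rewrite le_min in wr; move/andP: wr => [wr wD].
have wer : `|w| <= erad by exact: le_trans re.
set l := lcoord (ex w); set E1 := Num.min 1 _ => Hl.
have E1K : E1 * K <= e / 2.
  apply: (@le_trans _ _ (e / (2 * K) * K)); first by rewrite ler_wpM2r ?(ltW K0)// /E1 ge_min lexx orbT.
  by rewrite le_eqVlt; apply/orP; left; apply/eqP; field; rewrite gt_eqF.
have E11 : E1 <= 1 by rewrite /E1 ge_min lexx.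
have s0 := normr_ge0 s; have v0 := normr_ge0 v; have w0 := normr_ge0 w.
have l1 : `|l| <= (`|v| + 1) * `|s|.
  have A1 := ler_normD (l - s *: v) (s *: v); rewrite subrK normrZ in A1.
  have A2 : E1 * `|s| <= 1 * `|s| by rewrite ler_wpM2r.
  by rewrite mulrDl (mulrC `|v|); lra.
have [_ w1] := lcoord_ex_bound wer; rewrite -/l in w1.
have w2 : `|w| <= 2 * (`|v| + 1) * `|s| by rewrite -mulrA; lra.
have lw : `|l - w| <= 4 * mC * `|w| * `|w|.
  have := @ex_strict R n G w 0 `|w| wer (lexx _); rewrite normr0 => /(_ w0).
  by rewrite ex0 lcoord1 !subr0.
have k1 : `|kappa (ex w) - delta w| <= C * `|w| * (K * `|w|).
  by apply: le_trans (HC w wr) _; rewrite ler_wpM2l ?HK// mulr_ge0.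
have k2 : `|delta w - s *: delta v| <= K * (4 * mC * `|w| * `|w| + E1 * `|s|).
  rewrite -(linZ _ _ (gen_lin HR X)) -(linB _ _ (gen_lin HR X)); apply: le_trans (HK _) _.
  rewrite ler_wpM2l ?(ltW K0)//.
  have := ler_normD (w - l) (l - s *: v); rewrite subrKA => /le_trans; apply.
  by apply: lerD => //; rewrite distrC.
have := ler_normD (kappa (ex w) - delta w) (delta w - s *: delta v); rewrite subrKA => /le_trans; apply.
apply: le_trans (lerD k1 k2) _.
have -> : C * `|w| * (K * `|w|) + K * (4 * mC * `|w| * `|w| + E1 * `|s|) =
  (C * K + K * (4 * mC)) * (`|w| * `|w|) + E1 * K * `|s| by ring.
have B0 : 0 <= C * K + K * (4 * mC) by rewrite addr_ge0// !mulr_ge0// ltW.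
have W2 : `|w| * `|w| <= e / (2 * D) * (2 * (`|v| + 1) * `|s|) by exact: ler_pM.
have W3 := ler_wpM2l B0 W2; have W4 := ler_wpM2r s0 E1K.
have W5 : (C * K + K * (4 * mC)) * (e / (2 * D) * (2 * (`|v| + 1) * `|s|)) <= e / 2 * `|s|.
  have -> : (C * K + K * (4 * mC)) * (e / (2 * D) * (2 * (`|v| + 1) * `|s|)) =
      (D - 1) / D * (e / 2 * `|s|).
    by rewrite /D; field; rewrite gt_eqF// -/D.
  apply: ler_piMl; first by rewrite mulr_ge0// divr_ge0// ltW.
  by rewrite ler_pdivrMr// mul1r; have := D0; lra.
have := lerD (le_trans W3 W5) W4; rewrite -mulrDl => /le_trans; apply.
by rewrite -splitr.
Qed.

End KappaDerivative.

Local Opaque dfe rinv.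

(** * The Lie bracket on tangent vectors *)

Section LieBracket.
Context {R : realType} {n : nat} {G : lieGroupType R n}.
Local Notation V := 'rV[R]_n.
Hypothesis HR : forall Y : operator G, right_invariant Y -> exists v : V, Y = rinv v.

Lemma brack_ex (v w : V) : exists u : V, bracket (rinv v) (rinv w) = rinv u :> operator G.
Proof. by apply: HR; apply: right_invariant_bracket; exact: right_invariant_rinv. Qed.

Definition brack (v w : V) : V := projT1 (cid (brack_ex v w)).

Lemma brackE v w : bracket (rinv v) (rinv w) = rinv (brack v w) :> operator G.
Proof. by rewrite /brack; case: cid. Qed.

Lemma brack_dfe v w (f : G -> R) : smoothG f ->
  dfe f (brack v w) = dfe (rinv w f) v - dfe (rinv v f) w.
Proof.
move=> fs; rewrite -rinv1// -brackE /bracket.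
by rewrite !rinv1//; exact: smooth_rinv.
Qed.

Local Opaque brack.

(* Stated on bare reals: rewriting with the identities on [dfe] unfolds it. *)
Lemma bilinear_difference (a x l y1 y2 p q p1 p2 q1 q2 : R) :
  x = p - q -> p = a * p1 + p2 -> q = a * q1 + q2 -> y1 = p1 - q1 -> y2 = p2 - q2 ->
  l = a * y1 + y2 -> x = l.
Proof. by move=> -> -> -> -> -> ->; ring. Qed.

Lemma opposite_difference (x y l p q : R) : x = p - q -> y = q - p -> l = (-1) * y -> x = l.
Proof. by move=> -> -> ->; ring. Qed.

Lemma brack_linr v : lin (brack v).
Proof.
move=> a w w'; apply: (@dfe_inj _ _ G) => f fs; have S u := smooth_rinv u fs.
have E1 : dfe (rinv (a *: w + w') f) v = a * dfe (rinv w f) v + dfe (rinv w' f) v.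
  by rewrite -rinv_lin; exact: (dfe_linf a v (S w) (S w')).
exact: (bilinear_difference (brack_dfe v (a *: w + w') fs) E1 (dfe_lin a w w' (S v))
  (brack_dfe v w fs) (brack_dfe v w' fs) (dfe_lin a (brack v w) (brack v w') fs)).
Qed.

Lemma brackN v w : brack v w = - brack w v.
Proof.
apply: (@dfe_inj _ _ G) => f fs; rewrite -scaleN1r.
exact: (opposite_difference (brack_dfe v w fs) (brack_dfe w v fs) (dfeZ (-1) (brack w v) fs)).
Qed.

Lemma brack_linl w : lin (brack^~ w).
Proof. by move=> a v v' /=; rewrite !(brackN _ w) brack_linr scalerN opprD. Qed.

Lemma brack_bound : exists2 B : R, 0 <= B & forall v w, `|brack v w| <= B * `|v| * `|w|.
Proof.
have /choice[K HK] : forall i, exists K : R, 0 <= K /\ forall w, `|brack (delta_mx 0 i) w| <= K * `|w|.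
  by move=> i; have [K K0 HK] := lin_bound (brack_linr (delta_mx 0 i)); exists K; split=> //; exact: ltW.
exists (\sum_i K i); first by apply: sumr_ge0 => i _; case: (HK i).
move=> v w; have := @lin_bound_le _ _ _ (fun i => K i * `|w|) v (brack_linl w).
by rewrite -mulr_suml mulrAC; apply=> i; case: (HK i).
Qed.

Lemma brack_flow (X : linear_field G) t v w :
  dflow X t (brack v w) = brack (dflow X t v) (dflow X t w).
Proof.
have push u (f : G -> R) : smoothG f ->
    rinv (dflow X t u) f \o lf_flow X t = rinv u (f \o lf_flow X t).
  move=> fs; have fp : smoothG (f \o lf_flow X t) by exact: (smooth_endo_flow X t).2.
  apply/funext => x; have fx := smoothG_mulr (lf_flow X t x) fs.
  apply: etrans (rinvE (dflow X t u) (lf_flow X t x) fs) _.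
  apply: etrans (dfe_dflow X t u fx) _; apply: etrans _ (esym (rinvE u x fp)).
  by congr dfe; apply/funext => y /=; rewrite flowM.
apply: (@dfe_inj _ _ G) => f fs.
have fp : smoothG (f \o lf_flow X t) by exact: (smooth_endo_flow X t).2.
have S u := smooth_rinv u fs.
have key u u' : dfe (rinv (dflow X t u) f) (dflow X t u') = dfe (rinv u (f \o lf_flow X t)) u'.
  exact: etrans (dfe_dflow X t u' (S _)) (congr1 (fun g => dfe g u') (push u f fs)).
apply: etrans (dfe_dflow X t (brack v w) fs) _.
apply: etrans (brack_dfe v w fp) _.
apply: etrans _ (esym (brack_dfe (dflow X t v) (dflow X t w) fs)).
exact: (esym (congr2 (fun a b : R => a - b) (key w v) (key v w))).
Qed.

End LieBracket.

(** A functional vanishing on the subspace vanishes on the difference quotients of the curve, hence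
    on their limit; one that separates [l] from the subspace therefore cannot exist. Positive times
    are enough. *)
Lemma subspace_derive {R : realType} {n : nat} (b : 'rV[R]_n -> Prop) (c : R -> 'rV[R]_n) l :
  b 0 -> (forall a v w, b v -> b w -> b (a *: v + w)) ->
  is_derive (0 : R) (1 : R) c l -> c 0 = 0 -> (forall t, 0 < t -> b (c t)) -> b l.
Proof.
move=> b0 bD dc c0 bc; apply: contrapT => nb.
have [al [a0 an]] := subspace_functional b0 bD nb; move/eqP: an; apply.
pose A (v : 'rV[R]_n) := \sum_j v 0 j * al j.
pose K := 1 + \sum_j `|al j|.
have K0 : 0 < K by rewrite ltr_pwDl// sumr_ge0.
have AK v : `|A v| <= K * `|v|.
  rewrite (le_trans (ler_norm_sum _ _ _))// mulrDl mul1r ler_wpDl// mulr_suml.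
  by apply: ler_sum => j _; rewrite normrM mulrC ler_wpM2l// norm_coord.
have Az a v : A (a *: v) = a * A v.
  by rewrite /A mulr_sumr; apply: eq_bigr => j _; rewrite mxE mulrA.
have AB v w : A (v - w) = A v - A w.
  by rewrite /A -sumrB; apply: eq_bigr => j _; rewrite !mxE mulrBl.
apply/eqP; rewrite -normr_eq0 eq_le normr_ge0 andbT; apply/ler_addgt0Pr => e e0.
have eK : 0 < e / K by rewrite divr_gt0.
have /is_derive_leP/(_ _ eK)/nbhs_normP[q q0 Hq] := dc.
have q20 : 0 < q / 2 by rewrite divr_gt0.
have := Hq (q / 2); rewrite subr0 gtr0_norm// ltr_pdivrMr// ltr_pMr// ltr1n => /(_ isT).
rewrite add0r c0 subr0 => H; have Ok : A (c (q / 2)) = 0 by exact/a0/bc.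
have := AK (c (q / 2) - (q / 2) *: l).
rewrite AB Ok sub0r normrN Az normrM gtr0_norm// => H2.
have H3 := le_trans H2 (ler_wpM2l (ltW K0) H).
have E3 : K * (e / K * (q / 2)) = q / 2 * e by field; rewrite gt_eqF.
by rewrite E3 ler_pM2l// in H3; rewrite add0r.
Qed.

Lemma kappa_bound {R : realType} {n : nat} {G : lieGroupType R n} (X : linear_field G)
    (K : set G) : compact K -> exists M : R, forall x, K x -> `|kappa X x| <= M.
Proof.
move=> cK; have cf : compact (kappa X @` K).
  by apply: continuous_compact => //; apply: continuous_subspaceT; exact: kappa_cont.
have [M [_ MP]] := compact_bounded cf; exists (`|M| + 1) => x Kx.
by apply: MP; [rewrite (le_lt_trans (ler_norm _))// ltrDl|exists x].
Qed.

(** * Subexponential growth from a bounded orbit *)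

Section BoundedOrbitGrowth.
Context {R : realType} {n m : nat} {G : lieGroupType R n}.
Local Notation V := 'rV[R]_n.
Variable S : linear_control_system m G.
Local Notation X := (drift S).
Local Notation phi := (lf_flow (drift S)).
Local Notation traj := (trajectory S).
Local Notation orbit := (positive_orbit S 1%g).
Hypothesis HR : forall Y : operator G, right_invariant Y -> exists v : V, Y = rinv v.
Hypothesis larc : LARC S.
Hypothesis Hb : bounded_subset orbit.
Local Notation delta := (gen HR X).
Local Notation LX := (dflow_linear_flow HR X).

Lemma orbit1 : orbit 1%g.
Proof.
by exists 1, (fun=> 0); split; [exact: ltr01|exact: controls0|rewrite trajectory_rest].
Qed.

Lemma orbit_step t u x : 0 < t -> controls S u -> orbit x ->
  orbit (traj t 1%g u * phi t x)%g.
Proof.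
move=> t0 cu [s [v [s0 cv ->]]]; exists (s + t), (concat s v u).
split; [exact: addr_gt0|exact: control_concat|].
by rewrite trajectory_concat// ltW.
Qed.

Lemma orbit_flow t x : 0 <= t -> orbit x -> orbit (phi t x).
Proof.
rewrite le_eqVlt => /orP[/eqP <-|t0]; first by rewrite lf_flow0.
by move=> /(orbit_step t0 (controls0 S)); rewrite trajectory_rest ?mul1g// ltW.
Qed.

(** Vectors with bounded forward trajectory under [dflow] form a subspace. It contains [kappa x] for
    [x] in the orbit, because [kappa] intertwines the flows and the orbit is forward invariant; so
    it contains the velocity of [kappa] along a trajectory with constant control, which is [delta]
    of the control vector. *)
Lemma control_growth i : exists M : R, forall t, 0 <= t ->
  `|dflow X t (delta (control_vector S i))| <= M.
Proof.
pose b v := exists M : R, forall t, 0 <= t -> `|dflow X t v| <= M.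
have b0 : b 0 by exists 0 => t _; rewrite dflow_0 normr0.
have bD (a : R) v w : b v -> b w -> b (a *: v + w).
  move=> [M HM] [M' HM']; exists (`|a| * M + M') => t t0.
  rewrite dflow_lin (le_trans (ler_normD _ _))// lerD ?HM'// normrZ ler_wpM2l//.
  exact: HM.
have bk x : orbit x -> b (kappa X x).
  have [M HM] := kappa_bound X Hb => Ox; exists M => t t0; rewrite -kappa_flow.
  by apply: HM; apply: subset_closure; exact: orbit_flow.
have [c [u [c0 Ou uE]]] := control_direction S i; have cu := controls_cst Ou.
have : b (delta (cvec S u)).
  apply: (subspace_derive b0 bD (kappa_derive HR X (vel_trajectory_start Ou))).
    by rewrite (trajectory0 1%g cu) kappa1.
  by move=> t t0; apply: bk; exists t, (fun=> u).
rewrite uE (linZ _ _ (gen_lin HR X)) => bc.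
have := bD c^-1 _ 0 bc b0; rewrite addr0 scalerA mulVf ?scale1r//.
by rewrite gt_eqF.
Qed.

Definition subexponential (v : V) : Prop := forall e : R, 0 < e ->
  exists C : R, forall t, 0 <= t -> `|dflow X t v| <= C * expR (e * t).

Lemma subexponential_lin (a : R) v w :
  subexponential v -> subexponential w -> subexponential (a *: v + w).
Proof.
move=> Hv Hw e e0; have [C HC] := Hv e e0; have [C' HC'] := Hw e e0.
exists (`|a| * C + C') => t t0; rewrite dflow_lin (le_trans (ler_normD _ _))// mulrDl.
by rewrite lerD ?HC'// normrZ -mulrA ler_wpM2l// HC.
Qed.

Lemma subexponential0 : subexponential 0.
Proof. by move=> e e0; exists 0 => t _; rewrite dflow_0 normr0 mul0r. Qed.

Lemma subexponential_control i : subexponential (control_vector S i).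
Proof.
move=> e e0; have [M HM] := control_growth i; set v := control_vector S i in HM *.
have M0 : 0 <= M by apply: le_trans (HM 0 (lexx _)).
(* Integrating the bounded derivative gives at most |v| + M t, and M t is at most (M / e) exp (e
   t). *)
exists (`|v| + M / e) => t t0.
have := @lflow_diff_ge0 _ _ _ _ LX v t M t0 M0 (fun s s0 _ => HM s s0) => H.
rewrite -(subrK v (dflow X t v)) (le_trans (ler_normD _ _))// addrC mulrDl lerD//.
  by rewrite ler_peMr// -expR0 ler_expR mulr_ge0// ltW.
apply: le_trans H _; have -> : M * t = M / e * (e * t) by field; rewrite gt_eqF.
rewrite ler_wpM2l ?divr_ge0// ?(ltW e0)//.
by have := expR_ge1Dx (e * t); lra.
Qed.

Lemma subexponential_gen v : subexponential v -> subexponential (delta v).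
Proof.
move=> Hv e e0; have [C HC] := Hv e e0; have [K K0 HK] := lin_bound (gen_lin HR X).
exists (K * C) => t t0; rewrite -(lflow_genC _ _ LX); apply: le_trans (HK _) _.
by rewrite -mulrA ler_wpM2l ?HC// ltW.
Qed.

(** The bracket is bilinear and commutes with the flow, so two rates e/2 add up to e. *)
Lemma subexponential_brack v w : subexponential v -> subexponential w ->
  subexponential (brack HR v w).
Proof.
move=> Hv Hw e e0; have e2 : 0 < e / 2 by rewrite divr_gt0.
have [C HC] := Hv _ e2; have [C' HC'] := Hw _ e2; have [B B0 HB] := brack_bound HR.
exists (B * C * C') => t t0; rewrite brack_flow; apply: le_trans (HB _ _) _.
have -> : e * t = e / 2 * t + e / 2 * t by field.
rewrite expRD; have -> (E : R) : B * C * C' * (E * E) = B * (C * E) * (C' * E) by ring.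
apply: ler_pM => //; [by rewrite mulr_ge0| |exact: HC'].
by rewrite ler_wpM2l// HC.
Qed.

Lemma subexponential_full v : subexponential v.
Proof.
pose h' : set (operator G) := [set Y | exists2 v, subexponential v & Y = rinv v].
have : h' (rinv v).
  have := right_invariant_rinv (G := G) v; rewrite larc; apply; split; last first.
    by move=> _ [i _ <-]; exists (control_vector S i);
      [exact: subexponential_control|exact: control_vectorP].
  split; last by move=> _ [w sw ->]; exists (delta w); [exact: subexponential_gen|exact: genE].
  split.
  - by move=> _ [w _ ->]; exact: right_invariant_rinv.
  - by exists 0; [exact: subexponential0|exact: rinv_0].
  - by move=> a _ _ [w sw ->] [w' sw' ->]; exists (a *: w + w');
      [exact: subexponential_lin|exact: rinv_lin].
  - by move=> _ _ [w sw ->] [w' sw' ->]; exists (brack HR w w');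
      [exact: subexponential_brack|exact: brackE].
by move=> [w sw /rinv_inj ->].
Qed.

Lemma bounded_orbit_no_growth (J : jordan_decomposition X) x a : 0 < a ->
  gen HR (hyp_part J) x = a *: x -> x = 0.
Proof. by move=> a0 Hx; apply: (eigen_growth Hx a0); exact: subexponential_full. Qed.

End BoundedOrbitGrowth.

(** * Recurrence of the maps [y * phi t g] on a compact set *)

Section Recurrence.
Context {R : realType} {n : nat} {G : lieGroupType R n}.
Local Notation V := 'rV[R]_n.
Hypothesis HR : forall Y : operator G, right_invariant Y -> exists v : V, Y = rinv v.
Variables (X : linear_field G) (J : jordan_decomposition X).
Local Notation H := (hyp_part J).
Local Notation N := (nil_part J).
Local Notation phi := (lf_flow X).
Local Notation phiH := (lf_flow H).
Local Notation kappa := (kappa X).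
Hypothesis cG : connected [set: G].

Lemma G0_kappa g : G0 J g -> gen HR H (kappa g) = 0.
Proof.
move=> Hg; have L := dflow_linear_flow HR H.
have E s : dflow H s (kappa g) = kappa g.
  have v1 := vel_tmap (smooth_endo_flow H s) (kappaP X g).
  apply: (vel_uniq v1); apply: vel_ext (kappaP X g) => h.
  by rewrite /= flowM flowV Hg -flow_commute// Hg.
have := lflow_derive L 0 (kappa g); rewrite (lflow0 L) => -[_ <-].
have -> : (fun s => dflow H s (kappa g)) = fun=> kappa g by apply/funext => s; exact: E.
exact: derive_cst.
Qed.

Lemma precompact_kappa (K : set G) g : compact K -> G0 J g ->
  (forall t, 0 <= t -> K (phi t g)) -> gen HR N (kappa g) = 0.
Proof.
move=> cK Hg HK; have [M HM] := kappa_bound X cK.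
apply: (bounded_nil (G0_kappa Hg) (M := M)) => t t0.
by rewrite -kappa_flow; apply: HM; exact: HK.
Qed.

(** The inverse maps [Ad x^-1] have columns that are continuous in [x], hence bounded on the compact
    set. *)
Lemma Ad_bound (K : set G) : compact K ->
  exists2 C : R, 0 <= C & forall x v, K x -> `|v| <= C * `|Ad x v|.
Proof.
move=> cK.
have /choice[M HM] : forall i : 'I_n, exists M : R,
    forall x, K x -> `|Ad x^-1%g (delta_mx 0 i)| <= M.
  move=> i; have cf : compact ((fun x => Ad x^-1%g (delta_mx 0 i)) @` K).
    apply: continuous_compact => //; apply: continuous_subspaceT => x.
    apply: (@continuous_comp G G V (fun x : G => x^-1)%g (fun u : G => Ad u (delta_mx 0 i : V))).
      exact: invg_cont.
    exact: Ad_cont.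
  have [M [_ MP]] := compact_bounded cf; exists (`|M| + 1) => x Kx.
  by apply: MP; [rewrite (le_lt_trans (ler_norm _))// ltrDl|exists x].
exists (\sum_i `|M i|); first exact: sumr_ge0.
move=> x v Kx; rewrite -{1}(AdK x v).
have lA : lin (Ad x^-1%g) by move=> a u w; exact: Ad_lin.
apply: (@lin_bound_le _ _ _ (fun i => `|M i|) _ lA) => i.
by apply: le_trans (HM i x Kx) _; exact: ler_norm.
Qed.

Variables (K0 : set G) (y : G) (t : R).
Hypothesis cK0 : compact K0.
Hypothesis K0G0 : K0 `<=` G0 J.
Hypothesis K0flow : forall s x, 0 <= s -> K0 x -> K0 (phi s x).
Hypothesis t0 : 0 <= t.
Let f (g : G) : G := (y * phi t g)%g.
Hypothesis K0f : forall x, K0 x -> K0 (f x).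

(** The map [f] moves a right factor by the flow alone, so iterates of [g * h] and of [g] differ by
    the flow of [h]. *)
Lemma iter_translate k g h : iter k f (g * h)%g = (iter k f g * phi (k%:R * t) h)%g.
Proof.
elim: k => [|k IH]; first by rewrite mul0r lf_flow0.
rewrite !iterS IH /f flowM mulgA; congr (_ * _)%g.
by rewrite -lf_flowD -natr1 mulrDl mul1r addrC.
Qed.

Lemma iter_K0 k g : K0 g -> K0 (iter k f g).
Proof. by move=> Kg; elim: k => // k IH; exact: K0f. Qed.

Lemma iter_cont k : continuous (iter k f).
Proof.
elim: k => [|k IH] x; first exact: cvg_id.
apply: mulg_cvg; first exact: cvg_cst.
by apply: (cvg_comp _ _ (IH x)); exact: flow_cont.
Qed.

(** If the iterates of order k and l are near a common cluster point, their values of [kappa] are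
    close. By the cocycle identity the difference is [Ad] of one iterate applied to the flow of
    [kappa h], where h is g^-1 times the iterate of order l - k. The flow is elliptic on [kappa h],
    so both maps have bounded inverses and [kappa h] itself is small. *)
Lemma kappa_recurrent g e : K0 g -> 0 < e ->
  exists2 k, (0 < k)%N & `|kappa (g^-1 * iter k f g)%g| <= e.
Proof.
move=> Kg e0; have [CE CE0 HE] := ell_lower HR J.
have [CA CA0 HA] := Ad_bound cK0.
have D0 : 0 < e / (1 + CE * CA) by rewrite divr_gt0// ltr_wpDr// mulr_ge0// ltW.
have [p Kp Hp] := cluster_seq cK0 (fun k => iter_K0 k Kg).
pose U := [set x : G | `|kappa p - kappa x| < e / (1 + CE * CA) / 2].
have nU : nbhs p U.
  have D2 : 0 < e / (1 + CE * CA) / 2 by rewrite divr_gt0.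
  by have /cvgrPdist_lt/(_ _ D2) := @kappa_cont _ _ _ X p.
have [k _ Uk] := Hp U nU 0%N; have [l kl Ul] := Hp U nU k.+1.
exists (l - k)%N; first by rewrite subn_gt0.
set h := (g^-1 * iter (l - k) f g)%g.
have Hh : G0 J h.
  by apply: G0M; [apply: G0V; exact: K0G0|apply: K0G0; exact: iter_K0].
have Nh : gen HR N (kappa h) = 0.
  apply: (precompact_kappa (mul_compact (_ : compact ((fun x : G => x^-1%g) @` K0)) cK0) Hh).
    by apply: continuous_compact => //; apply: continuous_subspaceT; exact: invg_cont.
  move=> s s0; rewrite /h flowM flowV; exists ((phi s g)^-1%g, phi s (iter (l - k) f g)) => //.
  split=> /=; last by apply: K0flow => //; exact: iter_K0.
  by exists (phi s g) => //; exact: K0flow.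
have lE : iter l f g = (iter k f g * phi (k%:R * t) h)%g.
  by rewrite -iter_translate /h mulVKg -iterD subnKC// ltnW.
have kE : Ad (iter k f g) (dflow X (k%:R * t) (kappa h)) = kappa (iter l f g) - kappa (iter k f g).
  by rewrite lE kappaM kappa_flow addrAC subrr add0r.
have B1 := HE (k%:R * t) (kappa h) (G0_kappa Hh) Nh.
have B2 := HA (iter k f g) (dflow X (k%:R * t) (kappa h)) (iter_K0 k Kg).
have B3 : `|kappa (iter l f g) - kappa (iter k f g)| <= e / (1 + CE * CA).
  rewrite -(subrKA (kappa p)) (le_trans (ler_normD _ _))// [leRHS]splitr lerD//.
    by rewrite distrC ltW.
  exact: ltW.
rewrite kE in B2; apply: le_trans B1 _; apply: le_trans (ler_wpM2l (ltW CE0) B2) _.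
rewrite mulrA; apply: le_trans (ler_wpM2l _ B3) _; first by rewrite mulr_ge0// ltW.
rewrite mulrCA ler_piMr ?(ltW e0)// ler_pdivrMr ?mul1r ?lerDr//.
by rewrite ltr_wpDr// mulr_ge0// ltW.
Qed.

(* Minimality of isometry-like maps: [g] lies in the closure of its own forward
   orbit. First the cocycle [kappa] recurs, which gives a limit point [g * z] with
   [z] fixed by the flow; then the powers of [z] recur. *)
Lemma translate_surjective g : K0 g -> exists2 k, K0 k & g = f k.
Proof.
move=> Kg.
pose w := closure [set x | exists2 k, (0 < k)%N & x = iter k f g].
have clK : closed (f @` K0).
  apply: compact_closedG; apply: continuous_compact => //; apply: continuous_subspaceT => x.
  by apply: mulg_cvg; [exact: cvg_cst|exact: flow_cont].
have wf : w `<=` f @` K0.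
  rewrite /w [X in _ `<=` X](closure_id _).1//; apply: closureS => _ [[//|k] _ ->].
  by exists (iter k f g) => //; exact: iter_K0.
have [z [zfix wz]] : exists z, (forall s, phi s z = z) /\ w (g * z)%g.
  have /choice[m Hm] : forall j : nat, exists k, (0 < k)%N /\
      `|kappa (g^-1 * iter k f g)%g| <= j.+1%:R^-1.
    by move=> j; have [|k k0 Hk] := @kappa_recurrent g j.+1%:R^-1 Kg _; [rewrite invr_gt0|exists k].
  have [p Kp Hp] := cluster_seq cK0 (fun j => iter_K0 (m j) Kg).
  exists (g^-1 * p)%g; rewrite mulVKg; split; last first.
    move=> U nU; have [j _ Uj] := Hp U nU 0%N.
    by exists (iter (m j) f g); split=> //; exists (m j) => //; case: (Hm j).
  apply: kappa_fixed; apply/eqP; rewrite -normr_eq0 eq_le normr_ge0 andbT.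
  apply/ler_addgt0Pr => e e0; rewrite add0r.
  have e2 : 0 < e / 2 by rewrite divr_gt0.
  have c : (fun x => kappa (g^-1 * x)%g) @ p --> kappa (g^-1 * p)%g.
    have c1 : (fun x : G => g^-1 * x)%g @ p --> (g^-1 * p)%g.
      by apply: mulg_cvg; [exact: cvg_cst|exact: cvg_id].
    exact: (cvg_comp _ _ c1 (@kappa_cont _ _ _ X _)).
  move/cvgrPdist_le/(_ _ e2) : c => nU.
  have [j jN Uj] := Hp _ nU (Num.bound (e / 2)^-1).
  have [_ Hj] := Hm j; rewrite -(subrK (kappa (g^-1 * iter (m j) f g)%g) (kappa (g^-1 * p)%g)).
  rewrite (le_trans (ler_normD _ _))// [leRHS]splitr lerD//.
  apply: le_trans Hj _; rewrite -[leRHS]invrK lef_pV2 ?posrE ?invr_gt0//.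
  have := @archi_boundP _ (e / 2)^-1; rewrite invr_ge0 (ltW e2) => /(_ isT)/ltW/le_trans; apply.
  by rewrite ler_nat (leq_trans jN).
(* As [z] is fixed by the flow, right translation by [z] commutes with [f] and carries the forward
   orbit of [g] to that of [g * z], which lies in the invariant closed set [w]. *)
have wstep x : w x -> w (x * z)%g.
  suff H : w `<=` [set x | w (x * z)%g] by exact: H.
  have clz : closed [set x | w (x * z)%g].
    apply: (@closed_comp _ _ (fun x : G => x * z)%g); last exact: closed_closure.
    by move=> x' _; apply: mulg_cvg; [exact: cvg_id|exact: cvg_cst].
  rewrite [X in _ `<=` X](closure_id _).1//; apply: closureS => _ [k k0 ->] /=.
  have -> : (iter k f g * z)%g = iter k f (g * z)%g by rewrite iter_translate zfix.
  have clk : closed [set x | w (iter k f x)].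
    by apply: (@closed_comp _ _ (iter k f)); [move=> x' _; exact: iter_cont|exact: closed_closure].
  suff : w `<=` [set x | w (iter k f x)] by apply.
  rewrite [X in _ `<=` X](closure_id _).1//; apply: closureS => _ [l l0 ->] /=.
  by apply: subset_closure; exists (k + l)%N; [rewrite addn_gt0 k0|rewrite iterD].
have wpow j : w (g * z ^+ j.+1)%g.
  by elim: j => [|j IH]; rewrite ?expg1// expgSr mulgA; exact: wstep.
suff wg : w g by have [k Kk <-] := wf _ wg; exists k.
have wK0 : w `<=` K0 by move=> x /wf[k Kk <-]; exact: K0f.
have ww : closure w `<=` w by rewrite -(closure_id w).1//; exact: closed_closure.
apply: ww => B nB.
have nU : nbhs (1%g : G) ((fun u : G => g * u)%g @^-1` B).
  have c : (fun u : G => g * u)%g @ (1%g : G) --> (g * 1)%g.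
    by apply: mulg_cvg; [exact: cvg_cst|exact: cvg_id].
  by rewrite mulg1 in c; exact: (c _ nB).
(* The points [g * z ^+ j.+1] lie in the compact [K0]; a quotient of two of them is a positive power
   of [z], and it can be taken close to 1. *)
have [k [l [kl /= Bkl]]] := recurrent_seq cK0 (fun j => wK0 _ (wpow j)) nU.
exists (g * z ^+ (l - k))%g; split.
  by rewrite -(prednK (n := l - k)) ?subn_gt0//; exact: wpow.
move: Bkl; rewrite invgM -!mulgA mulKg.
have -> : (z ^+ l.+1 = z ^+ k.+1 * z ^+ (l - k))%g by rewrite -expgnDr addSn subnKC// ltnW.
by rewrite mulKg.
Qed.

End Recurrence.

(** * Structure of the group under a bounded orbit *)

Section BoundedOrbitStructure.
Context {R : realType} {n m : nat} {G : lieGroupType R n}.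
Local Notation V := 'rV[R]_n.
Variable S : linear_control_system m G.
Local Notation X := (drift S).
Local Notation phi := (lf_flow (drift S)).
Local Notation traj := (trajectory S).
Local Notation orbit := (positive_orbit S 1%g).
Variable J : jordan_decomposition (drift S).
Local Notation H := (hyp_part J).
Local Notation phiH := (lf_flow (hyp_part J)).
Hypothesis cG : connected [set: G].
Hypothesis HR : forall Y : operator G, right_invariant Y -> exists v : V, Y = rinv v.
Hypothesis Hneg : forall x a, 0 < a -> gen HR H x = a *: x -> x = 0.
Local Notation gproj := (gproj cG Hneg).

(** The hyperbolic flow takes [g] into the range of the exponential, at a point whose logarithm is a
    sum of eigenvectors with negative eigenvalue. Flowing back keeps each eigenspace. *)
Lemma kernel_Gminus g : gproj g = 1%g -> Gminus J g.
Proof.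
move=> g1; have [e e0 He] := kernel_small cG Hneg.
have lg : phiH t g @[t --> +oo] --> (1%g : G).
  by rewrite -[X in _ --> X]g1; exact: gproj_cvg.
have ne : \forall t \near +oo, (@gexp R n G @` [set v | `|v| <= e]) (phiH t g).
  exact: (lg _ (@gexp_nbhs R n G e e0)).
have [t [w /= we wE]] := filter_ex ne.
have w0 : hproj Hneg w = 0.
  apply: He => //; rewrite wE -g1; apply: gproj_uniq.
  have -> : (fun s => phiH s (phiH t g)) = (fun s => phiH (s + t) g).
    by apply/funext => s; rewrite lf_flowD.
  exact: (cvg_comp _ _ (cvg_addrr t) (@gproj_cvg _ _ _ cG HR _ J Hneg g)).
have [k [x [a [wx Hx]]]] := hproj_negative w0.
have L := dflow_linear_flow HR H.
pose z i := dflow H (- t) (x i).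
have gE : g = gexp (\sum_i z i).
  by rewrite -(lin_sum _ _ (lflow_lin L (- t))) -wx -gexp_flow wE flowK.
exists (rinv (\sum_i z i)); last first.
  exists (fun s => gexp (s *: \sum_i z i)); split; first exact: gexp_curve.
    by rewrite scale0r gexp0.
  by rewrite scale1r gE.
exists k, a, (fun i => rinv (z i)); split.
  move=> i; have [ai xi] := Hx i; split=> //; first exact: right_invariant_rinv.
  rewrite (genE HR) /z (lflow_genC _ _ L) xi (linZ _ _ (lflow_lin L _)).
  have := rinv_lin (G := G) (a i) (dflow H (- t) (x i)) 0; rewrite addr0 => <-.
  by rewrite -rinv_0; apply/funext => f; apply/funext => u; rewrite addr0.
have := rinv_sum (G := G) (index_enum 'I_k) (fun=> 1) z.
by under [in RHS]eq_bigr do rewrite scale1r; move=> <-.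
Qed.

Lemma no_growth_Gminus0 : [set: G] = Gminus0 J.
Proof.
apply/esym/seteqP; split=> // g _; exists (g * (gproj g)^-1)%g, (gproj g); split.
- by apply: kernel_Gminus; exact: gproj_ker.
- exact: G0_gproj.
- by rewrite mulgVK.
Qed.

Hypothesis larc : LARC S.
Hypothesis Hb : bounded_subset orbit.

Let K0 : set G := gproj @` closure orbit.

Let cK0 : compact K0.
Proof. by apply: continuous_compact => //; apply: continuous_subspaceT; exact: gproj_cont. Qed.

Let K0G0 : K0 `<=` G0 J.
Proof. by move=> _ [x _ <-]; exact: G0_gproj. Qed.

Let K01 : K0 1%g.
Proof. by exists 1%g; [exact/subset_closure/orbit1|exact: gproj1]. Qed.

Let closed_orbit_step t u x : 0 < t -> controls S u -> closure orbit x ->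
  closure orbit (traj t 1%g u * phi t x)%g.
Proof.
move=> t0 cu; pose F (x : G) := (traj t 1%g u * phi t x)%g.
suff : closure orbit `<=` F @^-1` closure orbit by apply.
have clF : closed (F @^-1` closure orbit).
  apply: closed_comp; last exact: closed_closure.
  by move=> x' _; apply: mulg_cvg; [exact: cvg_cst|exact: flow_cont].
rewrite [X in _ `<=` X](closure_id _).1//; apply: closureS => x' Ox.
by apply: subset_closure; exact: orbit_step.
Qed.

Let K0_step t u x : 0 < t -> controls S u -> K0 x -> K0 (gproj (traj t 1%g u) * phi t x)%g.
Proof.
move=> t0 cu [x' Ox <-]; exists (traj t 1%g u * phi t x')%g; first exact: closed_orbit_step.
by rewrite gprojM gproj_flow.
Qed.

Let K0_flow_ge0 s x : 0 <= s -> K0 x -> K0 (phi s x).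
Proof.
rewrite le_eqVlt => /orP[/eqP <-|s0]; first by rewrite lf_flow0.
by move=> /(K0_step s0 (controls0 S)); rewrite trajectory_rest ?gproj1 ?mul1g// ltW.
Qed.

Let K0_surjective t u g : 0 < t -> controls S u -> K0 g ->
  exists2 k, K0 k & g = (gproj (traj t 1%g u) * phi t k)%g.
Proof.
move=> t0 cu Kg.
by have [k Kk ->] := translate_surjective HR cG cK0 K0G0 K0_flow_ge0
  (fun x => K0_step t0 cu) Kg; exists k.
Qed.

(** The orbit is only forward invariant. Backward invariance of [K0] is surjectivity of the step
    with zero control, which is the flow itself. *)
Let K0_flow s x : K0 x -> K0 (phi s x).
Proof.
move=> Kx; case: (leP 0 s) => s0; first exact: K0_flow_ge0.
have s1 : 0 < - s by rewrite oppr_gt0.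
have [k Kk ->] := K0_surjective s1 (controls0 S) Kx.
by rewrite trajectory_rest ?(ltW s1)// gproj1 mul1g flowVK.
Qed.

Lemma bounded_orbit_compact_G0 : compact (G0 J).
Proof.
(* Including the inverse in the condition makes [L] a subgroup; for points of the orbit this half is
   the surjectivity obtained from recurrence. *)
pose L := [set g | forall k, K0 k -> K0 (gproj g * k)%g /\ K0 ((gproj g)^-1 * k)%g].
have LT : L = setT.
  apply: (@subgroup_full _ _ _ _ S L) => //.
  - by move=> k Kk; rewrite gproj1 invg1 !mul1g.
  - move=> x y Lx Ly k Kk; rewrite gprojM invgM -!mulgA.
    have [Ky1 Ky2] := Ly k Kk; have [Kx1 Kx2] := Lx k Kk.
    by split; [case: (Lx _ Ky1)|case: (Ly _ Kx2)].
  - by move=> x Lx k Kk; rewrite gprojV invgK; have [] := Lx k Kk.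
  - move=> t x Lx k Kk; rewrite gproj_flow.
    have [K1 K2] := Lx _ (K0_flow (- t) Kk).
    have := K0_flow t K1; have := K0_flow t K2.
    by rewrite !flowM flowV flowVK.
  - move=> _ [t [u [t0 cu ->]]] k Kk; split.
      by have := K0_step t0 cu (K0_flow (- t) Kk); rewrite flowVK.
    have [k' Kk' ->] := K0_surjective t0 cu Kk.
    by rewrite mulKg; exact: K0_flow.
  - have clK := compact_closedG cK0.
    have -> : L = \bigcap_(k in K0) ([set g | K0 (gproj g * k)%g] `&`
        [set g | K0 ((gproj g)^-1 * k)%g]).
      by apply/seteqP; split=> x Lx k Kk; have := Lx k Kk.
    apply: closed_bigI => k _; apply: closedI.
      apply: (@closed_comp _ _ (fun g : G => gproj g * k)%g) => // x _.
      by apply: mulg_cvg; [exact: gproj_cont|exact: cvg_cst].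
    apply: (@closed_comp _ _ (fun g : G => (gproj g)^-1 * k)%g) => // x _.
    by apply: mulg_cvg; [apply: invg_cvg; exact: gproj_cont|exact: cvg_cst].
(* An element of G^0 is its own projection, so it translates the point 1 of [K0] to itself. *)
have G0K : G0 J `<=` K0.
  move=> g Hg; have : L g by rewrite LT.
  by move=> /(_ _ K01)[]; rewrite mulg1 gproj_G0.
by apply: (subclosed_compact _ cK0) => //; exact: closed_fixed.
Qed.

End BoundedOrbitStructure.

Theorem theorem4p4 (R : realType) (n m : nat) (G : lieGroupType R n)
    (S : linear_control_system m G) (J : jordan_decomposition (drift S)) :
  connected [set: G] ->
  LARC S ->
  (([set: G] = Gminus0 J /\ is_subgroup (G0 J) /\ compact (G0 J)) <->
   bounded_subset (positive_orbit S 1%g)) /\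
  (bounded_subset (positive_orbit S 1%g) <->
   forall u, controls S u ->
     bounded_subset [set trajectory S t 1%g u | t in [set t | 0 <= t]]).
Proof.
move=> cG larc; have HR (Y : operator G) : right_invariant Y -> exists v, Y = rinv v.
  exact: (larc_rinv larc).
split; split.
- move=> [GE [_ cG0]]; apply: (no_growth_bounded_orbit cG _ cG0).
  exact: (Gminus0_no_growth GE).
- move=> Hb; have Hneg x a := @bounded_orbit_no_growth _ _ _ _ S HR larc Hb J x a.
  split; first exact: (no_growth_Gminus0 cG Hneg).
  split; first exact: G0_subgroup.
  exact: (bounded_orbit_compact_G0 cG Hneg).
- by move=> Hb u cu; exact: orbit_bounded_trajectories.
- exact: trajectories_bounded_orbit.
Qed.
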